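(* To any mutually externally tangent (proper) circles $C_1,C_2,C_3$ in an Apollonian circle packing, there exists a corresponding Apollonian triangulation $\mathcal{S}$. Moreover, the closure of $\mathcal{S}$ is convex.
   Context: An Apollonian circle packing is a minimal set of circles (lines allowed) containing some triple of pairwise tangent circles and closed under adding, for each pairwise tangent triple, the two circles tangent to all three. A proper circle is a circle that is not a line; all circles below are proper. **Apollonian curves.** The successor of three pairwise externally tangent circles is the circle tangent to all three inscribed in the bounded region between them. Let $(C_0,C_1,C_2)$ be pairwise externally tangent, $c_0$ the center of $C_0$. For a circle $C$ with center $c$ externally tangent to $C_0$, let $\alpha(C)$ be the angle of the vector $c-c_0$ with the positive $x$-axis and let $\ell^{1/2}(C)=\mathbb{R}\,v^{1/2}$, where $v^{1/2}$ is a complex square root of $c-c_0\in\mathbb{R}^2=\mathbb{C}$. For tangent $C,C'$ both externally tangent to $C_0$, $s(C,C')$ is the successor of $(C_0,C,C')$. Let $\mathcal{C}$ be the smallest set of circles containing $C_1,C_2$ and with $s(C,C')\in\mathcal{C}$ for all tangent $C,C'\in\mathcal{C}$; the angles $\alpha(C)$, $C\in\mathcal{C}$, are taken in the interval $[\alpha(C_1),\alpha(C_2)]$ corresponding to the arc of $C_0$ bordering the bounded region between $C_0,C_1,C_2$. An Apollonian curve associated to $(C_0,C_1,C_2)$ is a nonconstant continuous $\gamma:[\alpha(C_1),\alpha(C_2)]\to\mathbb{R}^2$ with $\gamma(\alpha(C))-\gamma(\alpha(C'))\in\ell^{1/2}(s(C,C'))$ for all tangent $C,C'\in\mathcal{C}$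 (it is unique up to translation and scaling). **Apollonian triangles.** If $C$ is the successor of pairwise externally tangent $C^1,C^2,C^3$, the Apollonian triangle $\mathcal{T}_C$ is the bounded region (unique up to translation and scaling) enclosed by the images of Apollonian curves $\gamma_{12},\gamma_{23},\gamma_{31}$ for $(C,C^1,C^2),(C,C^2,C^3),(C,C^3,C^1)$ such that consecutive curves $\gamma_{ij},\gamma_{jk}$ agree at $\alpha(C^j)$; these three common endpoints are its vertices. The degenerate Apollonian triangle for $(C_1,C_2,C_3)$ is the compact region enclosed by the image of the Apollonian curve $\gamma$ for $(C_1,C_2,C_3)$ and the tangent lines to $\gamma$ at its endpoints; its vertices are the two endpoints of $\gamma$. **Apollonian triangulations.** Given pairwise externally tangent $C_1,C_2,C_3$, let $\mathcal{A}^-(C_1,C_2,C_3)$ be the smallest set of circles containing them and closed under adding successors of pairwise tangent triples. Each $C\in\mathcal{A}^-\setminus\{C_1,C_2,C_3\}$ is the successor of a unique triple in $\mathcal{A}^-$, giving $\mathcal{T}_C$. An Apollonian triangulation corresponding to $\{C_1,C_2,C_3\}$ is a union of Apollonian triangles $\mathcal{T}_C$, $C\in\mathcal{A}^-\setminus\{C_1,C_2,C_3\}$, together with degenerate Apollonian triangles $\mathcal{T}_{C_i}$ (for $(C_i,C_j,C_k)$, $\{i,j,k\}=\{1,2,3\}$), such that disjoint circles correspond to disjoint triangles, and for tangent $C,C'\in\mathcal{A}^-$ with radii $r(C')\le r(C)$, $\mathcal{T}_{C'}$ and $\mathcal{T}_C$ intersect at a vertex of $\mathcal{T}_{C'}$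 and their boundary curves meet there at right angles. *)

(* Defs.v *)
From HB Require Import structures.
From mathcomp Require Export all_boot all_order all_algebra.
From mathcomp Require Export complex.
From mathcomp Require Export all_classical all_reals all_analysis.
Set Implicit Arguments.
Unset Strict Implicit.
Unset Printing Implicit Defensive.
Import Order.TTheory GRing.Theory Num.Theory.
Import numFieldNormedType.Exports.
Local Open Scope classical_set_scope.
Local Open Scope ring_scope.

Definition plane (R : realType) : normedModType R := (R^o * R^o)%type.

(* The library norm on a product is the sup norm (same topology); lengths here
   are Euclidean. *)
Definition enorm (R : realType) (x : plane R) : R :=
  Num.sqrt (x.1 ^+ 2 + x.2 ^+ 2).

Definition dot (R : realType) (x y : plane R) : R := x.1 * y.1 + x.2 * y.2.

Definition cross (R : realType) (x y : plane R) : R := x.1 * y.2 - x.2 * y.1.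

Definition line_through (R : realType) (p u : plane R) : set (plane R) :=
  [set x | exists t : R, x = p + t *: u].

Definition boundary (R : realType) (A : set (plane R)) : set (plane R) :=
  closure A `\` interior A.

(* Union of the bounded connected components of the complement of K. *)
Definition bounded_complement (R : realType) (K : set (plane R)) :
    set (plane R) :=
  [set x | (~` K) x /\ bounded_set (connected_component (~` K) x)].

(* Regions enclosed by curves are closed, i.e., include their bounding curves:
   distinct Apollonian triangles are to meet at vertices. *)
Definition enclosed_region (R : realType) (K : set (plane R)) :
    set (plane R) :=
  closure (bounded_complement K).

(* p + R u is the tangent line at p to the curve(s) with image K. This is a
   property of the image, as Apollonian curves need not be differentiable in
   their parameter. K may lie on one side of p (endpoint) or have a cusp at p. *)
Definition tangent_direction (R : realType) (K : set (plane R))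
    (p u : plane R) : Prop :=
  [/\ u != 0, limit_point K p &
      (cross u (x - p) / enorm (x - p)) @[x --> within K p^'] --> (0 : R)].

Record circle (R : realType) := Circle {
  center : plane R;
  radius : R;
  radius_gt0 : 0 < radius }.

Definition circle_set (R : realType) (C : circle R) : set (plane R) :=
  [set x | enorm (x - center C) = radius C].

Definition closed_disk (R : realType) (C : circle R) : set (plane R) :=
  [set x | enorm (x - center C) <= radius C].

Definition open_disk (R : realType) (C : circle R) : set (plane R) :=
  [set x | enorm (x - center C) < radius C].

(* Circles with lines allowed, as subsets of the sphere option (plane R), where
   None is the point at infinity; two of them are tangent when they meet in
   exactly one point (so distinct parallel lines are tangent at None). *)
Definition sphere_circle (R : realType) (C : circle R) :
    set (option (plane R)) :=
  Some @` circle_set C.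

Definition sphere_line (R : realType) (n : plane R) (b : R) :
    set (option (plane R)) :=
  None |` (Some @` [set x | dot n x = b]).

Definition generalized_circle (R : realType) (K : set (option (plane R))) :
    Prop :=
  (exists C : circle R, K = sphere_circle C) \/
  (exists (n : plane R) (b : R), n != 0 /\ K = sphere_line n b).

Definition sphere_tangent (R : realType) (K L : set (option (plane R))) :
    Prop :=
  exists z, K `&` L = [set z].

(* The three tangency points are required to be distinct: otherwise there are
   infinitely many circles tangent to all three, instead of two. *)
Definition sphere_tangent_triple (R : realType)
    (K L M : set (option (plane R))) : Prop :=
  [/\ sphere_tangent K L, sphere_tangent L M, sphere_tangent M K &
      K `&` L `&` M = set0].

Definition packing_closed (R : realType) (A : set (set (option (plane R)))) :
    Prop :=
  [/\ A `<=` @generalized_circle R,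
      exists K L M, [/\ A K, A L, A M & sphere_tangent_triple K L M] &
      forall K L M N, A K -> A L -> A M -> sphere_tangent_triple K L M ->
        generalized_circle N ->
        sphere_tangent N K -> sphere_tangent N L -> sphere_tangent N M ->
        A N].

Definition apollonian_packing (R : realType)
    (A : set (set (option (plane R)))) : Prop :=
  packing_closed A /\
  forall B, packing_closed B -> B `<=` A -> B = A.

Definition ext_tangent (R : realType) (C D : circle R) : Prop :=
  enorm (center C - center D) = radius C + radius D.

Definition ext_tangent_triple (R : realType) (C D E : circle R) : Prop :=
  [/\ ext_tangent C D, ext_tangent D E & ext_tangent E C].

(* The bounded region between three pairwise externally tangent circles. *)
Definition gap (R : realType) (C D E : circle R) : set (plane R) :=
  bounded_complement (closed_disk C `|` closed_disk D `|` closed_disk E).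

(* S is the successor of (C, D, E). *)
Definition is_successor (R : realType) (C D E S : circle R) : Prop :=
  [/\ ext_tangent_triple C D E,
      [/\ ext_tangent S C, ext_tangent S D & ext_tangent S E] &
      open_disk S `<=` gap C D E].

(* The circles C, written $\mathcal{C}$, at whose angles alpha(C) the curve for
   (C0, C1, C2) is constrained; all are externally tangent to C0. *)
Definition successor_chain (R : realType) (C0 C1 C2 : circle R) :
    set (circle R) :=
  smallest
    [set G | forall C C' S, G C -> G C' -> ext_tangent C C' ->
                is_successor C0 C C' S -> G S]
    [set C1; C2].

(* $\mathcal{A}^-(C_1,C_2,C_3)$ *)
Definition inner_packing (R : realType) (C1 C2 C3 : circle R) :
    set (circle R) :=
  smallest
    [set G | forall C D E S, G C -> G D -> G E ->
                is_successor C D E S -> G S]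
    [set C1; C2; C3].

Definition polar (R : realType) (r t : R) : plane R := (r * cos t, r * sin t).

Definition is_angle (R : realType) (v : plane R) (t : R) : Prop :=
  v = polar (enorm v) t.

(* The line spanned by a complex square root of w (the two roots are opposite,
   so they span the same line). *)
Definition sqrt_line (R : realType) (w : plane R) : set (plane R) :=
  [set x | exists v : plane R,
     (v.1 +i* v.2)%C ^+ 2 = (w.1 +i* w.2)%C /\ exists t : R, x = t *: v].

(* Unordered: [alpha(C_1), alpha(C_2)] when the bordering arc runs
   counterclockwise from C_1 to C_2, [alpha(C_2), alpha(C_1)] otherwise. *)
Definition segm (R : realType) (a b : R) : set R :=
  `[Num.min a b, Num.max a b].

(* a1 and a2 are determinations of alpha(C1) and alpha(C2), chosen so that
   the angles between them sweep the arc of C0 bordering the gap. This fixes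
   them up to a common multiple of 2 pi. *)
Definition angle_range (R : realType) (C0 C1 C2 : circle R) (a1 a2 : R) :
    Prop :=
  [/\ is_angle (center C1 - center C0) a1,
      is_angle (center C2 - center C0) a2 &
      forall t, segm a1 a2 t ->
        closure (gap C0 C1 C2) (center C0 + polar (radius C0) t)].

Definition apollonian_curve (R : realType) (C0 C1 C2 : circle R) (a1 a2 : R)
    (g : R -> plane R) : Prop :=
  [/\ angle_range C0 C1 C2 a1 a2,
      {within segm a1 a2, continuous g},
      exists t t', [/\ segm a1 a2 t, segm a1 a2 t' & g t <> g t'] &
      forall C C' S t t',
        successor_chain C0 C1 C2 C -> successor_chain C0 C1 C2 C' ->
        ext_tangent C C' -> is_successor C0 C C' S ->
        segm a1 a2 t -> is_angle (center C - center C0) t ->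
        segm a1 a2 t' -> is_angle (center C' - center C0) t' ->
        sqrt_line (center S - center C0) (g t - g t')].

(* K is the image of an Apollonian curve for (C0, C1, C2) that goes from p (at
   alpha(C1)) to q (at alpha(C2)). *)
Definition apollonian_arc (R : realType) (C0 C1 C2 : circle R)
    (p q : plane R) (K : set (plane R)) : Prop :=
  exists a1 a2 g,
    [/\ apollonian_curve C0 C1 C2 a1 a2 g, g a1 = p, g a2 = q &
        K = g @` segm a1 a2].

(* T is an Apollonian triangle for the successor C of (C1, C2, C3), and V is
   its set of vertices. *)
Definition apollonian_triangle (R : realType) (C C1 C2 C3 : circle R)
    (T V : set (plane R)) : Prop :=
  is_successor C1 C2 C3 C /\
  exists p1 p2 p3 K12 K23 K31,
    [/\ apollonian_arc C C1 C2 p1 p2 K12,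
        apollonian_arc C C2 C3 p2 p3 K23,
        apollonian_arc C C3 C1 p3 p1 K31,
        T = enclosed_region (K12 `|` K23 `|` K31) &
        V = [set p1; p2; p3]].

Definition degenerate_triangle (R : realType) (C1 C2 C3 : circle R)
    (T V : set (plane R)) : Prop :=
  exists p q K u v,
    [/\ apollonian_arc C1 C2 C3 p q K,
        tangent_direction K p u,
        tangent_direction K q v,
        T = enclosed_region (K `|` line_through p u `|` line_through q v) &
        V = [set p; q]].

Definition meet_at_right_angle (R : realType) (T T' : set (plane R))
    (p : plane R) : Prop :=
  exists u u',
    [/\ tangent_direction (boundary T) p u,
        tangent_direction (boundary T') p u' &
        dot u u' = 0].

Definition apollonian_triangulation (R : realType) (C1 C2 C3 : circle R)
    (S : set (plane R)) : Prop :=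
  let A := inner_packing C1 C2 C3 in
  exists T V : circle R -> set (plane R),
  [/\ [/\ degenerate_triangle C1 C2 C3 (T C1) (V C1),
          degenerate_triangle C2 C3 C1 (T C2) (V C2) &
          degenerate_triangle C3 C1 C2 (T C3) (V C3)],
      forall C, A C -> ~ [set C1; C2; C3] C ->
        exists D1 D2 D3, [/\ A D1, A D2, A D3 &
          apollonian_triangle C D1 D2 D3 (T C) (V C)],
      forall C C', A C -> A C' ->
        circle_set C `&` circle_set C' = set0 -> T C `&` T C' = set0,
      forall C C', A C -> A C' -> ext_tangent C C' -> radius C' <= radius C ->
        exists p, [/\ V C' p, T C' `&` T C = [set p] &
                      meet_at_right_angle (T C') (T C) p] &
      S = \bigcup_(C in A) T C].

(* Main.v *)
(* The "spinors" of a triple of tangent circles are square roots x, y, z of the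
   directions between their centers, normalised so that x + y + z = 0. Seen from C0,
   the successor of (C0, C, C') has the sum of the spinors of C and C' as spinor,
   so the circles on C0 form a Farey tree, and all Apollonian curves are linear
   images of one curve from (0,0) to (1,1), the union of its images under
   (u,v) -> (u+v, v)/3 and (u,v) -> (2+u, 1+u+v)/3. Its tangents at the ends are
   horizontal and vertical, the one in the middle has slope 1.

   To the gap of a triple one assigns a convex hexagon with a right angle at
   each of the three points where two of the regions of the triple meet,
   spanned by the spinors of the triple. The region of each of the three circles cuts
   off a degenerate triangle of the hexagon. The triangle of the successor
   consists of three such cells in a common hub, one in each of the hexagons of
   the three subdivided triples; these hexagons, which have disjoint interiors, and the
   three cells cover the given hexagon, and the linear maps contract by 2/3. So the
   triangles are dense in the hexagon of the root triple, which is convex. The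
   regions of non-adjacent circles are separated by hexagons, while the circles
   themselves are separated by the inversive distance, which is linear in
   curvature, curvature times center and co-curvature and hence grows down the
   tree by the Descartes relation L(S') = 2 (L(C1) + L(C2) + L(S)) - L(C3). *)

(* The factor 1/3 is forced. Seen from [C0] the end circles have Farey coordinates (1,0) and (0,1)
   and their successor (1,1); the increments of the curve on the two halves must be parallel to
   (2,1) and (1,2) and add up to (1,1), so both coefficients are 1/3 and the middle point is (2/3,
   1/3). The two affine maps are thus the changes of basis from [a], [b] to [a], [a + b] and to
   [a + b], [b], divided by 3. The obstacle is that the conditions range over all pairs of circles.
   Pairs on different branches are separated at the triple where they branch. For the others every
   hexagon inherits an invariant from its parent: a circle placed earlier either belongs to the
   triple, and its region meets the hexagon exactly in a cell, or its region misses the hexagon and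
   the circle carries a numerical certificate of being disjoint from all circles to come. Contacts
   then become questions about one hexagon. Containments there are linear inequalities with
   coefficients in the positive numbers k1, k2, k3, K, settled by explicit nonnegative
   combinations. *)
Require Import Defs.
From mathcomp Require Import ring lra zify.
Set Implicit Arguments.
Unset Strict Implicit.
Unset Printing Implicit Defensive.
Import Order.TTheory GRing.Theory Num.Theory.
Import numFieldNormedType.Exports.
Local Open Scope classical_set_scope.
Local Open Scope ring_scope.

(** * The universal curve in homogeneous Farey coordinates *)

Section UniversalCurve.
Variable R : realType.
Implicit Types x y u v t : R.

(* The curve in homogeneous Farey parameters: x and y count how often the first
   and the second of two neighbouring circles enter a spinor. Subtracting the
   smaller from the larger descends to one of the two halves of the curve, each
   an affine copy of the whole, and truncated subtraction makes the other half
   contribute an endpoint. *)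
Fixpoint approx (n : nat) x y : R * R :=
  if n is m.+1 then
    let p := approx m (Num.max (x - y) 0) y in
    let q := approx m x (Num.max (y - x) 0) in
    ((p.1 + p.2 + q.1) / 3, (p.2 + q.1 + q.2) / 3)
  else (y / (x + y), y / (x + y)).

Arguments approx : simpl never.

Lemma approxS n x y (p := approx n (Num.max (x - y) 0) y)
    (q := approx n x (Num.max (y - x) 0)) :
  approx n.+1 x y = ((p.1 + p.2 + q.1) / 3, (p.2 + q.1 + q.2) / 3).
Proof. by []. Qed.

Definition quadrant x y := [/\ 0 <= x, 0 <= y & 0 < x + y].

Lemma quadrant_subl x y : quadrant x y -> quadrant (Num.max (x - y) 0) y.
Proof. by move=> [x0 y0 xy]; split=> //; case: (ltrP (x - y) 0) => h; lra. Qed.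

Lemma quadrant_subr x y : quadrant x y -> quadrant x (Num.max (y - x) 0).
Proof. by move=> [x0 y0 xy]; split=> //; case: (ltrP (y - x) 0) => h; lra. Qed.

Lemma approx0l n y : 0 < y -> approx n 0 y = (1, 1).
Proof.
elim: n y => [|n IH] y y0; first by rewrite /approx add0r divff ?gt_eqF.
rewrite approxS sub0r subr0 (max_r (_ : - y <= 0)) ?oppr_le0 ?(ltW y0) // (max_l (ltW y0)) !IH //=.
by congr (_, _); lra.
Qed.

Lemma approx0r n x : 0 < x -> approx n x 0 = (0, 0).
Proof.
elim: n x => [|n IH] x x0; first by rewrite /approx mul0r.
rewrite approxS sub0r subr0 (max_r (_ : - x <= 0)) ?oppr_le0 ?(ltW x0) // (max_l (ltW x0)) !IH //=.
by congr (_, _); lra.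
Qed.

Lemma approx_ge n x y : quadrant x y -> y <= x ->
  let p := approx n (x - y) y in
  (approx n.+1 x y).1 = (p.1 + p.2) / 3 /\ (approx n.+1 x y).2 = p.2 / 3.
Proof.
move=> [x0 y0 xy] yx p; rewrite approxS.
rewrite (max_l (_ : 0 <= x - y)) ?subr_ge0 // (max_r (_ : y - x <= 0)) ?subr_le0 //.
rewrite (approx0r n (_ : 0 < x)) /=; last by lra.
by split; lra.
Qed.

Lemma approx_le n x y : quadrant x y -> x <= y ->
  let q := approx n x (y - x) in
  (approx n.+1 x y).1 = (2 + q.1) / 3 /\
  (approx n.+1 x y).2 = (1 + q.1 + q.2) / 3.
Proof.
move=> [x0 y0 xy] xy' q; rewrite approxS.
rewrite (max_r (_ : x - y <= 0)) ?subr_le0 // (max_l (_ : 0 <= y - x)) ?subr_ge0 //.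
rewrite (approx0l n (_ : 0 < y)) /=; last by lra.
by split; lra.
Qed.

Lemma approx_bound n x y : quadrant x y ->
  [/\ 0 <= (approx n x y).1, (approx n x y).1 <= 1,
      0 <= (approx n x y).2 & (approx n x y).2 <= 1].
Proof.
elim: n x y => [|n IH] x y xyq.
  have [x0 y0 xy] := xyq.
  have h1 : y / (x + y) <= 1 by rewrite ler_pdivrMr // mul1r; lra.
  have h0 : 0 <= y / (x + y) by rewrite divr_ge0 // ltW.
  by split.
have [? ? ? ?] := IH _ _ (quadrant_subl xyq).
have [? ? ? ?] := IH _ _ (quadrant_subr xyq).
by rewrite approxS /=; split; lra.
Qed.

Lemma approx_mono n x y x' y' : quadrant x y -> quadrant x' y' ->
  x' * y <= x * y' ->
  (approx n x y).1 <= (approx n x' y').1 /\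
  (approx n x y).2 <= (approx n x' y').2.
Proof.
elim: n x y x' y' => [|n IH] x y x' y' xyq xyq' le.
  have [x0 y0 xy] := xyq; have [x0' y0' xy'] := xyq'.
  suff h : y / (x + y) <= y' / (x' + y') by [].
  by rewrite ler_pdivrMr // mulrAC ler_pdivlMr //; nra.
have [x0 y0 xy] := xyq; have [x0' y0' xy'] := xyq'.
have [|? ?] := IH _ _ _ _ (quadrant_subl xyq) (quadrant_subl xyq').
  case: (ltrP (x' - y') 0) => h1; case: (ltrP (x - y) 0) => h2; first by lra.
  - by have := mulr_ge0 h2 y0'; lra.
  - by have := mulr_ge0 (_ : 0 <= y - x) y0'; lra.
  - by lra.
have [|? ?] := IH _ _ _ _ (quadrant_subr xyq) (quadrant_subr xyq').
  case: (ltrP (y' - x') 0) => h1; case: (ltrP (y - x) 0) => h2; first by lra.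
  - by have := mulr_ge0 (_ : 0 <= x' - y') x0; lra.
  - by have := mulr_ge0 h1 x0; lra.
  - by lra.
by rewrite !approxS /=; split; lra.
Qed.

(** In each half a coordinate of the new point is, up to a constant, a third of at most two old
    coordinates; so each level contracts by 2/3 in the sup norm. At level 0 both points lie in the
    unit square. *)
Lemma approx_step n x y : quadrant x y ->
  `|(approx n.+1 x y).1 - (approx n x y).1| <= (2 / 3) ^+ n /\
  `|(approx n.+1 x y).2 - (approx n x y).2| <= (2 / 3) ^+ n.
Proof.
elim: n x y => [|n IH] x y xyq.
  have [? ? ? ?] := approx_bound 1 xyq; have [? ? ? ?] := approx_bound 0 xyq.
  by rewrite expr0 !ler_norml; split; lra.
have [x0 y0 xy] := xyq.
rewrite exprS; set c := _ ^+ n.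
case: (lerP y x) => h.
  have q' : quadrant (x - y) y by split; lra.
  have [-> ->] := approx_ge n.+1 xyq h; have [-> ->] := approx_ge n xyq h.
  have [] := IH _ _ q'; rewrite -/c !ler_norml => h1 h2.
  by split; lra.
have q' : quadrant x (y - x) by split; lra.
have [-> ->] := approx_le n.+1 xyq (ltW h); have [-> ->] := approx_le n xyq (ltW h).
have [] := IH _ _ q'; rewrite -/c !ler_norml => h1 h2.
by split; lra.
Qed.

(** The device by which bounds and identities of the approximations pass to the limit curve. *)
Lemma geometric_squeeze (a b c : R) :
  (forall n, a <= b + c * (2 / 3) ^+ n) -> a <= b.
Proof.
move=> h; apply/ler_addgt0Pr => e e0.
have cvg : (fun n => (2 / 3 : R) ^+ n) @ \oo --> (0 : R).
  by apply: cvg_expr; rewrite ger0_norm; lra.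
have d0 : 0 < e / (`|c| + 1) by rewrite divr_gt0 // ltr_wpDl.
have /cvgrPdist_lt/(_ _ d0)[N _ /(_ N (leqnn N))] := cvg.
rewrite sub0r normrN ltr_pdivlMr ?ltr_wpDl // => hN.
apply: le_trans (h N) _; rewrite lerD2l.
apply: le_trans (ltW hN).
apply: le_trans (ler_norm _) _; rewrite normrM mulrC.
by apply: ler_wpM2l => //; rewrite lerDl.
Qed.

(** The limit of the approximations, written as a supremum: the steps after level n sum to at most 3
    (2/3)^n, and subtracting this tail makes the sequence nondecreasing. *)
Definition curve1 x y : R := sup (range (fun n => (approx n x y).1 - 3 * (2 / 3) ^+ n)).
Definition curve2 x y : R := sup (range (fun n => (approx n x y).2 - 3 * (2 / 3) ^+ n)).

Lemma sup_geometric (f : nat -> R) :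
  (forall n, `|f n.+1 - f n| <= (2 / 3) ^+ n) ->
  forall n, `|sup (range (fun n => f n - 3 * (2 / 3) ^+ n)) - f n| <= 3 * (2 / 3) ^+ n.
Proof.
move=> hf.
have up n m : f n - 3 * (2 / 3) ^+ n <= f (n + m)%N - 3 * (2 / 3) ^+ (n + m).
  elim: m => [|m IH]; first by rewrite addn0.
  apply: le_trans IH _; rewrite addnS.
  have := hf (n + m)%N; rewrite exprS; set c := _ ^+ _; rewrite ler_norml; lra.
have dn n m : f (n + m)%N + 3 * (2 / 3) ^+ (n + m) <= f n + 3 * (2 / 3) ^+ n.
  elim: m => [|m IH]; first by rewrite addn0.
  apply: le_trans IH; rewrite addnS.
  have := hf (n + m)%N; rewrite exprS; set c := _ ^+ _; rewrite ler_norml; lra.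
have q0 n : 0 <= (2 / 3 : R) ^+ n by rewrite exprn_ge0 //; lra.
have ub n : ubound (range (fun n => f n - 3 * (2 / 3) ^+ n)) (f n + 3 * (2 / 3) ^+ n).
  move=> _ [m _ <-].
  have h1 := up m n; have h2 := dn n m; rewrite addnC in h1.
  by have := q0 (n + m)%N; lra.
move=> n; rewrite ler_norml.
have h1 : sup (range (fun n => f n - 3 * (2 / 3) ^+ n)) <= f n + 3 * (2 / 3) ^+ n.
  by apply: ge_sup; [exists (f 0 - 3 * (2 / 3) ^+ 0), 0 | exact: ub].
have h2 : f n - 3 * (2 / 3) ^+ n <= sup (range (fun n => f n - 3 * (2 / 3) ^+ n)).
  by apply: ub_le_sup; [exists (f 0 + 3 * (2 / 3) ^+ 0); exact: ub | exists n].
lra.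
Qed.

Lemma curve_approx n x y : quadrant x y ->
  `|curve1 x y - (approx n x y).1| <= 3 * (2 / 3) ^+ n /\
  `|curve2 x y - (approx n x y).2| <= 3 * (2 / 3) ^+ n.
Proof.
move=> q; split; first by apply: (sup_geometric (f := fun n => (approx n x y).1)) => m; have [] := approx_step m q.
by apply: (sup_geometric (f := fun n => (approx n x y).2)) => m; have [] := approx_step m q.
Qed.

Lemma curve_bound x y : quadrant x y ->
  [/\ 0 <= curve1 x y, curve1 x y <= 1, 0 <= curve2 x y & curve2 x y <= 1].
Proof.
move=> q; split; apply: (geometric_squeeze (c := 3)) => n;
  have [] := curve_approx n q; have [] := approx_bound n q; set c := _ ^+ n;
  rewrite !ler_norml; lra.
Qed.

Lemma curve_mono x y x' y' : quadrant x y -> quadrant x' y' ->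
  x' * y <= x * y' -> curve1 x y <= curve1 x' y' /\ curve2 x y <= curve2 x' y'.
Proof.
move=> q q' le; split; apply: (geometric_squeeze (c := 6)) => n;
  have [] := curve_approx n q; have [] := curve_approx n q';
  have [] := approx_mono n q q' le; set c := _ ^+ n; rewrite !ler_norml; lra.
Qed.

Lemma curve_homog x y x' y' : quadrant x y -> quadrant x' y' ->
  x' * y = x * y' -> curve1 x y = curve1 x' y' /\ curve2 x y = curve2 x' y'.
Proof.
move=> q q' e.
have [|a b] := @curve_mono x y x' y' q q'; first by rewrite e.
have [|c d] := @curve_mono x' y' x y q' q; first by rewrite e.
by split; apply/eqP; rewrite eq_le ?a ?b ?c ?d.
Qed.

Lemma curve0l y : 0 < y -> curve1 0 y = 1 /\ curve2 0 y = 1.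
Proof.
move=> y0; have q : quadrant 0 y by split; lra.
have [? ? ? ?] := curve_bound q.
by split; apply/eqP; rewrite eq_le; apply/andP; split=> //;
  apply: (geometric_squeeze (c := 3)) => n;
  have [] := curve_approx n q; rewrite approx0l //= !ler_norml; set c := _ ^+ n; lra.
Qed.

Lemma curve0r x : 0 < x -> curve1 x 0 = 0 /\ curve2 x 0 = 0.
Proof.
move=> y0; have q : quadrant x 0 by split; lra.
have [? ? ? ?] := curve_bound q.
by split; apply/eqP; rewrite eq_le; apply/andP; split=> //;
  apply: (geometric_squeeze (c := 3)) => n;
  have [] := curve_approx n q; rewrite approx0r //= !ler_norml; set c := _ ^+ n; lra.
Qed.

Lemma curve_ge x y : quadrant x y -> y <= x ->
  curve1 x y = (curve1 (x - y) y + curve2 (x - y) y) / 3 /\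
  curve2 x y = curve2 (x - y) y / 3.
Proof.
move=> q yx; have [x0 y0 xy] := q.
have q' : quadrant (x - y) y by split; lra.
by split; apply/eqP; rewrite eq_le; apply/andP; split;
  apply: (geometric_squeeze (c := 6)) => n;
  have [] := curve_approx n.+1 q; have [] := curve_approx n q';
  have [-> ->] := approx_ge n q yx; rewrite exprS; set c := _ ^+ n; rewrite !ler_norml; lra.
Qed.

Lemma curve_le x y : quadrant x y -> x <= y ->
  curve1 x y = (2 + curve1 x (y - x)) / 3 /\
  curve2 x y = (1 + curve1 x (y - x) + curve2 x (y - x)) / 3.
Proof.
move=> q yx; have [x0 y0 xy] := q.
have q' : quadrant x (y - x) by split; lra.
by split; apply/eqP; rewrite eq_le; apply/andP; split;
  apply: (geometric_squeeze (c := 6)) => n;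
  have [] := curve_approx n.+1 q; have [] := curve_approx n q';
  have [-> ->] := approx_le n q yx; rewrite exprS; set c := _ ^+ n; rewrite !ler_norml; lra.
Qed.

End UniversalCurve.

(** * Continuity of the universal curve *)

Section UniversalCurveContinuity.
Variable R : realType.

Lemma approx_continuous (T : topologicalType) n (f g : T -> R) (t0 : T) :
  {for t0, continuous f} -> {for t0, continuous g} -> quadrant (f t0) (g t0) ->
  {for t0, continuous (fun t => (approx n (f t) (g t)).1)} /\
  {for t0, continuous (fun t => (approx n (f t) (g t)).2)}.
Proof.
elim: n f g => [|n IH] f g cf cg q.
  have [x0 y0 xy] := q.
  suff h : {for t0, continuous (fun t => g t / (f t + g t))} by [].
  apply: (continuousM (t := fun t => (f t + g t)^-1)) => //.
  apply: (continuousV (s := fun t => f t + g t)); first by rewrite gt_eqF.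
  exact: continuousD.
have cl : {for t0, continuous (fun t => Num.max (f t - g t) 0)}.
  apply: (@continuous_max _ _ (fun t => f t - g t) (fun=> 0)); last exact: cst_continuous.
  exact: continuousB.
have cr : {for t0, continuous (fun t => Num.max (g t - f t) 0)}.
  apply: (@continuous_max _ _ (fun t => g t - f t) (fun=> 0)); last exact: cst_continuous.
  exact: continuousB.
have [L1 L2] := IH _ _ cl cg (quadrant_subl q).
have [R1 R2] := IH _ _ cf cr (quadrant_subr q).
split.
  apply: (continuousM (t := fun=> 3^-1)); last exact: cst_continuous.
  by apply: continuousD => //; exact: continuousD.
apply: (continuousM (t := fun=> 3^-1)); last exact: cst_continuous.
by apply: continuousD => //; exact: continuousD.
Qed.

Lemma uniform_limit_continuous (T : topologicalType) (f : nat -> T -> R) (h : T -> R) (t0 : T) :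
  (forall n, {for t0, continuous (f n)}) ->
  (\forall t \near t0, forall n, `|h t - f n t| <= 3 * (2 / 3) ^+ n) ->
  {for t0, continuous h}.
Proof.
move=> cf hf; apply/cvgrPdist_le => e e0.
have cvg0 : (fun n => (2 / 3 : R) ^+ n) @ \oo --> (0 : R).
  by apply: cvg_expr; rewrite ger0_norm; lra.
(* The approximation error is 3 times the power and enters twice; with e / 9 the two errors and the
   variation of [f N] are e / 3 each. *)
have /cvgrPdist_lt/(_ (e / 9))[|N _ /(_ N (leqnn N))] := cvg0; first by lra.
rewrite sub0r normrN => hN; have {}hN := le_lt_trans (ler_norm _) hN.
have h0 : forall n, `|h t0 - f n t0| <= 3 * (2 / 3) ^+ n by exact: nbhs_singleton hf.
have e3 : 0 < e / 3 by lra.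
have /cvgrPdist_le/(_ _ e3) U := cf N.
apply: filterS2 hf U => t ft /= fN.
have := ft N; have := h0 N; move: fN; rewrite !ler_norml; lra.
Qed.

(** The curve is only controlled on the quadrant, so both coordinates are clamped at 0; positivity
    of the sum at [t0] keeps nearby parameters in the quadrant, where convergence is uniform. *)
Lemma curve_continuous (T : topologicalType) (f g : T -> R) (t0 : T) :
  {for t0, continuous f} -> {for t0, continuous g} ->
  0 < Num.max (f t0) 0 + Num.max (g t0) 0 ->
  {for t0, continuous (fun t => curve1 (Num.max (f t) 0) (Num.max (g t) 0))} /\
  {for t0, continuous (fun t => curve2 (Num.max (f t) 0) (Num.max (g t) 0))}.
Proof.
move=> cf cg p.
have cf' : {for t0, continuous (fun t => Num.max (f t) 0)}.
  by apply: (@continuous_max _ _ f (fun=> 0)) => //; exact: cst_continuous.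
have cg' : {for t0, continuous (fun t => Num.max (g t) 0)}.
  by apply: (@continuous_max _ _ g (fun=> 0)) => //; exact: cst_continuous.
have m0 (r : R) : 0 <= Num.max r 0 by rewrite le_max lexx orbT.
have : \forall t \near t0, quadrant (Num.max (f t) 0) (Num.max (g t) 0).
  have : {for t0, continuous (fun t => Num.max (f t) 0 + Num.max (g t) 0)}.
    exact: continuousD.
  move=> /cvgrPdist_lt/(_ _ p); apply: filterS => t; rewrite ltr_norml => /andP[_ h].
  by split=> //; move: h; lra.
move=> q; have q0 := nbhs_singleton q.
split.
  apply: (@uniform_limit_continuous _
      (fun n t => (approx n (Num.max (f t) 0) (Num.max (g t) 0)).1)).
    by move=> n; have [] := approx_continuous n cf' cg' q0.
  by apply: filterS q => t q n; have [] := curve_approx n q.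
apply: (@uniform_limit_continuous _
    (fun n t => (approx n (Num.max (f t) 0) (Num.max (g t) 0)).2)).
  by move=> n; have [] := approx_continuous n cf' cg' q0.
by apply: filterS q => t q n; have [] := curve_approx n q.
Qed.

End UniversalCurveContinuity.

(** * Farey increments, flatness at the ends, and the affine parametrization *)

Section UnitCurve.
Variable R : realType.
Implicit Types x y u v t s : R.

(** The defining property of an Apollonian curve in universal coordinates: between Farey neighbours
    the increment points along their mediant. Euclidean descent maps neighbours to neighbours, and
    the linear part of each contraction carries the smaller mediant to a third of the larger one.
    The only pair that does not lie in one half is (1,0), (0,1). *)
Lemma farey_increment (m n m' n' : nat) : (m * n' = m' * n + 1)%N ->
  exists l : R,
    curve1 m'%:R n'%:R - curve1 m%:R n%:R = l * (m + m')%:R /\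
    curve2 m'%:R n'%:R - curve2 m%:R n%:R = l * (n + n')%:R.
Proof.
move: {2}(_ + _)%N (leqnn (m + n + m' + n')) => N; elim: N => [|N IH] in m n m' n' *.
  by move=> h d; exfalso; nia.
move=> hN d.
have quad (i j : nat) : (0 < i + j)%N -> @quadrant R i%:R j%:R.
  by move=> h; split; rewrite ?ler0n // -natrD ltr0n.
have q : @quadrant R m%:R n%:R by apply: quad; nia.
have q' : @quadrant R m'%:R n'%:R by apply: quad; nia.
have [/andP[mn mn']|h1] := boolP ((n <= m) && (n' <= m'))%N.
  have [||l [l1 l2]] := IH (m - n)%N n (m' - n')%N n'; [nia|nia|].
  have [|-> ->] := curve_ge q; first by rewrite ler_nat.
  have [|-> ->] := curve_ge q'; first by rewrite ler_nat.
  exists (l / 3); rewrite natrD in l1; rewrite natrD in l2.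
  by move: l1 l2; rewrite !natrB // !natrD => l1 l2; split; lra.
have [/andP[mn mn']|h2] := boolP ((m <= n) && (m' <= n'))%N.
  have [||l [l1 l2]] := IH m (n - m)%N m' (n' - m')%N; [nia|nia|].
  have [|-> ->] := curve_le q; first by rewrite ler_nat.
  have [|-> ->] := curve_le q'; first by rewrite ler_nat.
  exists (l / 3); rewrite natrD in l1; rewrite natrD in l2.
  by move: l1 l2; rewrite !natrB // !natrD => l1 l2; split; lra.
have [m0 n0] : m' = 0%N /\ n = 0%N by nia.
have [m1 n1] : m = 1%N /\ n' = 1%N by nia.
rewrite m0 n0 m1 n1; have [-> ->] := curve0l (ltr01 : 0 < 1 :> R).
by have [-> ->] := curve0r (ltr01 : 0 < 1 :> R); exists 1; split; lra.
Qed.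

(** Each application of the lower map (u, v) -> (u + v, v) / 3 raises u / v by 1, and a parameter
    with n y <= x lies in n nested lower halves. This yields the horizontal tangent at the start. *)
Lemma curve_flat n x y : quadrant x y -> n%:R * y <= x ->
  n%:R * curve2 x y <= curve1 x y.
Proof.
elim: n x y => [|n IH] x y q h; first by rewrite mul0r; have [] := curve_bound q.
have [x0 y0 xy] := q; rewrite -natr1 mulrDl mul1r in h.
have ny : 0 <= n%:R * y by rewrite mulr_ge0.
have [|-> ->] := curve_ge q; first by lra.
have q' : quadrant (x - y) y by split; lra.
have h' : n%:R * y <= x - y by lra.
have := IH _ _ q' h'.
by rewrite -natr1; lra.
Qed.

Lemma curve_n1 n : 3 ^- n <= curve1 n%:R (1 : R) /\ 3 ^- n <= curve2 n%:R (1 : R).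
Proof.
have quad k : @quadrant R k%:R 1 by split; rewrite ?ler0n // ltr_wpDl.
elim: n => [|n [IH1 IH2]].
  by rewrite expr0 invr1; have [-> ->] := curve0l (ltr01 : 0 < 1 :> R).
have [|-> ->] := curve_ge (quad n.+1); first by rewrite ler1n.
rewrite -[n.+1%:R]natr1 addrK exprS invfM.
have [? ? ? ?] := curve_bound (quad n); move: IH1 IH2; set c := _ ^- n; lra.
Qed.

(** The homogeneous parameter is (1 - t : t). Clamping makes the curve constant outside [0, 1], so
    parameters can range over the whole line. *)
Definition unit1 t := curve1 (Num.max (1 - t) 0) (Num.max t 0).
Definition unit2 t := curve2 (Num.max (1 - t) 0) (Num.max t 0).

Lemma quadrant_clamp t : quadrant (Num.max (1 - t) 0) (Num.max t 0).
Proof. by split; case: (ltrP (1 - t) 0) => h1; case: (ltrP t 0) => h2; lra. Qed.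

Lemma unit_bound t : [/\ 0 <= unit1 t, unit1 t <= 1, 0 <= unit2 t & unit2 t <= 1].
Proof. exact: curve_bound (quadrant_clamp t). Qed.

Lemma unit_mono t s : t <= s -> unit1 t <= unit1 s /\ unit2 t <= unit2 s.
Proof.
move=> ts; apply: curve_mono; try exact: quadrant_clamp.
case: (ltrP (1 - t) 0) => h1; case: (ltrP t 0) => h2;
  case: (ltrP (1 - s) 0) => h3; case: (ltrP s 0) => h4; try nra.
Qed.

Lemma unit0 t : t <= 0 -> unit1 t = 0 /\ unit2 t = 0.
Proof. by move=> t0; rewrite /unit1 /unit2 (max_r t0) max_l ?curve0r; try lra; apply: curve0r; lra. Qed.

Lemma unit1_ t : 1 <= t -> unit1 t = 1 /\ unit2 t = 1.
Proof.
move=> t0; rewrite /unit1 /unit2 (max_r (_ : 1 - t <= 0)) ?(max_l (_ : 0 <= t)); try lra.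
by apply: curve0l; lra.
Qed.

Lemma unit_curve x y : quadrant x y ->
  unit1 (y / (x + y)) = curve1 x y /\ unit2 (y / (x + y)) = curve2 x y.
Proof.
move=> q; have [x0 y0 xy] := q.
have h0 : 0 <= y / (x + y) by rewrite divr_ge0 // ltW.
have h1 : 1 - y / (x + y) = x / (x + y) by field; rewrite gt_eqF.
have h2 : 0 <= x / (x + y) by rewrite divr_ge0 // ltW.
rewrite /unit1 /unit2 h1 !max_l //; apply: curve_homog => //.
  by split=> //; rewrite -mulrDl divff ?gt_eqF.
by field; rewrite gt_eqF.
Qed.

Lemma unit_continuous : continuous unit1 /\ continuous unit2.
Proof.
suff h t : {for t, continuous unit1} /\ {for t, continuous unit2}.
  by split=> t; have [] := h t.
apply: (@curve_continuous _ _ (fun t => 1 - t) id).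
- by apply: continuousB; [exact: cst_continuous|exact: cvg_id].
- exact: cvg_id.
- by have [] := quadrant_clamp t.
Qed.

Lemma unit1_ivt a b u : a <= b -> unit1 a <= u <= unit1 b ->
  exists t, [/\ a <= t, t <= b & unit1 t = u].
Proof.
move=> ab h; have [|t] := @IVT R unit1 a b u ab (continuous_subspaceT (fst unit_continuous)).
  have [m _] := unit_mono ab; by rewrite (min_l m) (max_r m).
by rewrite in_itv /= => /andP[] ? ? <-; exists t.
Qed.

Lemma unit2_ivt a b u : a <= b -> unit2 a <= u <= unit2 b ->
  exists t, [/\ a <= t, t <= b & unit2 t = u].
Proof.
move=> ab h; have [|t] := @IVT R unit2 a b u ab (continuous_subspaceT (snd unit_continuous)).
  have [_ m] := unit_mono ab; by rewrite (min_l m) (max_r m).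
by rewrite in_itv /= => /andP[] ? ? <-; exists t.
Qed.

Lemma unit_low t : t <= 1 / 2 ->
  exists s, unit1 t = (unit1 s + unit2 s) / 3 /\ unit2 t = unit2 s / 3.
Proof.
move=> t2; case: (lerP t 0) => t0.
  exists 0; have [-> ->] := unit0 t0; have [-> ->] := unit0 (lexx 0); by split; lra.
have q : quadrant (1 - t) t by split; lra.
have q' : quadrant (1 - t - t) t by split; lra.
have [e1 e2] := unit_curve q; rewrite subrK divr1 in e1 e2.
exists (t / (1 - t - t + t)); have [-> ->] := unit_curve q'.
by rewrite e1 e2; apply: curve_ge => //; lra.
Qed.

Lemma unit_high t : 1 / 2 <= t ->
  exists s, unit1 t = (2 + unit1 s) / 3 /\ unit2 t = (1 + unit1 s + unit2 s) / 3.
Proof.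
move=> t2; case: (lerP 1 t) => t0.
  exists 1; have [-> ->] := unit1_ t0; have [-> ->] := unit1_ (lexx 1); by split; lra.
have q : quadrant (1 - t) t by split; lra.
have q' : quadrant (1 - t) (t - (1 - t)) by split; lra.
have [e1 e2] := unit_curve q; rewrite subrK divr1 in e1 e2.
exists ((t - (1 - t)) / (1 - t + (t - (1 - t)))); have [-> ->] := unit_curve q'.
by rewrite e1 e2; apply: curve_le => //; lra.
Qed.

Lemma unit_low' s :
  exists t, unit1 t = (unit1 s + unit2 s) / 3 /\ unit2 t = unit2 s / 3.
Proof.
have q := quadrant_clamp s; rewrite [unit1 s]/unit1 [unit2 s]/unit2.
move: (Num.max _ _) (Num.max _ _) q => y x q; have [x0 y0 xy] := q.
have q' : quadrant (x + y) y by split; lra.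
exists (y / (x + y + y)); have [-> ->] := unit_curve q'.
have [|-> ->] := curve_ge q'; first by lra. by rewrite addrK.
Qed.

Lemma unit_high' s :
  exists t, unit1 t = (2 + unit1 s) / 3 /\ unit2 t = (1 + unit1 s + unit2 s) / 3.
Proof.
have q := quadrant_clamp s; rewrite [unit1 s]/unit1 [unit2 s]/unit2.
move: (Num.max _ _) (Num.max _ _) q => y x q; have [x0 y0 xy] := q.
have q' : quadrant x (x + y) by split; lra.
exists ((x + y) / (x + (x + y))); have [-> ->] := unit_curve q'.
by have [|-> ->] := curve_le q'; [lra|rewrite [x + y]addrC addrK].
Qed.

(** On the two halves the difference of the coordinates is [unit1 s / 3] and [(1 - unit2 s) / 3].
    The bound 1/3 is attained at the middle point (2/3, 1/3), where the tangent has slope 1. *)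
Lemma unit_le t : unit2 t <= unit1 t /\ unit1 t - unit2 t <= 1 / 3.
Proof.
have [h|/ltW h] := lerP t (1 / 2).
  have [s [-> ->]] := unit_low h; have [? ? ? ?] := unit_bound s; split; lra.
have [s [-> ->]] := unit_high h; have [? ? ? ?] := unit_bound s; split; lra.
Qed.

(** The parameter (n : 1) separates the stretch of slope at most 1/n from points that stay at
    distance 3^-n from both axes; near the start only the first case remains. *)
Lemma curve_flat_or n x y : quadrant x y -> n%:R * curve2 x y <= curve1 x y \/
  3 ^- n <= curve1 x y /\ 3 ^- n <= curve2 x y.
Proof.
move=> q; case: (lerP (n%:R * y) x) => h; first by left; apply: curve_flat.
right; have [h1 h2] := curve_n1 n.
have qn : @quadrant R n%:R 1 by split; rewrite ?ler0n // ltr_wpDl.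
have [|l1 l2] := curve_mono qn q; first by rewrite mulr1 ltW.
by split; [apply: le_trans h1 l1|apply: le_trans h2 l2].
Qed.

Lemma unit_flat n t : n%:R * unit2 t <= unit1 t \/
  3 ^- n <= unit1 t /\ 3 ^- n <= unit2 t.
Proof. exact: curve_flat_or (quadrant_clamp t). Qed.

Lemma archimedean_ratio (a b : R) : 0 < b -> exists n : nat, a < n%:R * b.
Proof.
move=> b0; exists (Num.bound `|a / b|).
by rewrite -ltr_pdivrMr //; exact: le_lt_trans (ler_norm _) (archi_boundP (normr_ge0 _)).
Qed.

(** The curve leaves its initial tangent at once: any t > 0 lies beyond some (n : 1), where the
    height is at least 3^-n. *)
Lemma unit2_eq0 t : unit2 t <= 0 -> unit1 t = 0.
Proof.
move=> h; case: (lerP t 0) => [/unit0[]//|t0].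
have [n hn] := archimedean_ratio (1 - t) t0.
have [_ h2] := curve_n1 n.
have qn : @quadrant R n%:R 1 by split; rewrite ?ler0n // ltr_wpDl.
have [|_ l2] := curve_mono qn (quadrant_clamp t).
  rewrite mulr1 (max_l (ltW t0)); case: (ltrP (1 - t) 0) => h1; last exact: ltW.
  by rewrite mulr_ge0 // ltW.
have : 0 < 3 ^- n :> R by rewrite invr_gt0 exprn_gt0.
by move: l2 h2 h; rewrite -/(unit2 t); set c := _ ^- n; lra.
Qed.

(** The reflection (u, v) -> (1 - v, 1 - u) exchanges the two contractions and reverses the curve,
    so facts about the start transfer to the end. *)
Lemma approx_sym n x y : quadrant x y ->
  (approx n y x).1 = 1 - (approx n x y).2 /\ (approx n y x).2 = 1 - (approx n x y).1.
Proof.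
elim: n x y => [|n IH] x y q.
  have [x0 y0 xy] := q.
  by rewrite /approx /=; split; field; rewrite gt_eqF // addrC.
have [l1 l2] := IH _ _ (quadrant_subl q).
have [r1 r2] := IH _ _ (quadrant_subr q).
by rewrite !approxS /= l1 l2 r1 r2; split; lra.
Qed.

Lemma unit_sym t : unit1 (1 - t) = 1 - unit2 t /\ unit2 (1 - t) = 1 - unit1 t.
Proof.
rewrite /unit1 /unit2 opprB addrC subrK.
have q := quadrant_clamp t; move: (Num.max _ _) (Num.max _ _) q => y x q.
have q' : quadrant y x by have [? ? ?] := q; split=> //; rewrite addrC.
by split; apply/eqP; rewrite eq_le; apply/andP; split;
  apply: (geometric_squeeze (c := 6)) => n;
  have [] := curve_approx n q; have [] := curve_approx n q';
  have [-> ->] := approx_sym n q; set c := _ ^+ n; rewrite !ler_norml; lra.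
Qed.

Lemma unit1_eq1 t : 1 <= unit1 t -> unit2 t = 1.
Proof. by move=> h; have [e1 e2] := unit_sym t; have := @unit2_eq0 (1 - t); lra. Qed.

End UnitCurve.

(** * Topology of the plane and bounded components of a complement *)

Section PlaneBasics.
Variable R : realType.
Implicit Types p q x y : plane R.

Lemma fstD x y : (x + y).1 = x.1 + y.1 :> R. Proof. by []. Qed.
Lemma sndD x y : (x + y).2 = x.2 + y.2 :> R. Proof. by []. Qed.
Lemma fstN x : (- x).1 = - x.1 :> R. Proof. by []. Qed.
Lemma sndN x : (- x).2 = - x.2 :> R. Proof. by []. Qed.
Lemma fstZ (a : R) x : (a *: x).1 = a * x.1 :> R. Proof. by []. Qed.
Lemma sndZ (a : R) x : (a *: x).2 = a * x.2 :> R. Proof. by []. Qed.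
Lemma fst0 : (0 : plane R).1 = 0 :> R. Proof. by []. Qed.
Lemma snd0 : (0 : plane R).2 = 0 :> R. Proof. by []. Qed.
Definition coordE := (fstD, sndD, fstN, sndN, fstZ, sndZ, fst0, snd0).

Lemma plane_eq x y : x.1 = y.1 :> R -> x.2 = y.2 :> R -> x = y.
Proof. by case: x y => [? ?] [? ?] /= -> ->. Qed.

Lemma nbhs_planeP p (U : set (plane R)) :
  nbhs p U <-> exists2 e : R, 0 < e &
    forall q, `|q.1 - p.1 : R| < e -> `|q.2 - p.2 : R| < e -> U q.
Proof.
split=> [/nbhs_ballP[e /= e0 h]|[e e0 h]].
  by exists e => // q h1 h2; apply: h; split; rewrite /ball /= distrC.
by apply/nbhs_ballP; exists e => //= q [] h1 h2; apply: h; rewrite distrC.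
Qed.

Lemma closure_planeP (A : set (plane R)) p :
  closure A p <-> forall e : R, 0 < e ->
    exists q, [/\ A q, `|q.1 - p.1 : R| < e & `|q.2 - p.2 : R| < e].
Proof.
split=> [h e e0|h U /nbhs_planeP[e e0 hU]].
  have [|q [Aq [? ?]]] := h [set q | `|q.1 - p.1 : R| < e /\ `|q.2 - p.2 : R| < e].
    by apply/nbhs_planeP; exists e.
  by exists q.
by have [q [Aq ? ?]] := h e e0; exists q; split=> //; apply: hU.
Qed.

Lemma fst_continuous : continuous (fun q : plane R => q.1 : R).
Proof.
move=> q; apply/cvgrPdist_lt => e e0; apply/nbhs_planeP; exists e => // r h _.
by rewrite distrC.
Qed.

Lemma snd_continuous : continuous (fun q : plane R => q.2 : R).
Proof.
move=> q; apply/cvgrPdist_lt => e e0; apply/nbhs_planeP; exists e => // r _ h.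
by rewrite distrC.
Qed.

Lemma affine_continuous_at (T : topologicalType) (f g : T -> R) (t : T) (a b c : R) :
  {for t, continuous f} -> {for t, continuous g} ->
  {for t, continuous (fun s => a * f s + b * g s + c)}.
Proof.
move=> cf cg; apply: continuousD; last exact: cst_continuous.
by apply: continuousD; apply: continuousM => //; exact: cst_continuous.
Qed.

Lemma affine_continuous (a b c : R) :
  continuous (fun q : plane R => a * q.1 + b * q.2 + c : R).
Proof.
move=> q; apply: (@affine_continuous_at _ (fun q : plane R => q.1) (fun q : plane R => q.2)).
  exact: fst_continuous.
exact: snd_continuous.
Qed.

Lemma plane_continuous (T : topologicalType) (f : T -> plane R) (t : T) :
  {for t, continuous (fun s => (f s).1 : R)} ->
  {for t, continuous (fun s => (f s).2 : R)} -> {for t, continuous f}.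
Proof.
move=> c1 c2 U /nbhs_planeP[e e0 hU].
have /cvgrPdist_lt/(_ _ e0) h1 := c1; have /cvgrPdist_lt/(_ _ e0) h2 := c2.
by apply: filterS2 h1 h2 => s; rewrite distrC => h1; rewrite distrC; apply: hU.
Qed.

Lemma cross_continuous (a p : plane R) : continuous (fun q => cross a (q - p)).
Proof.
suff -> : (fun q => cross a (q - p)) =
    (fun q : plane R => - a.2 * q.1 + a.1 * q.2 + (a.2 * p.1 - a.1 * p.2)).
  exact: affine_continuous.
by apply/funext => q; rewrite /cross !coordE; ring.
Qed.

Lemma dot_continuous (a p : plane R) : continuous (fun q => dot a (q - p)).
Proof.
suff -> : (fun q => dot a (q - p)) =
    (fun q : plane R => a.1 * q.1 + a.2 * q.2 + (- a.1 * p.1 - a.2 * p.2)).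
  exact: affine_continuous.
by apply/funext => q; rewrite /dot !coordE; ring.
Qed.

Lemma bounded_planeP (A : set (plane R)) :
  bounded_set A <-> exists M : R, forall q, A q -> `|q.1 : R| <= M /\ `|q.2 : R| <= M.
Proof.
have hn (q : plane R) (M : R) : `|q| <= M <-> `|q.1 : R| <= M /\ `|q.2 : R| <= M.
  by rewrite [`|q|]/Num.norm /= ge_max; split=> [/andP[]|[-> ->]].
split=> [[M [_ hM]]|[M hM]].
  by exists (M + 1) => q Aq; apply/hn; apply: (hM (M + 1)) => //; rewrite ltrDl.
exists M; split; first exact: num_real.
by move=> N MN q Aq; apply: le_trans (ltW MN); apply/hn; apply: hM.
Qed.

Lemma line_connected (I : set R) p r : is_interval I ->
  connected [set q : plane R | exists2 t, I t & q = p + t *: r].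
Proof.
move=> /connected_intervalP cI.
have -> : [set q : plane R | exists2 t, I t & q = p + t *: r] = (fun t => p + t *: r) @` I.
  by apply/seteqP; split=> q [t It h]; exists t.
apply: connected_continuous_connected => //; apply: continuous_subspaceT => t.
by apply: plane_continuous;
  [have -> : (fun s => (p + s *: r).1 : R) = (fun s : R => r.1 * s + 0 * s + p.1)
  |have -> : (fun s => (p + s *: r).2 : R) = (fun s : R => r.2 * s + 0 * s + p.2)];
  do ?[by apply/funext => s; rewrite !coordE; ring];
  apply: (@affine_continuous_at _ id id); exact: cvg_id.
Qed.

Lemma segment_component (K : set (plane R)) p r :
  (forall t, 0 <= t <= 1 -> ~ K (p + t *: r)) ->
  connected_component (~` K) p = connected_component (~` K) (p + r).
Proof.
move=> h; apply: same_connected_component.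
pose L := [set q : plane R | exists2 t, `[0, 1]%classic t & q = p + t *: r].
apply: (@connected_component_max _ _ L).
- by exists 0; rewrite ?scale0r ?addr0 //= in_itv /= lexx ler01.
- by move=> q [t] /=; rewrite in_itv /= => /h ? ->.
- by apply: line_connected; exact: interval_is_interval.
- by exists 1; rewrite ?scale1r //= in_itv /= lexx ler01.
Qed.

(** The certificate for not being enclosed: points outside a region are always sent to infinity
    along a straight ray. *)
Lemma ray_unbounded (K : set (plane R)) p r : r != 0 ->
  (forall t, 0 <= t -> ~ K (p + t *: r)) -> ~ bounded_complement K p.
Proof.
move=> r0 h [_ /bounded_planeP[M hM]].
pose L := [set q : plane R | exists2 t, `[0, +oo[%classic t & q = p + t *: r].
have sub : L `<=` connected_component (~` K) p.
  apply: connected_component_max.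
  - by exists 0; rewrite ?scale0r ?addr0 //= in_itv /= lexx.
  - by move=> q [t] /=; rewrite in_itv /= andbT => /h ? ->.
  - by apply: line_connected; exact: interval_is_interval.
have bd (a b : R) : b != 0 -> exists2 t, 0 <= t & M < `|a + t * b|.
  move=> b0; exists ((`|M| + `|a| + 1) / `|b|).
    by rewrite divr_ge0 // addr_ge0 // addr_ge0.
  have e : `|(`|M| + `|a| + 1) / `|b| * b| = `|M| + `|a| + 1.
    rewrite normrM ger0_norm; last first.
      by rewrite divr_ge0 // addr_ge0 // addr_ge0.
    by rewrite mulfVK // normr_eq0.
  have := lerB_normD ((`|M| + `|a| + 1) / `|b| * b) a; rewrite e [_ * b + a]addrC.
  by have := ler_norm M; lra.
have Lt t : 0 <= t -> L (p + t *: r) by move=> t0; exists t => //=; rewrite in_itv /= andbT.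
have : r.1 != 0 :> R \/ r.2 != 0 :> R.
  apply/orP; rewrite -negb_and; apply: contra r0 => /andP[/eqP e1 /eqP e2].
  by apply/eqP/plane_eq.
case=> [/(bd p.1)|/(bd p.2)] [t t0] lt; have [] := hM _ (sub _ (Lt t t0)); rewrite !coordE.
  by rewrite leNgt lt.
by move=> _; rewrite leNgt lt.
Qed.

(* A set U that is both relatively open and relatively closed off K contains
   the component of each of its points. *)
Lemma component_clopen (K U F : set (plane R)) p :
  open U -> closed F -> ~` K `&` U = ~` K `&` F -> U p -> ~ K p ->
  connected_component (~` K) p `<=` U.
Proof.
move=> oU cF e Up Kp; set A := connected_component _ p.
have AK : A `<=` ~` K by exact: connected_component_sub.
have AU : A `&` U = A.
  apply: (@component_connected _ (~` K) p).
  - by exists p; split=> //; apply: connected_component_refl.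
  - by exists U.
  - exists F => //; rewrite -/A -(setIidl AK) -!setIA.
    by rewrite e.
by rewrite -AU => q [].
Qed.

(** The certificate for being enclosed: [U] and [F] will be an open and a closed version of the
    region that agree off the bounding curves. *)
Lemma bounded_complement_clopen (K U F : set (plane R)) :
  open U -> closed F -> ~` K `&` U = ~` K `&` F -> bounded_set U ->
  U `&` ~` K `<=` bounded_complement K.
Proof.
move=> oU cF e /bounded_planeP[M bU] p [Up Kp]; split=> //.
apply/bounded_planeP; exists M => q /(component_clopen oU cF e Up Kp); exact: bU.
Qed.

End PlaneBasics.

(** * The two sides of the universal curve *)

Section AboveBelow.
Variable R : realType.
Implicit Types u v t s : R.

(** As the curve is monotone, its sides are the points to the upper left, or to the lower right, of
    some curve point; both contain the curve. [below] also has the two end tangents as bounds, which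
    makes it the degenerate triangle. *)
Definition above u v := exists t, u <= unit1 t /\ unit2 t <= v.
Definition below u v := [/\ u <= 1, 0 <= v & exists t, unit1 t <= u /\ v <= unit2 t].

(** Between the two witnessing parameters monotonicity freezes one coordinate at its value in (u,
    v); the intermediate value theorem finds the other. *)
Lemma above_below u v : above u v -> below u v ->
  exists t, unit1 t = u /\ unit2 t = v.
Proof.
move=> [t [t1 t2]] [_ _ [s [s1 s2]]].
have [ts|/ltW st] := lerP t s.
  have [m1 m2] := unit_mono ts.
  have [|r [tr rs <-]] := @unit2_ivt R t s v ts; first by apply/andP.
  exists r; split=> //; have [? _] := unit_mono tr; have [? _] := unit_mono rs; lra.
have [m1 m2] := unit_mono st.
have [|r [tr rs <-]] := @unit1_ivt R s t u st; first by apply/andP.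
exists r; split=> //; have [_ ?] := unit_mono tr; have [_ ?] := unit_mono rs; lra.
Qed.

Lemma above_or_below u v : u <= 1 -> 0 <= v -> above u v \/ below u v.
Proof.
move=> u1 v0; case: (lerP u 0) => u0.
  by left; exists 0; have [-> ->] := unit0 (lexx (0 : R)).
have [|t [_ _ tu]] := @unit1_ivt R 0 1 u ler01.
  by have [-> _] := unit0 (lexx (0 : R)); have [-> _] := unit1_ (lexx (1 : R)); lra.
have [h|/ltW h] := lerP (unit2 t) v; first by left; exists t; rewrite tu.
by right; split=> //; exists t; rewrite tu.
Qed.

Lemma curve_above t : above (unit1 t) (unit2 t).
Proof. by exists t. Qed.

Lemma curve_below t : below (unit1 t) (unit2 t).
Proof. by have [? ? ? ?] := unit_bound t; split=> //; exists t. Qed.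

Lemma below_vert u v : below u v -> exists t, unit1 t = u /\ v <= unit2 t.
Proof.
move=> [u1 v0 [t [t1 t2]]].
have [? ? ? ?] := unit_bound t.
case: (lerP t 1) => h1; last by have [] := unit1_ (ltW h1); exists t; split=> //; lra.
have [|s [ts _ su]] := @unit1_ivt R t 1 u h1.
  by have [-> _] := unit1_ (lexx (1 : R)); apply/andP.
by exists s; split=> //; have [_ ?] := unit_mono ts; lra.
Qed.

Lemma below_horiz u v : below u v -> exists t, unit1 t <= u /\ unit2 t = v.
Proof.
move=> [u1 v0 [t [t1 t2]]].
have [? ? ? ?] := unit_bound t.
case: (lerP 0 t) => h1; last by have [] := unit0 (ltW h1); exists t; split=> //; lra.
have [|s [_ ts su]] := @unit2_ivt R 0 t v h1.
  by have [_ ->] := unit0 (lexx (0 : R)); apply/andP.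
by exists s; split=> //; have [? _] := unit_mono ts; lra.
Qed.

Lemma below_bound u v : below u v -> 0 <= v /\ v <= u /\ u <= 1.
Proof. by move=> [u1 v0 [t [t1 t2]]]; have [? _] := unit_le t; split=> //; lra. Qed.

Lemma below_v0 u : 0 <= u <= 1 -> below u 0.
Proof.
move=> /andP[u0 u1]; split=> //; exists 0.
by have [-> ->] := unit0 (lexx (0 : R)).
Qed.

Lemma below_sym u v : below u v -> below (1 - v) (1 - u).
Proof.
move=> [u1 v0 [t [t1 t2]]]; split; [lra|lra|exists (1 - t)].
by have [-> ->] := unit_sym t; lra.
Qed.

Lemma below_u1 v : 0 <= v <= 1 -> below 1 v.
Proof.
move=> h; have := @below_sym (1 - v) 0; rewrite subr0 (_ : 1 - (1 - v) = v); last by lra.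
by apply; apply: below_v0; lra.
Qed.

(** The middle tangent u - v = 1/3 cuts off a triangle at the corner (1, 0); the rest consists of
    two affine copies of the whole, pulled back here by the inverses of the contractions. This
    governs how a cell splits when its hexagon is subdivided. *)
Lemma below_splits u v : below u v <->
  [\/ [/\ u <= 1, 0 <= v & 1 / 3 <= u - v], below (3 * (u - v)) (3 * v) |
      below (3 * u - 2) (3 * (v - u) + 1)].
Proof.
split.
  move=> [u1 v0 [t [t1 t2]]].
  have [h|/ltW h] := lerP (1 / 3) (u - v); first exact: Or31.
  have [t3|/ltW t3] := lerP t (1 / 2).
    have [s [s1 s2]] := unit_low t3; have [? ? ? ?] := unit_bound s.
    by apply: Or32; split; [lra|lra|exists s; split; lra].
  have [s [s1 s2]] := unit_high t3; have [? ? ? ?] := unit_bound s.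
  by apply: Or33; split; [lra|lra|exists s; split; lra].
case.
- move=> [u1 v0 h]; have [|t [_ _ tv]] := @unit2_ivt R 0 1 v ler01.
    by have [_ ->] := unit0 (lexx (0 : R)); have [_ ->] := unit1_ (lexx (1 : R)); lra.
  by split=> //; exists t; have [_ ?] := unit_le t; split; lra.
- move=> b; have [? [? ?]] := below_bound b; have [s [s1 s2]] := below_horiz b.
  have [t [t1 t2]] := unit_low' s; have [? ? ? ?] := unit_bound s.
  by split; [lra|lra|exists t; split; lra].
- move=> b; have [? [? ?]] := below_bound b; have [s [s1 s2]] := below_vert b.
  have [t [t1 t2]] := unit_high' s; have [? ? ? ?] := unit_bound s.
  by split; [lra|lra|exists t; split; lra].
Qed.

Lemma above_shift u v e : 0 <= e -> above u v -> above (u - e) (v + e).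
Proof. by move=> e0 [t [? ?]]; exists t; split; lra. Qed.

Lemma curve_shift t e : 0 < e -> ~ below (unit1 t - e) (unit2 t + e).
Proof.
move=> e0 b; have [] := above_below _ b; first by apply: above_shift (ltW e0) (curve_above t).
move=> s [s1 s2]; have [/unit_mono[]|/ltW/unit_mono[]] := lerP s t; lra.
Qed.

Lemma strictly_below u v t : unit1 t < u -> v < unit2 t -> ~ above u v.
Proof.
move=> ut vt [s [s1 s2]].
by have [/unit_mono[]|/ltW/unit_mono[]] := lerP s t; lra.
Qed.

Lemma below_approx_interior u v e : 0 < e -> below u v -> 0 < v -> u < 1 ->
  exists u' v', [/\ `|u' - u| < e, `|v' - v| < e, 0 < v', u' < 1 & ~ above u' v'].
Proof.
move=> e0 b v0 u1; have [t [t1 t2]] : exists t, unit1 t <= u /\ v <= unit2 t by case: b.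
have [_ [_ _]] := below_bound b.
pose d := Num.min (e / 2) (1 / 2).
have d0 : 0 < d by rewrite lt_min; lra.
have de : d <= e / 2 by rewrite ge_min lexx.
have d1 : d <= 1 / 2 by rewrite ge_min lexx orbT.
have [? [? ?]] := below_bound b.
have p1 : 0 < d * (1 - u) by rewrite mulr_gt0 //; lra.
have p2 : d * (1 - u) <= d * 1 by rewrite ler_wpM2l //; lra.
have p3 : 0 < d * v by rewrite mulr_gt0.
have p4 : d * v <= 1 / 2 * v by rewrite ler_wpM2r //; lra.
have p5 : d * v <= d * 1 by rewrite ler_wpM2l //; lra.
have p6 : d * (1 - u) <= 1 / 2 * (1 - u) by rewrite ler_wpM2r //; lra.
(* The point moves by a fraction d of the way to the corner (1, 0), hence strictly to the lower
   right of the curve point at [t]. *)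
exists (u + d * (1 - u)), (v - d * v); split; rewrite ?ltr_norml; try lra.
by apply: (@strictly_below _ _ t); lra.
Qed.

Lemma below_approx_edge u v e : 0 < e -> below u v -> v = 0 ->
  exists u' v', [/\ `|u' - u| < e, `|v' - v| < e, 0 < v', u' < 1 & below u' v'].
Proof.
move=> e0 b ->; have [v0 [_ u1]] := below_bound b.
have [u0 _] : 0 <= u /\ True by have [? [? ?]] := below_bound b; split=> //; lra.
pose d := Num.min (e / 2) (1 / 2).
have d0 : 0 < d by rewrite lt_min; lra.
have de : d <= e / 2 by rewrite ge_min lexx.
have d1 : d <= 1 / 2 by rewrite ge_min lexx orbT.
have [|t [_ _ td]] := @unit1_ivt R 0 1 d ler01.
  by have [-> _] := unit0 (lexx (0 : R)); have [-> _] := unit1_ (lexx (1 : R)); lra.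
have t2 : 0 < unit2 t by rewrite ltNge; apply/negP => /unit2_eq0; lra.
pose w := Num.min (unit2 t) d.
have w0 : 0 < w by rewrite lt_min t2.
have wt : w <= unit2 t by rewrite ge_min lexx.
have wd : w <= d by rewrite ge_min lexx orbT.
(* The abscissa is kept between d and 1 - d; as it is at least [unit1 t = d], any height up to
   [unit2 t] stays below the curve. *)
exists (Num.min (Num.max u d) (1 - d)), w.
suff [h1 h2] : `|Num.min (Num.max u d) (1 - d) - u| < e /\
    d <= Num.min (Num.max u d) (1 - d) <= 1 - d.
  by split=> //; [rewrite ltr_norml; lra|lra|split; [lra|lra|exists t; lra]].
case: (lerP u d) => h3.
  by rewrite min_l; [split; rewrite ?ltr_norml; lra|lra].
by case: (lerP u (1 - d)) => h4; split; rewrite ?ltr_norml; lra.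
Qed.

Lemma below_approx_offedge u v e : 0 < e -> below u v ->
  exists u' v', [/\ `|u' - u| < e, `|v' - v| < e, 0 < v', u' < 1 & below u' v'].
Proof.
move=> e0 b; have [v0 [vu u1]] := below_bound b.
have [v1|v1] := eqVneq v 0; first exact: below_approx_edge.
have [u2|u2] := eqVneq u 1; last first.
  by exists u, v; rewrite !subrr normr0; split=> //; rewrite lt_neqAle ?u2 // eq_sym v1.
have [|u' [v' [a1 a2 a3 a4 a5]]] := below_approx_edge e0 (below_sym b); first by rewrite u2 subrr.
case: (lerP 1 v') => h; last first.
  have [? [? ?]] := below_bound a5.
  exists (1 - v'), (1 - u'); split; [| |lra|lra|exact: below_sym].
    by move: a2; rewrite !ltr_norml; lra.
  by move: a1; rewrite !ltr_norml; lra.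
by have [? [? ?]] := below_bound a5; lra.
Qed.

(** The region is the closure of its interior: step off the two end tangents first, then off the
    curve. *)
Lemma below_approx u v e : 0 < e -> below u v ->
  exists u' v', [/\ `|u' - u| < e, `|v' - v| < e, 0 < v', u' < 1 & ~ above u' v'].
Proof.
move=> e0 b; have e2 : 0 < e / 2 by lra.
have [u1 [v1 [a1 a2 a3 a4 b1]]] := below_approx_offedge e2 b.
have [u2 [v2 [c1 c2 c3 c4 c5]]] := below_approx_interior e2 b1 a3 a4.
exists u2, v2; split=> //; move: a1 a2 c1 c2; rewrite !ltr_norml; lra.
Qed.

(** Being above means that [f] takes a value at most 0. By compactness and constancy outside [0, 1]
    [f] has a minimum, positive here, which serves as the radius. *)
Lemma above_gap u v : ~ above u v -> exists2 e, 0 < e &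
  forall u' v', `|u' - u| < e -> `|v' - v| < e -> ~ above u' v'.
Proof.
move=> h; pose f t := Num.max (u - unit1 t) (unit2 t - v).
have cf : {within `[0, 1], continuous f}.
  apply: continuous_subspaceT => t; apply: (@continuous_max _ _ (fun t => u - unit1 t) (fun t => unit2 t - v)).
    by apply: continuousB; [exact: cst_continuous|exact: (fst (@unit_continuous R))].
  by apply: continuousB; [exact: (snd (@unit_continuous R))|exact: cst_continuous].
have [c _ hc] := EVT_min ler01 cf.
have fc t : f c <= f t.
  case: (lerP t 0) => t0.
    have -> : f t = f 0.
      by rewrite /f; have [-> ->] := unit0 t0; have [-> ->] := unit0 (lexx (0 : R)).
    by apply: hc; rewrite in_itv /= lexx ler01.
  case: (lerP 1 t) => t1; last by apply: hc; rewrite in_itv /= !ltW.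
  have -> : f t = f 1.
    by rewrite /f; have [-> ->] := unit1_ t1; have [-> ->] := unit1_ (lexx (1 : R)).
  by apply: hc; rewrite in_itv /= lexx ler01.
exists (f c).
  rewrite lt_max !subr_gt0; apply/orP; case: (ltrP (unit1 c) u) => h1; first by left.
  case: (ltrP v (unit2 c)) => h2; first by right.
  by case: h; exists c.
move=> u' v'; rewrite !ltr_norml => h1 h2 [t [t1 t2]].
have : f t < f c by rewrite {1}/f gt_max; lra.
by rewrite ltNge fc.
Qed.

Lemma below_gap u v : ~ below u v -> exists2 e, 0 < e &
  forall u' v', `|u' - u| < e -> `|v' - v| < e -> ~ below u' v'.
Proof.
move=> h; case: (lerP u 1) => u1; last first.
  by exists (u - 1); [lra|move=> u' v'; rewrite !ltr_norml => ? ? []; lra].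
case: (lerP 0 v) => v0; last first.
  by exists (- v); [lra|move=> u' v'; rewrite !ltr_norml => ? ? []; lra].
pose f t := Num.max (unit1 t - u) (v - unit2 t).
have cf : {within `[0, 1], continuous f}.
  apply: continuous_subspaceT => t; apply: (@continuous_max _ _ (fun t => unit1 t - u) (fun t => v - unit2 t)).
    by apply: continuousB; [exact: (fst (@unit_continuous R))|exact: cst_continuous].
  by apply: continuousB; [exact: cst_continuous|exact: (snd (@unit_continuous R))].
have [c _ hc] := EVT_min ler01 cf.
have fc t : f c <= f t.
  case: (lerP t 0) => t0.
    have -> : f t = f 0.
      by rewrite /f; have [-> ->] := unit0 t0; have [-> ->] := unit0 (lexx (0 : R)).
    by apply: hc; rewrite in_itv /= lexx ler01.
  case: (lerP 1 t) => t1; last by apply: hc; rewrite in_itv /= !ltW.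
  have -> : f t = f 1.
    by rewrite /f; have [-> ->] := unit1_ t1; have [-> ->] := unit1_ (lexx (1 : R)).
  by apply: hc; rewrite in_itv /= lexx ler01.
exists (f c).
  rewrite lt_max !subr_gt0; apply/orP; case: (ltrP u (unit1 c)) => h1; first by left.
  case: (ltrP (unit2 c) v) => h2; first by right.
  by case: h; split=> //; exists c.
move=> u' v'; rewrite !ltr_norml => h1 h2 [_ _ [t [t1 t2]]].
have : f t < f c by rewrite {1}/f gt_max; lra.
by rewrite ltNge fc.
Qed.

End AboveBelow.

(** * Affine copies of the curve and of its sides *)

Section AffineCopies.
Variable R : realType.
Implicit Types (p q a b w : plane R) (u v t e : R) (K : set (plane R)).

(** The frame (p; a, b) carries the universal curve to one from [p] to [p + a + b] that starts along
    [a] and ends along [b]; the corner where the end tangents meet is [p + a]. *)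
Definition pt p a b u v : plane R := p + u *: a + v *: b.
Definition arc p a b : set (plane R) := [set q | exists t, q = pt p a b (unit1 t) (unit2 t)].
Definition under p a b : set (plane R) := [set q | exists u v, below u v /\ q = pt p a b u v].
Definition over p a b : set (plane R) := [set q | exists u v, above u v /\ q = pt p a b u v].

Lemma cross_pt_l p a b u v : cross (pt p a b u v - p) b = u * cross a b.
Proof. by rewrite /cross /pt !coordE; ring. Qed.

Lemma cross_pt_r p a b u v : cross a (pt p a b u v - p) = v * cross a b.
Proof. by rewrite /cross /pt !coordE; ring. Qed.

Lemma pt_inj p a b u v u' v' : cross a b != 0 ->
  pt p a b u v = pt p a b u' v' -> u = u' /\ v = v'.
Proof.
move=> ab e; split; apply: (mulIf ab).
  by rewrite -(cross_pt_l p a b u v) -(cross_pt_l p a b u' v') e.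
by rewrite -(cross_pt_r p a b u v) -(cross_pt_r p a b u' v') e.
Qed.

Lemma pt_coord p a b q : cross a b != 0 ->
  q = pt p a b (cross (q - p) b / cross a b) (cross a (q - p) / cross a b).
Proof.
by move=> ab; apply: plane_eq; rewrite /pt !coordE; move: ab; rewrite /cross !coordE => ab; field.
Qed.

Lemma pt_surj p a b q : cross a b != 0 -> exists u v, q = pt p a b u v.
Proof. by move=> /pt_coord h; exists (cross (q - p) b / cross a b), (cross a (q - p) / cross a b). Qed.

Lemma pt_near p a b u v U : nbhs (pt p a b u v) U -> exists2 d : R, 0 < d &
  forall u' v', `|u' - u| < d -> `|v' - v| < d -> U (pt p a b u' v').
Proof.
move=> /nbhs_planeP[e e0 hU].
pose m := `|a.1 : R| + `|a.2 : R| + `|b.1 : R| + `|b.2 : R| + 1.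
have a1 := normr_ge0 (a.1 : R); have a2 := normr_ge0 (a.2 : R).
have b1 := normr_ge0 (b.1 : R); have b2 := normr_ge0 (b.2 : R).
have m0 : 0 < m by rewrite /m; lra.
exists (e / m); first by rewrite divr_gt0.
have bnd (x y r s : R) : `|x| + `|y| <= m -> `|r| < e / m -> `|s| < e / m ->
    `|r * x + s * y| < e.
  move=> xy hr hs; have [x0|x0] := eqVneq (`|x| + `|y|) 0.
    have /eqP := x0; rewrite paddr_eq0 // !normr_eq0 => /andP[/eqP -> /eqP ->].
    by rewrite !mulr0 addr0 normr0.
  have xp : 0 < `|x| + `|y| by rewrite lt_neqAle eq_sym x0 addr_ge0.
  apply: le_lt_trans (ler_normD _ _) _; rewrite !normrM.
  have h1 : `|r| * `|x| <= e / m * `|x| by rewrite ler_wpM2r // ltW.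
  have h2 : `|s| * `|y| <= e / m * `|y| by rewrite ler_wpM2r // ltW.
  have h3 : e / m * (`|x| + `|y|) <= e.
    by rewrite mulrAC ler_pdivrMr // ler_pM2l.
  have [x1|x1] := eqVneq `|x| 0; last first.
    have : `|r| * `|x| < e / m * `|x| by rewrite ltr_pM2r // lt_neqAle eq_sym x1 normr_ge0.
    by lra.
  have : `|s| * `|y| < e / m * `|y|.
    by rewrite ltr_pM2r //; move: xp; rewrite x1 add0r.
  by lra.
move=> u' v' hu hv; apply: hU.
  rewrite (_ : _ - _ = (u' - u) * a.1 + (v' - v) * b.1).
    by apply: bnd => //; rewrite /m; lra.
  by rewrite /pt !coordE; ring.
rewrite (_ : _ - _ = (u' - u) * a.2 + (v' - v) * b.2).
  by apply: bnd => //; rewrite /m; lra.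
by rewrite /pt !coordE; ring.
Qed.

Lemma coord_near p a b u v e : cross a b != 0 -> 0 < e ->
  \forall q \near pt p a b u v, exists u' v',
    [/\ q = pt p a b u' v', `|u' - u| < e & `|v' - v| < e].
Proof.
move=> ab e0.
have ce : 0 < e * `|cross a b| by rewrite mulr_gt0 ?normr_gt0.
have := cross_continuous (p := p) (a := a) (x := pt p a b u v).
move=> /cvgrPdist_lt/(_ _ ce) h1.
have := cross_continuous (p := p) (a := b) (x := pt p a b u v).
move=> /cvgrPdist_lt/(_ _ ce) h2.
apply: filterS2 h1 h2 => q h1 h2.
have [u' [v' eq]] := pt_surj p q ab; exists u', v'; split => //.
  rewrite -(ltr_pM2r (_ : 0 < `|cross a b|)) ?normr_gt0 // -normrM mulrBl.
  rewrite -(cross_pt_l p a b u v) -(cross_pt_l p a b u' v') -eq.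
  by move: h2; congr (is_true (`|_| < _)); rewrite /cross !coordE; ring.
rewrite -(ltr_pM2r (_ : 0 < `|cross a b|)) ?normr_gt0 // -normrM mulrBl.
by rewrite -(cross_pt_r p a b u v) -(cross_pt_r p a b u' v') -eq distrC.
Qed.

Lemma closed_coord p a b (P : R -> R -> Prop) : cross a b != 0 ->
  (forall u v, ~ P u v -> exists2 e, 0 < e &
     forall u' v', `|u' - u| < e -> `|v' - v| < e -> ~ P u' v') ->
  closed [set q | exists u v, P u v /\ q = pt p a b u v].
Proof.
move=> ab h; rewrite -openC openE => q /= hq.
have [u [v eq]] := pt_surj p q ab.
have [|e e0 he] := h u v; first by move=> Puv; apply: hq; exists u, v.
have := coord_near p u v ab e0; rewrite -eq; apply: filterS.
move=> r [u' [v' [er hu hv]]] [u2 [v2 [P2]]]; rewrite er => /(pt_inj ab)[e1 e2].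
by apply: (he u' v') => //; rewrite e1 e2.
Qed.

Lemma under_closed p a b : cross a b != 0 -> closed (under p a b).
Proof. by move=> ab; apply: closed_coord => // u v; apply: below_gap. Qed.

Lemma over_closed p a b : cross a b != 0 -> closed (over p a b).
Proof. by move=> ab; apply: closed_coord => // u v; apply: above_gap. Qed.

Lemma underE p a b u v : cross a b != 0 -> under p a b (pt p a b u v) <-> below u v.
Proof.
move=> ab; split=> [[u' [v' [bl /(pt_inj ab)[-> ->]]]]//|bl].
by exists u, v.
Qed.

Lemma overE p a b u v : cross a b != 0 -> over p a b (pt p a b u v) <-> above u v.
Proof.
move=> ab; split=> [[u' [v' [bl /(pt_inj ab)[-> ->]]]]//|bl].
by exists u, v.
Qed.

Lemma arc_under p a b : arc p a b `<=` under p a b.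
Proof. by move=> q [t ->]; exists (unit1 t), (unit2 t); split=> //; apply: curve_below. Qed.

Lemma arc_over p a b : arc p a b `<=` over p a b.
Proof. by move=> q [t ->]; exists (unit1 t), (unit2 t); split=> //; apply: curve_above. Qed.

Lemma over_under p a b q : cross a b != 0 -> over p a b q -> under p a b q -> arc p a b q.
Proof.
move=> ab [u [v [ov ->]]] /(underE p u v ab) un.
by have [t [<- <-]] := above_below ov un; exists t.
Qed.

Lemma arc_start p a b : arc p a b p.
Proof.
exists 0; have [-> ->] := unit0 (lexx (0 : R)).
by rewrite /pt !scale0r !addr0.
Qed.

Lemma arc_end p a b : arc p a b (p + a + b).
Proof.
exists 1; have [-> ->] := unit1_ (lexx (1 : R)).
by rewrite /pt !scale1r.
Qed.

Lemma pt_rev p a b u v : pt (p + a + b) (- b) (- a) (1 - v) (1 - u) = pt p a b u v.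
Proof. by apply: plane_eq; rewrite /pt !coordE; ring. Qed.

Lemma cross_rev a b : cross (- b) (- a) = - cross a b.
Proof. by rewrite /cross !coordE; ring. Qed.

Lemma arc_rev p a b : arc (p + a + b) (- b) (- a) = arc p a b.
Proof.
suff h (c d r : plane R) : arc c d r `<=` arc (c + d + r) (- r) (- d).
  apply/seteqP; split; last exact: h.
  have := h (p + a + b) (- b) (- a).
  by rewrite !opprK (_ : p + a + b + - b + - a = p) // addrK addrK.
move=> q [t ->]; exists (1 - t); have [-> ->] := unit_sym t.
by rewrite pt_rev.
Qed.

Lemma under_rev p a b : under (p + a + b) (- b) (- a) = under p a b.
Proof.
suff h (c d r : plane R) : under c d r `<=` under (c + d + r) (- r) (- d).
  apply/seteqP; split; last exact: h.
  have := h (p + a + b) (- b) (- a).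
  by rewrite !opprK (_ : p + a + b + - b + - a = p) // addrK addrK.
move=> q [u [v [bl ->]]]; exists (1 - v), (1 - u); split; first exact: below_sym.
by rewrite pt_rev.
Qed.

Lemma under_interior p a b u v : cross a b != 0 -> u < 1 -> 0 < v -> ~ above u v ->
  nbhs (pt p a b u v) [set q | exists u' v', [/\ q = pt p a b u' v', u' < 1, 0 < v' & ~ above u' v']].
Proof.
move=> ab u1 v0 /above_gap[e e0 he].
pose d := Num.min e (Num.min (1 - u) v).
have [de [du dv]] : d <= e /\ d <= 1 - u /\ d <= v.
  by rewrite /d !ge_min !lexx !orbT.
have d0 : 0 < d by rewrite !lt_min e0 v0 subr_gt0 u1.
apply: filterS (coord_near p u v ab d0) => q [u' [v' [-> hu hv]]]; exists u', v'.
split=> //; [move: hu; rewrite ltr_norml; lra|move: hv; rewrite ltr_norml; lra|].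
by apply: he; [apply: lt_le_trans hu de|apply: lt_le_trans hv de].
Qed.

Lemma not_above_below u v : u < 1 -> 0 < v -> ~ above u v -> below u v.
Proof. by move=> u1 v0 h; case: (above_or_below (ltW u1) (ltW v0)). Qed.

Lemma under_closure p a b : under p a b `<=`
  closure [set q | exists u v, [/\ q = pt p a b u v, u < 1, 0 < v & ~ above u v]].
Proof.
move=> q [u [v [bl ->]]] U /pt_near[d d0 hU].
have [u' [v' [h1 h2 h3 h4 h5]]] := below_approx d0 bl.
by exists (pt p a b u' v'); split; [exists u', v'|apply: hU].
Qed.

Lemma arc_shift_out p a b t U : nbhs (pt p a b (unit1 t) (unit2 t)) U ->
  exists2 e, 0 < e & U (pt p a b (unit1 t - e) (unit2 t + e)).
Proof.
move=> /pt_near[d d0 hU]; exists (d / 2); first by lra.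
by apply: hU; rewrite ltr_norml; lra.
Qed.

Lemma arc_near_start p a b U : nbhs p U ->
  exists t, [/\ U (pt p a b (unit1 t) (unit2 t)), 0 < unit1 t, unit1 t < 1, 0 < unit2 t & unit2 t < 1].
Proof.
have {1}-> : p = pt p a b 0 0 by rewrite /pt !scale0r !addr0.
move=> /pt_near[d d0 hU]; pose e := Num.min (d / 2) (1 / 2).
have e0 : 0 < e by rewrite lt_min; lra.
have ed : e <= d / 2 by rewrite ge_min lexx.
have e1 : e <= 1 / 2 by rewrite ge_min lexx orbT.
have [|t [_ _ te]] := @unit1_ivt R 0 1 e ler01.
  by have [-> _] := unit0 (lexx (0 : R)); have [-> _] := unit1_ (lexx (1 : R)); lra.
have t2 : 0 < unit2 t by rewrite ltNge; apply/negP => /unit2_eq0; lra.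
by exists t; have [h _] := unit_le t; split; [apply: hU; rewrite ltr_norml|..]; lra.
Qed.

End AffineCopies.

(** * Tangents of the arcs at their ends and in the middle *)

Section Tangency.
Variable R : realType.
Implicit Types (p q a b w : plane R) (u v t e : R) (K L : set (plane R)).

(* The limit required by [tangent_direction], without the limit point. *)
Definition hugs K p w := forall e, 0 < e ->
  \forall q \near p, K q -> `|cross w (q - p)| <= e * enorm (q - p).

Lemma enorm_ge0 p : 0 <= enorm p. Proof. exact: sqrtr_ge0. Qed.

Lemma enorm_sqr p : enorm p ^+ 2 = p.1 ^+ 2 + p.2 ^+ 2.
Proof. by rewrite sqr_sqrtr // addr_ge0 // sqr_ge0. Qed.

Lemma enorm_eq0 p : enorm p = 0 -> p = 0.
Proof.
move=> e; have := enorm_sqr p; rewrite e expr0n /= => /esym/eqP.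
by rewrite paddr_eq0 ?sqr_ge0 // !sqrf_eq0 => /andP[/eqP ? /eqP ?]; apply: plane_eq.
Qed.

Lemma cross_bound p q : `|cross p q| <= enorm p * enorm q.
Proof.
rewrite -(@ler_pXn2r _ 2) ?nnegrE ?mulr_ge0 ?enorm_ge0 ?normr_ge0 //.
rewrite real_normK ?num_real // exprMn !enorm_sqr /cross -subr_ge0.
by rewrite (_ : _ - _ = (p.1 * q.1 + p.2 * q.2) ^+ 2) ?sqr_ge0 //; ring.
Qed.

Lemma hugs_sub K L p w : K `<=` L -> hugs L p w -> hugs K p w.
Proof. by move=> KL h e /h; apply: filterS => q hq /KL/hq. Qed.

Lemma hugs_near K L p w : (\forall q \near p, K q -> L q) -> hugs L p w -> hugs K p w.
Proof. by move=> KL h e /h; apply: filterS2 KL => q hq h1 /hq/h1. Qed.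

Lemma hugs_setU K L p w : hugs K p w -> hugs L p w -> hugs (K `|` L) p w.
Proof. by move=> h1 h2 e e0; apply: filterS2 (h1 e e0) (h2 e e0) => q k1 k2 [/k1|/k2]. Qed.

Lemma hugs_far K p w : closed K -> ~ K p -> hugs K p w.
Proof.
move=> cK Kp e e0; have : nbhs p (~` K) by apply: open_nbhs_nbhs; split=> //; rewrite openC.
by apply: filterS => q Kq /Kq.
Qed.

Lemma hugs_line p w : hugs (line_through p w) p w.
Proof.
move=> e e0; apply: filterE => q [t ->].
rewrite (_ : cross _ _ = 0) ?normr0 ?mulr_ge0 ?enorm_ge0 ?(ltW e0) //.
by rewrite /cross !coordE; ring.
Qed.

Lemma hugs_scale K p w (c : R) : hugs K p w -> hugs K p (c *: w).
Proof.
move=> h e e0; have e1 : 0 < e / (`|c| + 1) by rewrite divr_gt0 // ltr_wpDl.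
apply: filterS (h _ e1) => q hq /hq {}hq.
rewrite (_ : cross _ _ = c * cross w (q - p)); last by rewrite /cross !coordE; ring.
rewrite normrM; apply: le_trans (ler_wpM2l (normr_ge0 c) hq) _.
rewrite mulrA ler_wpM2r ?enorm_ge0 // mulrCA ger_pMr //.
by rewrite ler_pdivrMr ?mul1r ?lerDl // ltr_wpDl.
Qed.

Lemma hugs_tangent K p w : w != 0 -> limit_point K p -> hugs K p w ->
  tangent_direction K p w.
Proof.
move=> w0 lK h; split=> //; apply/cvgrPdist_le => e e0.
have := h e e0; rewrite !near_withinE => hq.
apply: filterS hq => q hq qp Kq; rewrite sub0r normrN normrM normfV.
have q0 : 0 < enorm (q - p).
  rewrite lt_neqAle enorm_ge0 andbT eq_sym; apply/eqP => /enorm_eq0/eqP.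
  by rewrite subr_eq0 (negPf qp).
by rewrite (ger0_norm (ltW q0)) ler_pdivrMr // hq.
Qed.

(** Near [p] the first coordinate is below 3^-n, so [unit_flat] leaves only slope at most 1/n. With
    n chosen so that [enorm b < n * e], this bounds the deviation from [a] by e times the
    distance. *)
Lemma arc_hugs_start p a b : cross a b != 0 -> hugs (arc p a b) p a.
Proof.
move=> ab e e0.
have [n hn] := archimedean_ratio (enorm b) e0.
have c0 : 0 < `|cross a b| by rewrite normr_gt0.
have d0 : 0 < 3 ^- n * `|cross a b| by rewrite mulr_gt0 // invr_gt0 exprn_gt0.
have := cross_continuous (p := p) (a := b) (x := p).
move=> /cvgrPdist_lt/(_ _ d0); apply: filterS => q hq [t eq].
have hv := cross_pt_r p a b (unit1 t) (unit2 t).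
have hu := cross_pt_l p a b (unit1 t) (unit2 t).
have [u0 _ v0 _] := unit_bound t.
rewrite -eq in hv hu.
have hu2 : unit1 t * `|cross a b| < 3 ^- n * `|cross a b|.
  apply: le_lt_trans hq; rewrite -{1}(ger0_norm u0) -normrM -hu.
  by rewrite le_eqVlt; apply/orP; left; apply/eqP; congr `|_|; rewrite /cross !coordE; ring.
have flat : n%:R * unit2 t <= unit1 t.
  have [//|[h _]] := unit_flat n t.
  by rewrite ltr_pM2r // ltNge h in hu2.
have h1 : unit1 t * `|cross a b| <= enorm (q - p) * enorm b.
  by rewrite -{1}(ger0_norm u0) -normrM -hu; apply: cross_bound.
rewrite hv normrM (ger0_norm v0).
have [eb|eb] := eqVneq (enorm b) 0.
  case/eqP: ab; rewrite /cross.
  by have -> := enorm_eq0 eb; rewrite !coordE; ring.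
have bp : 0 < enorm b by rewrite lt_neqAle eq_sym eb enorm_ge0.
rewrite -(ler_pM2l bp).
have h2 : enorm b * (unit2 t * `|cross a b|) <= n%:R * e * (unit2 t * `|cross a b|).
  by rewrite ler_wpM2r ?mulr_ge0 // ltW.
apply: le_trans h2 _.
have h3 : n%:R * unit2 t * `|cross a b| <= unit1 t * `|cross a b| by rewrite ler_wpM2r.
have h4 := le_trans h3 h1.
by have := ler_wpM2l (ltW e0) h4; lra.
Qed.

Lemma arc_hugs_end p a b : cross a b != 0 -> hugs (arc p a b) (p + a + b) b.
Proof.
move=> ab; have ba : cross (- b) (- a) != 0 by rewrite cross_rev oppr_eq0.
have := @hugs_scale _ _ _ (-1) (@arc_hugs_start (p + a + b) (- b) (- a) ba).
by rewrite scaleN1r opprK arc_rev.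
Qed.

Lemma arc_splits p a b (ab := 3^-1 *: (a + b)) :
  arc p a b `<=` arc p (3^-1 *: a) ab `|` arc (p + 3^-1 *: a + ab) ab (3^-1 *: b).
Proof.
move=> q [t ->]; have [h|/ltW h] := lerP t (1 / 2).
  left; have [s [-> ->]] := unit_low h; exists s.
  by apply: plane_eq; rewrite /pt /ab !coordE; field.
right; have [s [-> ->]] := unit_high h; exists s.
by apply: plane_eq; rewrite /pt /ab !coordE; field.
Qed.

(** The middle point is the end of the lower copy and the start of the upper one, both with tangent
    [a + b]. *)
Lemma arc_hugs_mid p a b (ab := 3^-1 *: (a + b)) : cross a b != 0 ->
  hugs (arc p a b) (p + 3^-1 *: a + ab) ab.
Proof.
move=> h; apply: hugs_sub (@arc_splits p a b) _.
have c9 : cross a b / 9 != 0 by rewrite mulf_neq0 // invr_eq0 pnatr_eq0.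
have h1 : cross (3^-1 *: a) ab != 0.
  by rewrite (_ : cross _ _ = cross a b / 9) // /ab /cross !coordE; field.
have h2 : cross ab (3^-1 *: b) != 0.
  by rewrite (_ : cross _ _ = cross a b / 9) // /ab /cross !coordE; field.
by apply: hugs_setU; [apply: arc_hugs_end|apply: arc_hugs_start].
Qed.

Lemma limit_pointP K p : (forall U, nbhs p U -> exists q, [/\ q <> p, K q & U q]) ->
  limit_point K p.
Proof. by move=> h U /h[q [/eqP ? ? ?]]; exists q. Qed.

Lemma arc_limit_start p a b : cross a b != 0 -> limit_point (arc p a b) p.
Proof.
move=> ab; apply: limit_pointP => U /(@arc_near_start R p a b)[t [Ut h _ _ _]].
exists (pt p a b (unit1 t) (unit2 t)); split=> //; last by exists t.
have {2}<- : pt p a b 0 0 = p by rewrite /pt !scale0r !addr0.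
by move=> /(pt_inj ab)[]; lra.
Qed.

Lemma under_boundary p a b : cross a b != 0 ->
  boundary (under p a b) `<=` arc p a b `|`
    ([set q | exists u, q = pt p a b u 0] `|` [set q | exists v, q = pt p a b 1 v]).
Proof.
move=> ab q []; rewrite -(closure_id _).1; last exact: under_closed.
move=> [u [v [bl ->]]] hn.
have [v0 [vu u1]] := below_bound bl.
have [e|v1] := eqVneq v 0; first by right; left; exists u; rewrite e.
have [e|u2] := eqVneq u 1; first by right; right; exists v; rewrite e.
have u3 : u < 1 by rewrite lt_neqAle u2.
have v3 : 0 < v by rewrite lt_neqAle eq_sym v1.
have [ov|ov] := pselect (above u v).
  by left; apply: over_under => //; [apply/overE|apply/underE].
case: hn; apply: filterS (under_interior p ab u3 v3 ov) => r [u' [v' [-> h1 h2 h3]]].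
by apply/underE => //; apply: not_above_below.
Qed.

(** Of the three curves that bound the region, the arc and the first tangent line hug [a]; the
    second tangent line is closed and misses [p]. *)
Lemma under_hugs_start p a b : cross a b != 0 -> hugs (boundary (under p a b)) p a.
Proof.
move=> ab; apply: hugs_sub (under_boundary ab) _.
apply: hugs_setU; first exact: arc_hugs_start.
apply: hugs_setU.
  apply: hugs_sub (hugs_line p a) => q [u ->]; exists u.
  by rewrite /pt scale0r addr0.
apply: hugs_far.
  suff -> : [set q | exists v, q = pt p a b 1 v] = [set q | exists u v, u = 1 /\ q = pt p a b u v].
    apply: closed_coord => // u v u1; exists `|1 - u|.
      by rewrite normr_gt0 subr_eq0 eq_sym; apply/eqP.
    by move=> u' v' h _ e; rewrite e ltxx in h.
  by apply/seteqP; split=> q; [move=> [v ->]; exists 1, v|move=> [u [v [-> ->]]]; exists v].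
move=> [v]; have {1}<- : pt p a b 0 0 = p by rewrite /pt !scale0r !addr0.
by move=> /(pt_inj ab)[]; lra.
Qed.

Lemma under_hugs_end p a b : cross a b != 0 -> hugs (boundary (under p a b)) (p + a + b) b.
Proof.
move=> ab; have ba : cross (- b) (- a) != 0 by rewrite cross_rev oppr_eq0.
have := @hugs_scale _ _ _ (-1) (@under_hugs_start (p + a + b) (- b) (- a) ba).
by rewrite scaleN1r opprK under_rev.
Qed.

Lemma boundary_setU K L : closed K -> closed L ->
  boundary (K `|` L) `<=` boundary K `|` boundary L.
Proof.
move=> cK cL q; rewrite /boundary -!(closure_id _).1 //; last exact: closedU.
move=> [[Kq|Lq] h]; [left|right]; split=> // h'; apply: h; apply: filterS h' => r ?.
  by left.
by right.
Qed.

End Tangency.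

(** * The degenerate triangle as an enclosed region *)

Section EnclosedRegions.
Variable R : realType.
Implicit Types (p q a b w O d : plane R) (u v t e : R) (K L : set (plane R)).

Lemma under_bounded p a b : bounded_set (under p a b).
Proof.
apply/bounded_planeP.
exists (`|p.1 : R| + `|p.2 : R| + `|a.1 : R| + `|a.2 : R| + `|b.1 : R| + `|b.2 : R|).
move=> q [u [v [bl ->]]]; have [v0 [vu u1]] := below_bound bl.
have bnd (x y z : R) : `|x + u * y + v * z| <= `|x| + `|y| + `|z|.
  apply: le_trans (ler_normD _ _) _; apply: lerD.
    apply: le_trans (ler_normD _ _) _; rewrite lerD2l normrM ger0_norm; last by lra.
    by rewrite ler_piMl.
  by rewrite normrM ger0_norm // ler_piMl //; lra.
have := bnd p.1 a.1 b.1; have := bnd p.2 a.2 b.2; rewrite /pt !coordE.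
have := normr_ge0 (p.1 : R); have := normr_ge0 (p.2 : R).
have := normr_ge0 (a.1 : R); have := normr_ge0 (a.2 : R).
have := normr_ge0 (b.1 : R); have := normr_ge0 (b.2 : R).
by move=> *; split; lra.
Qed.

Lemma pt_shift p a b u v t x y :
  pt p a b u v + t *: (x *: a + y *: b) = pt p a b (u + t * x) (v + t * y).
Proof. by apply: plane_eq; rewrite /pt !coordE; ring. Qed.

Lemma dir_neq0 a b (x y : R) : cross a b != 0 -> x != 0 \/ y != 0 -> x *: a + y *: b != 0.
Proof.
move=> ab h; apply/eqP => e.
have := @pt_inj R 0 a b x y 0 0 ab; rewrite /pt add0r e !scale0r !addr0 => -[] // x0 y0.
by case: h => /eqP.
Qed.

Lemma degenerate_region p a b : cross a b != 0 ->
  enclosed_region (arc p a b `|` line_through p a `|` line_through (p + a + b) b) =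
  under p a b.
Proof.
move=> ab; rewrite /enclosed_region.
set K := _ `|` _.
have lineA q : line_through p a q <-> exists u, q = pt p a b u 0.
  by split=> -[u ->]; exists u; rewrite /pt scale0r addr0.
have lineB q : line_through (p + a + b) b q <-> exists v, q = pt p a b 1 v.
  split=> [[v ->]|[v ->]]; [exists (1 + v)|exists (v - 1)];
  by apply: plane_eq; rewrite /pt !coordE; ring.
pose U : set (plane R) :=
  [set q | exists u v, [/\ q = pt p a b u v, u < 1, 0 < v & ~ above u v]].
have UK : ~` K `&` U = ~` K `&` under p a b.
  apply/seteqP; split=> q [Kq]; first move=> [u [v [-> u1 v0 nab]]].
    split; last by apply/underE => //; apply: not_above_below.
    move=> [[[t /(pt_inj ab)[e1 e2]]|/lineA[u' /(pt_inj ab)[_]]]|/lineB[v' /(pt_inj ab)[]]]; last 2 first.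
    - by lra.
    - by lra.
    by apply: nab; rewrite e1 e2; apply: curve_above.
  move=> [u [v [bl eq]]]; split=> //; exists u, v; have [v0 [vu u1]] := below_bound bl.
  split=> //.
  - rewrite lt_neqAle u1 andbT; apply/eqP => e; apply: Kq; right; apply/lineB.
    by exists v; rewrite eq e.
  - rewrite lt_neqAle v0 andbT; apply/eqP => e; apply: Kq; left; right; apply/lineA.
    by exists u; rewrite eq -e.
  - move=> ov; apply: Kq; left; left; apply: over_under => //; rewrite eq.
      exact/overE.
    exact/underE.
have Usub : U `<=` under p a b.
  by move=> q [u [v [-> u1 v0 nab]]]; apply/underE => //; apply: not_above_below.
have UnK : U `<=` ~` K.
  move=> q [u [v [-> u1 v0 nab]]].
  move=> [[[t /(pt_inj ab)[e1 e2]]|/lineA[u' /(pt_inj ab)[_]]]|/lineB[v' /(pt_inj ab)[]]]; last 2 first.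
  - by lra.
  - by lra.
  by apply: nab; rewrite e1 e2; apply: curve_above.
have oU : open U.
  rewrite openE => q [u [v [-> u1 v0 nab]]].
  exact: under_interior.
suff -> : bounded_complement K = U.
  apply/seteqP; split.
    rewrite [X in _ `<=` X](closure_id _).1; last exact: under_closed.
    exact: closureS.
  exact: under_closure.
apply/seteqP; split=> q; last first.
  move=> Uq; apply: (bounded_complement_clopen oU (under_closed ab) UK); last by split=> //; apply: UnK.
  have /bounded_planeP[M hM] := under_bounded p a b.
  by apply/bounded_planeP; exists M => r /Usub/hM.
move=> bq; have Kq : ~ K q by case: bq.
have [u [v eq]] := pt_surj p q ab; exists u, v.
have u1 : u != 1 by apply/eqP => e; apply: Kq; right; apply/lineB; exists v; rewrite eq e.
have v0 : v != 0 by apply/eqP => e; apply: Kq; left; right; apply/lineA; exists u; rewrite eq e.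
(* Points outside the open region escape along (1, 0) if u > 1, along (0, -1) if v < 0, and along
   (-1, 1) if they lie above the curve. *)
have out (x y : R) : x != 0 \/ y != 0 ->
    (forall t, 0 <= t -> u + t * x != 1 /\ v + t * y != 0 /\
      (forall s, ~ (u + t * x = unit1 s /\ v + t * y = unit2 s))) -> False.
  move=> xy h; apply: (ray_unbounded (dir_neq0 ab xy)) bq => t t0; rewrite eq pt_shift.
  have [h1 [h2 h3]] := h t t0.
  move=> [[[s /(pt_inj ab)]|/lineA[u' /(pt_inj ab)[_]]]|/lineB[v' /(pt_inj ab)[]]].
  - exact: h3.
  - by move=> e; rewrite e eqxx in h2.
  - by move=> e; rewrite e eqxx in h1.
have u2 : u < 1.
  rewrite ltNge; apply/negP => u2; apply: (@out 1 0); first by left; rewrite oner_eq0.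
  have u3 : 1 < u by rewrite lt_neqAle eq_sym u1.
  move=> t t0; rewrite mulr1 mulr0 addr0; split; last split=> //.
    by rewrite gt_eqF //; lra.
  move=> s [e _]; have [_ ? _ _] := unit_bound s.
  by suff : 1 < 1 :> R; [rewrite ltxx|lra].
have v2 : 0 < v.
  rewrite ltNge; apply/negP => v2; apply: (@out 0 (-1)); first by right; rewrite oppr_eq0 oner_eq0.
  have v3 : v < 0 by rewrite lt_neqAle v0.
  move=> t t0; rewrite mulr0 mulrN1 addr0; split=> //; split; first by rewrite lt_eqF //; lra.
  move=> s [_ e]; have [_ _ ? _] := unit_bound s.
  by suff : 1 < 1 :> R; [rewrite ltxx|lra].
split=> // ov; apply: (@out (-1) 1); first by right; rewrite oner_eq0.
move=> t t0; rewrite mulrN1 mulr1; split; first by rewrite lt_eqF //; lra.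
split; first by rewrite gt_eqF //; lra.
move=> s [e1 e2]; apply: Kq; left; left; apply: over_under => //; rewrite eq; first exact/overE.
apply/underE => //; split; [exact: ltW|exact: ltW|exists s; split; lra].
Qed.

End EnclosedRegions.

(** * The region enclosed by three arcs around a common apex *)

Section Deltoid.
Variable R : realType.
Implicit Types (p q a b w O d : plane R) (u v t e : R) (K L : set (plane R)).

(** The arc runs from [O - d] to [O - d'], and both end tangents pass through the apex [O]. So the
    lobe is the part of the deltoid between two spokes. *)
Definition side O d d' : set (plane R) := arc (O - d) d (- d').
Definition lobe O d d' : set (plane R) := under (O - d) d (- d').
Definition colobe O d d' : set (plane R) := over (O - d) d (- d').

Lemma cross_lobe d d' : 0 < cross d' d -> cross d (- d') != 0.
Proof. by move=> h; rewrite gt_eqF // (_ : cross _ _ = cross d' d) // /cross !coordE; ring. Qed.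

Section ThreeSides.
Variables (O d1 d2 d3 : plane R).
Hypothesis d0 : d1 + d2 + d3 = 0.
Hypothesis d21 : 0 < cross d2 d1.

Let d3E : d3 = - d1 - d2.
Proof. by apply: plane_eq; have := congr1 fst d0; have := congr1 snd d0; rewrite !coordE; lra. Qed.

Lemma cross_next : 0 < cross d3 d2.
Proof. by rewrite d3E (_ : cross _ _ = cross d2 d1) // /cross !coordE; ring. Qed.

(** In terms of the frame of the next side the coordinates are u = 1 + v', v = 1 - u' - v'. Then u
    <= 1 forces v' <= 0, and [unit2_eq0] leaves only the common endpoint [O - d2]. *)
Lemma lobe_colobe_next q : lobe O d1 d2 q -> colobe O d2 d3 q -> side O d1 d2 q.
Proof.
have ab := cross_lobe d21.
move=> [u [v [bl ->]]] [u' [v' [ab' e]]].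
have := @pt_inj R (O - d1) d1 (- d2) u v (1 + v') (1 - u' - v') ab.
case; first by rewrite e; apply: plane_eq; rewrite /pt d3E !coordE; ring.
move=> eu ev; have [v0 [vu u1]] := below_bound bl.
have [t [t1 t2]] := ab'; have [_ _ t3 _] := unit_bound t.
have t4 : unit2 t <= 0 by lra.
have t5 := unit2_eq0 t4.
have [_ _ [s [s1 s2]]] := bl; have [_ _ _ s3] := unit_bound s.
have -> : u = 1 by lra.
have -> : v = 1 by lra.
by exists 1; have [-> ->] := unit1_ (lexx (1 : R)).
Qed.

Lemma lobe_colobe_prev q : lobe O d1 d2 q -> colobe O d3 d1 q -> side O d1 d2 q.
Proof.
have ab := cross_lobe d21.
move=> [u [v [bl ->]]] [u' [v' [ab' e]]].
have := @pt_inj R (O - d1) d1 (- d2) u v (2 - u' - v') (u' - 1) ab.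
case; first by rewrite e; apply: plane_eq; rewrite /pt d3E !coordE; ring.
move=> eu ev; have [v0 [vu u1]] := below_bound bl.
have [t [t1 t2]] := ab'; have [_ t3 _ _] := unit_bound t.
have t4 : 1 <= unit1 t by lra.
have t5 := unit1_eq1 t4.
have -> : u = 0 by lra.
have -> : v = 0 by lra.
by exists 0; have [-> ->] := unit0 (lexx (0 : R)).
Qed.

(** In the frame of the first side [d3] is the direction (-1, 1), which leads away from the curve;
    the two other sides lie where u >= 1 or v <= 0. *)
Lemma colobe_ray q : colobe O d1 d2 q ->
  ~ side O d1 d2 q -> ~ side O d2 d3 q -> ~ side O d3 d1 q ->
  forall t, 0 <= t -> ~ (side O d1 d2 `|` side O d2 d3 `|` side O d3 d1) (q + t *: d3).
Proof.
have ab := cross_lobe d21.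
move=> [u [v [av ->]]] n1 n2 n3 t; rewrite le_eqVlt => /orP[/eqP <-|t0].
  by rewrite scale0r addr0 => -[[]|].
have -> : pt (O - d1) d1 (- d2) u v + t *: d3 = pt (O - d1) d1 (- d2) (u - t) (v + t).
  by apply: plane_eq; rewrite /pt d3E !coordE; ring.
have [r [r1 r2]] := av; have [b1 b2 b3 b4] := unit_bound r.
move=> [[] [s e]|[s e]].
- have [e1 e2] := pt_inj ab e; have [c1 c2 c3 c4] := unit_bound s.
  apply: n1; apply: over_under => //; first exact/overE.
  apply/underE => //; split; [lra|lra|exists s; split; lra].
- have [|e1 e2] := @pt_inj R (O - d1) d1 (- d2) (u - t) (v + t) (1 + unit2 s) (1 - unit1 s - unit2 s) ab.
    by rewrite e; apply: plane_eq; rewrite /pt d3E !coordE; ring.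
  have [c1 c2 c3 c4] := unit_bound s.
  by suff : 1 < 1 :> R; [rewrite ltxx|lra].
- have [|e1 e2] := @pt_inj R (O - d1) d1 (- d2) (u - t) (v + t) (2 - unit1 s - unit2 s) (unit1 s - 1) ab.
    by rewrite e; apply: plane_eq; rewrite /pt d3E !coordE; ring.
  have [c1 c2 c3 c4] := unit_bound s.
  by suff : 1 < 1 :> R; [rewrite ltxx|lra].
Qed.

Lemma sector_cover q : 0 <= cross d1 (q - O) -> cross d2 (q - O) <= 0 ->
  colobe O d1 d2 q \/ lobe O d1 d2 q.
Proof.
have ab := cross_lobe d21.
have [u [v ->]] := pt_surj (O - d1) q ab => h1 h2.
have v0 : 0 <= v.
  move: h1; rewrite (_ : cross _ _ = v * cross d2 d1); last by rewrite /pt /cross !coordE; ring.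
  by rewrite pmulr_lge0.
have u1 : u <= 1.
  move: h2; rewrite (_ : cross _ _ = (u - 1) * cross d2 d1); last by rewrite /pt /cross !coordE; ring.
  by rewrite pmulr_lle0 // subr_le0.
by case: (above_or_below u1 v0) => h; [left; apply/overE|right; apply/underE].
Qed.

(* The part of a lobe off the edges O p_i lies in the interior of its sector,
   hence misses the other two. *)
Lemma lobe_inner q u v : q = pt (O - d1) d1 (- d2) u v -> u < 1 -> 0 < v ->
  ~ above u v -> ~ colobe O d1 d2 q /\ ~ colobe O d2 d3 q /\ ~ colobe O d3 d1 q.
Proof.
have ab := cross_lobe d21.
move=> -> u1 v0 na; split; first by move/overE => /(_ ab).
split=> -[u' [v' [[t [t1 t2]] e]]]; have [b1 b2 b3 b4] := unit_bound t.
  have [|e1 e2] := @pt_inj R (O - d1) d1 (- d2) u v (1 + v') (1 - u' - v') ab.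
    by rewrite e; apply: plane_eq; rewrite /pt d3E !coordE; ring.
  by suff : 1 < 1 :> R; [rewrite ltxx|lra].
have [|e1 e2] := @pt_inj R (O - d1) d1 (- d2) u v (2 - u' - v') (u' - 1) ab.
  by rewrite e; apply: plane_eq; rewrite /pt d3E !coordE; ring.
by suff : 1 < 1 :> R; [rewrite ltxx|lra].
Qed.

End ThreeSides.

Section Region.
Variables (O d1 d2 d3 : plane R).
Hypothesis d0 : d1 + d2 + d3 = 0.
Hypothesis d21 : 0 < cross d2 d1.

Let d0' : d2 + d3 + d1 = 0. Proof. by rewrite addrC addrA. Qed.
Let d0'' : d3 + d1 + d2 = 0. Proof. by rewrite addrC addrA. Qed.
Let d32 : 0 < cross d3 d2. Proof. exact: cross_next d0 d21. Qed.
Let d13 : 0 < cross d1 d3. Proof. exact: cross_next d0' d32. Qed.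

Definition deltoid : set (plane R) := lobe O d1 d2 `|` lobe O d2 d3 `|` lobe O d3 d1.
Let W : set (plane R) := colobe O d1 d2 `|` colobe O d2 d3 `|` colobe O d3 d1.
Let K : set (plane R) := side O d1 d2 `|` side O d2 d3 `|` side O d3 d1.

Lemma deltoid_closed : closed deltoid.
Proof.
apply: closedU; first apply: closedU; apply: under_closed; exact: cross_lobe.
Qed.

Let W_closed : closed W.
Proof.
apply: closedU; first apply: closedU; apply: over_closed; exact: cross_lobe.
Qed.

Let cover q : W q \/ deltoid q.
Proof.
(* As the sum vanishes, some two cyclically consecutive terms have the signs that put [q] in the
   sector between their spokes. *)
have s0 : cross d1 (q - O) + cross d2 (q - O) + cross d3 (q - O) = 0.
  have -> : d3 = - d1 - d2.
    by apply: plane_eq; have := congr1 fst d0; have := congr1 snd d0; rewrite !coordE; lra.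
  by rewrite /cross !coordE; ring.
have s1 := @sector_cover O d1 d2 d21 q.
have s2 := @sector_cover O d2 d3 d32 q.
have s3 := @sector_cover O d3 d1 d13 q.
have [h1|h1] := lerP 0 (cross d1 (q - O)).
  have [h2|h2] := lerP (cross d2 (q - O)) 0.
    by case: (s1 h1 h2) => ?; [left; left; left|right; left; left].
  have [h3|h3] := lerP (cross d3 (q - O)) 0; last by exfalso; lra.
  by case: (s2 (ltW h2) h3) => ?; [left; left; right|right; left; right].
have [h3|h3] := lerP 0 (cross d3 (q - O)).
  by case: (s3 h3 (ltW h1)) => ?; [left; right|right; right].
have [h2|h2] := lerP 0 (cross d2 (q - O)); last by exfalso; lra.
by case: (s2 h2 (ltW h3)) => ?; [left; left; right|right; left; right].
Qed.

Let overlap q : deltoid q -> W q -> K q.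
Proof.
move=> [[l|l]|l] [[c|c]|c].
- by left; left; apply: over_under => //; apply: cross_lobe.
- by left; left; apply: (lobe_colobe_next d0 d21).
- by left; left; apply: (lobe_colobe_prev d0 d21).
- by left; right; apply: (lobe_colobe_prev d0' d32).
- by left; right; apply: over_under => //; apply: cross_lobe.
- by left; right; apply: (lobe_colobe_next d0' d32).
- by right; apply: (lobe_colobe_next d0'' d13).
- by right; apply: (lobe_colobe_prev d0'' d13).
- by right; apply: over_under => //; apply: cross_lobe.
Qed.

Let side_W : K `<=` W.
Proof. by move=> q [[|]|] /arc_over h; [left; left|left; right|right]. Qed.

Let lobe_closure O' a b c : a + b + c = 0 -> 0 < cross b a ->
  lobe O' a b `<=` closure (~` (colobe O' a b `|` colobe O' b c `|` colobe O' c a)).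
Proof.
move=> s0 ab q /under_closure; apply: closureS => r [u [v [e u1 v0 na]]].
by have [n1 [n2 n3]] := lobe_inner s0 ab e u1 v0 na => -[[]|].
Qed.

(** The open version of the region is the complement of the three colobes. The union of the open
    lobes would not do: it omits the spokes, which lie inside the deltoid. *)
Lemma deltoid_region : enclosed_region K = deltoid.
Proof.
have oW : open (~` W) by rewrite openC.
have WT : ~` W `<=` deltoid by move=> q Wq; case: (cover q).
have e : ~` K `&` ~` W = ~` K `&` deltoid.
  apply/seteqP; split=> q [Kq h]; split=> //; first exact: WT.
  by move=> /(overlap h).
suff -> : enclosed_region K = closure (~` W).
  apply/seteqP; split.
    by rewrite [X in _ `<=` X](closure_id _).1; [exact: closureS|exact: deltoid_closed].
  move=> q [[|]|].
  - exact: lobe_closure.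
  - move=> /(lobe_closure d0' d32); apply: closureS => r; apply: contra_not.
    by move=> [[]|] ?; [right|left; left|left; right].
  - move=> /(lobe_closure d0'' d13); apply: closureS => r; apply: contra_not.
    by move=> [[]|] ?; [left; right|right|left; left].
congr closure; apply/seteqP; split=> q; last first.
  move=> Wq; apply: (bounded_complement_clopen oW deltoid_closed e).
    have /bounded_planeP[M1 h1] := @under_bounded R (O - d1) d1 (- d2).
    have /bounded_planeP[M2 h2] := @under_bounded R (O - d2) d2 (- d3).
    have /bounded_planeP[M3 h3] := @under_bounded R (O - d3) d3 (- d1).
    apply/bounded_planeP; exists (Num.max M1 (Num.max M2 M3)) => r /WT.
    have m1 : M1 <= Num.max M1 (Num.max M2 M3) by rewrite !le_max lexx.
    have m2 : M2 <= Num.max M1 (Num.max M2 M3) by rewrite !le_max lexx !orbT.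
    have m3 : M3 <= Num.max M1 (Num.max M2 M3) by rewrite !le_max lexx !orbT.
    by move=> [[/h1|/h2]|/h3] [i1 i2]; split; [apply: le_trans i1 _|apply: le_trans i2 _| apply: le_trans i1 _|apply: le_trans i2 _|apply: le_trans i1 _|apply: le_trans i2 _].
  by split=> // /side_W.
move=> bq Wq; have Kq : ~ K q by case: bq.
have n1 : ~ side O d1 d2 q by move=> h; apply: Kq; left; left.
have n2 : ~ side O d2 d3 q by move=> h; apply: Kq; left; right.
have n3 : ~ side O d3 d1 q by move=> h; apply: Kq; right.
have nz a b : 0 < cross b a -> a != 0.
  by move=> h; apply/eqP => a0; move: h; rewrite a0 /cross !coordE !mulr0 subrr ltxx.
case: Wq => [[c|c]|c].
- apply: (ray_unbounded (nz _ _ d13)) bq => t t0; exact: (colobe_ray d0 d21).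
- apply: (ray_unbounded (nz _ _ d21)) bq => t t0 h.
  apply: (colobe_ray d0' d32 c n2 n3 n1 t0).
  by case: h => [[]|] ?; [right|left; left|left; right].
- apply: (ray_unbounded (nz _ _ d32)) bq => t t0 h.
  apply: (colobe_ray d0'' d13 c n3 n1 n2 t0).
  by case: h => [[]|] ?; [left; right|right|left; left].
Qed.

End Region.
End Deltoid.

(** * The hexagon of a triple and its linear forms *)

Section Hexagon.
Variable R : realType.
Implicit Types (p q x y z : plane R).

(* Multiplication by i. *)
Definition J x : plane R := (- x.2, x.1).
Lemma fstJ x : (J x).1 = - x.2 :> R. Proof. by []. Qed.
Lemma sndJ x : (J x).2 = x.1 :> R. Proof. by []. Qed.

(* For the spinors x, y, -x-y of a triple the quantities are k1, k2, k3, the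
   curvatures, and K = sqrt(k1 k2 + k2 k3 + k3 k1). *)
Record acute x y := Acute {
  acute1 : 0 < - dot x (- x - y);
  acute2 : 0 < - dot x y;
  acute3 : 0 < - dot y (- x - y);
  acuteK : 0 < - cross x y }.

(* In the hexagon of a triple (C1, C2, C3), p is the point where the regions of C1
   and C2 meet, [rotp p x y] that for C2 and C3; (x, y) spans the hexagon of the
   triple (C1, C2, S) after [childy]. *)
Definition rotp p x y : plane R := p + J x - y.
Definition third x y : plane R := - x - y.
Definition childy x y : plane R := 3^-1 *: (y - J x).

Definition hex p x y : set (plane R) := [set q |
  [/\ 0 <= dot x (q - p) /\ 0 <= cross x (q - p),
      0 <= dot y (q - rotp p x y) /\ 0 <= cross y (q - rotp p x y) &
      0 <= dot (third x y) (q - rotp (rotp p x y) y (third x y)) /\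
      0 <= cross (third x y) (q - rotp (rotp p x y) y (third x y))]].

Definition ihex p x y : set (plane R) := [set q |
  [/\ 0 < dot x (q - p) /\ 0 < cross x (q - p),
      0 < dot y (q - rotp p x y) /\ 0 < cross y (q - rotp p x y) &
      0 < dot (third x y) (q - rotp (rotp p x y) y (third x y)) /\
      0 < cross (third x y) (q - rotp (rotp p x y) y (third x y))]].

(* The part of the region of C1 in the hexagon. *)
Definition cell p x y : set (plane R) := under p x (- J (third x y)).

Ltac unf := rewrite /rotp /third /childy /pt /dot /cross /J /= /GRing.scale /=.
Ltac peq := apply: plane_eq; unf; field.

Lemma third_rot x y : third y (third x y) = x. Proof. by peq. Qed.
Lemma third_rot' x y : third (third x y) x = y. Proof. by peq. Qed.
Lemma rotp3 p x y : rotp (rotp (rotp p x y) y (third x y)) (third x y) x = p.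
Proof. by peq. Qed.

Lemma hex_rot p x y : hex (rotp p x y) y (third x y) = hex p x y.
Proof. by rewrite /hex third_rot rotp3; apply/seteqP; split=> q [? ? ?]; split. Qed.

Lemma ihex_rot p x y : ihex (rotp p x y) y (third x y) = ihex p x y.
Proof. by rewrite /ihex third_rot rotp3; apply/seteqP; split=> q [? ? ?]; split. Qed.

Lemma acute_rot x y : acute x y -> acute y (third x y).
Proof. by case; unf => *; split; unf; lra. Qed.

Lemma acute_child x y : acute x y -> acute (3^-1 *: x) (childy x y).
Proof.
case; set k1 := - dot _ _; set k2 := - dot _ _; set k3 := - dot _ _; set K := - cross _ _.
move=> h1 h2 h3 hK; split.
- by rewrite (_ : - _ = k1 / 9); [lra|rewrite /k1; unf; field].
- by rewrite (_ : - _ = k2 / 9); [lra|rewrite /k2; unf; field].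
- by rewrite (_ : - _ = (k1 + k2 + k3 + K + K) / 9); [lra|rewrite /k1 /k2 /k3 /K; unf; field].
- by rewrite (_ : - _ = (K + k1 + k2) / 9); [lra|rewrite /k1 /k2 /K; unf; field].
Qed.

Lemma acute_cross x y : acute x y -> cross x (- J (third x y)) != 0.
Proof. by case=> h _ _ _; rewrite gt_eqF //; move: h; unf; lra. Qed.

(* [hub] is the common apex O of the three lobes of the successor's triangle,
   [spoke] the vector from the middle m1 of the first side to O. *)
Definition spoke x y : plane R := 3^-1 *: (third x y + J x).
Definition hub p x y : plane R := p + 3^-1 *: (2 *: x - J (third x y)) + spoke x y.

Lemma hub_rot p x y : hub (rotp p x y) y (third x y) = hub p x y.
Proof. by rewrite /hub /spoke; peq. Qed.

Lemma spoke_sum x y :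
  spoke x y + spoke y (third x y) + spoke (third x y) x = 0.
Proof. by rewrite /spoke; peq. Qed.

Lemma spoke_cross x y : acute x y -> 0 < cross (spoke y (third x y)) (spoke x y).
Proof.
case=> h1 h2 h3 hK; rewrite (_ : cross _ _ =
  (- dot x (third x y) + - dot x y + - dot y (third x y) + - cross x y + - cross x y) / 9).
  by move: h1 h2 h3 hK; rewrite /third; lra.
by rewrite /spoke; unf; field.
Qed.

Definition center_tile p x y : set (plane R) :=
  deltoid (hub p x y) (spoke x y) (spoke y (third x y)) (spoke (third x y) x).

Lemma center_tile_rot p x y : center_tile (rotp p x y) y (third x y) = center_tile p x y.
Proof.
by rewrite /center_tile hub_rot third_rot /deltoid setUC setUA.
Qed.

(* the corner of [hex p x y] cut off at the apex of its cell *)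
Definition cut p x y q := dot (spoke x y) (q - hub p x y).
(** Its zero set is the line along a spoke, which separates two neighbouring child hexagons. *)
Definition ell p x y q := cross (spoke x y) (q - hub p x y).

(** The child shares the right angle at [p]; its other two right angles sit at contact points of the
    successor, with sides along and across the spokes. *)
Lemma child_forms p x y q (y' := childy x y) (x' := 3^-1 *: x) :
  (dot x' (q - p) = dot x (q - p) / 3) * (cross x' (q - p) = cross x (q - p) / 3) *
  (dot y' (q - rotp p x' y') = - ell (rotp p x y) y (third x y) q) *
  (cross y' (q - rotp p x' y') =
    dot (spoke y (third x y)) (spoke y (third x y)) + cut (rotp p x y) y (third x y) q) *
  (dot (third x' y') (q - rotp (rotp p x' y') y' (third x' y')) =
    dot (spoke x y) (spoke x y) + cut p x y q) *
  (cross (third x' y') (q - rotp (rotp p x' y') y' (third x' y')) = ell p x y q).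
Proof. by rewrite /x' /y' /cut /ell /hub /spoke; do 5![split; last by unf; field]; unf; field. Qed.

Lemma hex_childE p x y q : hex p (3^-1 *: x) (childy x y) q <->
  [/\ 0 <= dot x (q - p) /\ 0 <= cross x (q - p),
      0 <= ell p x y q /\ ell (rotp p x y) y (third x y) q <= 0 &
      0 <= dot (spoke x y) (spoke x y) + cut p x y q /\
      0 <= dot (spoke y (third x y)) (spoke y (third x y)) + cut (rotp p x y) y (third x y) q].
Proof.
rewrite /hex /=; have [[[[[-> ->] ->] ->] ->] ->] := child_forms p x y q.
by split=> [[[? ?] [? ?] [? ?]]|[[? ?] [? ?] [? ?]]]; split; split; lra.
Qed.

Lemma ihex_childE p x y q : ihex p (3^-1 *: x) (childy x y) q <->
  [/\ 0 < dot x (q - p) /\ 0 < cross x (q - p),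
      0 < ell p x y q /\ ell (rotp p x y) y (third x y) q < 0 &
      0 < dot (spoke x y) (spoke x y) + cut p x y q /\
      0 < dot (spoke y (third x y)) (spoke y (third x y)) + cut (rotp p x y) y (third x y) q].
Proof.
rewrite /ihex /=; have [[[[[-> ->] ->] ->] ->] ->] := child_forms p x y q.
by split=> [[[? ?] [? ?] [? ?]]|[[? ?] [? ?] [? ?]]]; split; split; lra.
Qed.

(** In the coordinates of the cell the forms bounding the hexagon have positive coefficients in u,
    v, 1 - u, 1 - v, which makes signs on the cell visible. *)
Lemma cell_forms p x y u v (z := third x y) (q := pt p x (- J z) u v)
    (k1 := - dot x z) (k2 := - dot x y) (k3 := - dot y z) (K := - cross x y) :
  (dot x (q - p) = u * (k1 + k2) + v * K) * (cross x (q - p) = v * k1) *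
  (dot y (q - rotp p x y) = (1 - u) * k2 + (1 - v) * K + k3) *
  (cross y (q - rotp p x y) = u * K + v * k3 + k2) *
  (dot z (q - rotp (rotp p x y) y z) = (1 - u) * k1) *
  (cross z (q - rotp (rotp p x y) y z) = (1 - u) * K + (1 - v) * (k1 + k3)).
Proof. by rewrite /q /k1 /k2 /k3 /K /z; do 5![split; last by unf; ring]; unf; ring. Qed.

(** The cut is the middle tangent u - v = 1/3 of [below_splits], and [ell] vanishes at the middle
    point (2/3, 1/3). *)
Lemma cell_cut p x y u v (z := third x y) (q := pt p x (- J z) u v)
    (k1 := - dot x z) (k2 := - dot x y) (k3 := - dot y z) (K := - cross x y) :
  (dot (spoke x y) (spoke x y) + cut p x y q = k1 * (1 / 3 - u + v) / 3) *
  (ell p x y q = ((2 / 3 - u) * (K + k1 + k2) + (1 / 3 - v) * (K + k1 + k3)) / 3).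
Proof. by rewrite /cut /ell /hub /spoke /q /k1 /k2 /k3 /K /z; split; unf; field. Qed.

Lemma cell_hex p x y : acute x y -> cell p x y `<=` hex p x y.
Proof.
case; rewrite -/(third x y) => h1 h2 h3 hK q [u [v [bl ->]]].
have [v0 [vu u1]] := below_bound bl.
rewrite /hex /=; have [[[[[-> ->] ->] ->] ->] ->] := cell_forms p x y u v.
move: h1 h2 h3 hK; set k1 := - dot x (third x y); set k2 := - dot x y.
set k3 := - dot y (third x y); set K := - cross x y => h1 h2 h3 hK.
have P (c d : R) : 0 <= c -> 0 < d -> 0 <= c * d by move=> ? /ltW; apply: mulr_ge0.
have u0 : 0 <= u by lra.
have u2 : 0 <= 1 - u by lra.
have v2 : 0 <= 1 - v by lra.
have := P _ _ u0 h1; have := P _ _ u0 h2; have := P _ _ u0 h3; have := P _ _ u0 hK.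
have := P _ _ v0 h1; have := P _ _ v0 h2; have := P _ _ v0 h3; have := P _ _ v0 hK.
have := P _ _ u2 h1; have := P _ _ u2 h2; have := P _ _ u2 hK.
have := P _ _ v2 h1; have := P _ _ v2 h3; have := P _ _ v2 hK.
by split; split; lra.
Qed.

(** Certificates for [hex_child_far]: each far form of the parent, times a positive factor, is a
    nonnegative combination of forms of the child plus a positive constant. *)
Lemma hex_child_identities p x y q (z := third x y)
    (k1 := - dot x z) (k2 := - dot x y) (k3 := - dot y z) (K := - cross x y)
    (kS := k1 + k2 + k3 + 2 * K) :
  (dot z (q - rotp (rotp p x y) y z) * (dot (spoke x y) (spoke x y)) =
    (k1 + k3 + K) / 3 * (dot (spoke x y) (spoke x y) + cut p x y q) + k1 / 3 * ell p x y q
    + k1 / 3 * dot (spoke x y) (spoke x y)) *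
  (kS * cross z (q - rotp (rotp p x y) y z) =
    3 * (K + k3) * ell p x y q - 3 * k1 * ell (rotp p x y) y z q
    + kS * (K + k1 + 2 * k3) / 3) *
  (cross y (q - rotp p x y) * dot (spoke y z) (spoke y z) =
    (k2 + k3 + K) / 3 * (dot (spoke y z) (spoke y z) + cut (rotp p x y) y z q)
    - k2 / 3 * ell (rotp p x y) y z q + k2 / 3 * dot (spoke y z) (spoke y z)) *
  (kS * dot y (q - rotp p x y) =
    3 * k2 * ell p x y q - 3 * (K + k3) * ell (rotp p x y) y z q
    + kS * (K + k2 + 2 * k3) / 3).
Proof.
by rewrite /cut /ell /hub /spoke /kS /k1 /k2 /k3 /K /z; do 3![split; last by unf; field]; unf; field.
Qed.

End Hexagon.

Ltac unf := rewrite /rotp /third /childy /pt /dot /cross /J /= /GRing.scale /=.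
Ltac peq := apply: plane_eq; unf; field.

(** * Subdivision of a hexagon into children and parts of cells *)

Section HexagonTiling.
Variable R : realType.
Implicit Types (p q x y z : plane R).

Lemma dot_gt0 x y : 0 < cross x y -> 0 < dot x x /\ 0 < dot y y.
Proof.
have sq z : 0 <= dot z z by rewrite /dot addr_ge0 // -expr2 sqr_ge0.
move=> h; rewrite !lt_neqAle !sq !andbT; split; apply/eqP => /esym/eqP;
  rewrite /dot paddr_eq0 -?expr2 ?sqr_ge0 // !sqrf_eq0 => /andP[/eqP e1 /eqP e2];
  by move: h; rewrite /cross e1 e2 ?mulr0 ?mul0r subrr ltxx.
Qed.

(** The constants in the certificates are positive, so a child touches the boundary of its parent
    only along the two sides at [p]. *)
Lemma hex_child_far p x y q : acute x y -> hex p (3^-1 *: x) (childy x y) q ->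
  [/\ 0 < dot y (q - rotp p x y), 0 < cross y (q - rotp p x y),
      0 < dot (third x y) (q - rotp (rotp p x y) y (third x y)) &
      0 < cross (third x y) (q - rotp (rotp p x y) y (third x y))].
Proof.
move=> ac /hex_childE[_ [l1 l2] [c1 c2]].
have [s2 s1] := dot_gt0 (spoke_cross ac).
case: ac; rewrite -/(third x y) => h1 h2 h3 hK.
have [[[i1 i2] i3] i4] := hex_child_identities p x y q.
move: i1 i2 i3 i4 s1 s2 l1 l2 c1 c2 h1 h2 h3 hK.
set k1 := - dot x _; set k2 := - dot x y; set k3 := - dot y _; set K := - cross x y.
set a1 := dot (spoke x y) _; set a2 := dot (spoke y _) _.
set e1 := ell _ _ _ _; set e2 := ell _ _ _ _; set f1 := a1 + _; set f2 := a2 + _.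
move=> i1 i2 i3 i4 s1 s2 l1 l2 c1 c2 h1 h2 h3 hK.
have P (c d : R) : 0 <= c -> 0 < d -> 0 <= c * d by move=> ? /ltW; apply: mulr_ge0.
have S : 0 < k1 + k2 + k3 + 2 * K by lra.
have l2' : 0 <= - e2 by lra.
have SP (c : R) : 0 < c -> 0 < (k1 + k2 + k3 + 2 * K) * c by move=> ?; apply: mulr_gt0.
split.
- rewrite -(pmulr_rgt0 _ S) i4; have := P _ _ l1 h2; have := P _ _ l2' hK; have := P _ _ l2' h3.
  have := SP (K + k2 + 2 * k3); lra.
- rewrite -(pmulr_lgt0 _ s2) i3; have := P _ _ c2 h2; have := P _ _ c2 h3; have := P _ _ c2 hK.
  have := P _ _ l2' h2; have := mulr_gt0 h2 s2; lra.
- rewrite -(pmulr_lgt0 _ s1) i1; have := P _ _ c1 h1; have := P _ _ c1 h3; have := P _ _ c1 hK.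
  have := P _ _ l1 h1; have := mulr_gt0 h1 s1; lra.
- rewrite -(pmulr_rgt0 _ S) i2; have := P _ _ l1 h3; have := P _ _ l1 hK; have := P _ _ l2' h1.
  have := SP (K + k1 + 2 * k3); lra.
Qed.

Lemma hex_child_sub p x y : acute x y -> hex p (3^-1 *: x) (childy x y) `<=` hex p x y.
Proof.
move=> ac q h; have [a b c d] := hex_child_far ac h.
by move/hex_childE: h => [? _ _]; split=> //; split; exact: ltW.
Qed.

Lemma ihex_hex p x y : ihex p x y `<=` hex p x y.
Proof. by move=> q [[? ?] [? ?] [? ?]]; split; split; exact: ltW. Qed.

Lemma ihex_child_sub p x y : acute x y -> ihex p (3^-1 *: x) (childy x y) `<=` ihex p x y.
Proof.
move=> ac q h; have [a b c d] := hex_child_far ac (ihex_hex h).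
by move/ihex_childE: h => [? _ _]; split.
Qed.

Lemma hex_cut_cell p x y q : acute x y -> hex p x y q ->
  dot (spoke x y) (spoke x y) + cut p x y q < 0 -> cell p x y q.
Proof.
move=> ac; have [u [v ->]] := pt_surj p q (acute_cross ac).
case: ac; rewrite -/(third x y) => h1 h2 h3 hK.
rewrite /hex /=; have [[[[[-> ->] ->] ->] ->] ->] := cell_forms p x y u v.
have [-> _] := cell_cut p x y u v; move: h1; set k1 := - dot x _ => h1.
move=> [[_ c1] _ [c2 _]]; rewrite pmulr_lge0 // in c1; rewrite pmulr_lge0 // in c2.
rewrite -mulrA pmulr_rlt0 // => h.
exists u, v; split=> //; apply/below_splits/Or31; split; lra.
Qed.

Lemma ell_sum p x y q :
  ell p x y q + ell (rotp p x y) y (third x y) q +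
  ell (rotp (rotp p x y) y (third x y)) (third x y) x q = 0.
Proof. by rewrite /ell /hub /spoke; unf; field. Qed.

(** The three corners beyond the middle tangents belong to the cells. Off them, the three values of
    [ell] sum to 0, and their signs select a child. *)
Lemma hex_cover p x y (z := third x y) (p2 := rotp p x y) (p3 := rotp p2 y z) q :
  acute x y -> hex p x y q ->
  (cell p x y q \/ cell p2 y z q \/ cell p3 z x q) \/
  (hex p (3^-1 *: x) (childy x y) q \/ hex p2 (3^-1 *: y) (childy y z) q \/
   hex p3 (3^-1 *: z) (childy z x) q).
Proof.
move=> ac hq; have ac2 := acute_rot ac; have ac3 := acute_rot ac2; rewrite third_rot in ac3.
have hq2 : hex p2 y z q by rewrite hex_rot.
have hq3 : hex p3 z x q by have := hex_rot p2 y z; rewrite third_rot => ->.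
rewrite -/z in ac2 ac3.
have [c1|c1] := ltrP (dot (spoke x y) (spoke x y) + cut p x y q) 0.
  by left; left; apply: hex_cut_cell.
have [c2|c2] := ltrP (dot (spoke y z) (spoke y z) + cut p2 y z q) 0.
  by left; right; left; apply: hex_cut_cell.
have [c3|c3] := ltrP (dot (spoke z x) (spoke z x) + cut p3 z x q) 0.
  by left; right; right; apply: hex_cut_cell.
right; have := ell_sum p x y q; rewrite -/z -/p2 -/p3 => s0.
have E1 : 0 <= ell p x y q -> ell p2 y z q <= 0 -> hex p (3^-1 *: x) (childy x y) q.
  by move=> e1 e2; apply/hex_childE; case: hq.
have E2 : 0 <= ell p2 y z q -> ell p3 z x q <= 0 -> hex p2 (3^-1 *: y) (childy y z) q.
  by move=> e1 e2; apply/hex_childE; rewrite (third_rot x y); case: hq2.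
have E3 : 0 <= ell p3 z x q -> ell p x y q <= 0 -> hex p3 (3^-1 *: z) (childy z x) q.
  move=> e1 e2; apply/hex_childE; rewrite (third_rot' x y) (_ : rotp p3 z x = p); last exact: rotp3.
  by case: hq3.
have [h1|h1] := lerP 0 (ell p x y q).
  have [h2|h2] := lerP (ell p2 y z q) 0; first by left; apply: E1.
  by right; left; apply: E2; lra.
have [h3|h3] := lerP 0 (ell p3 z x q); first by right; right; apply: E3; lra.
by right; left; apply: E2; lra.
Qed.

Lemma child_hex_disjoint p x y (z := third x y) q :
  (ihex p (3^-1 *: x) (childy x y) q -> hex (rotp p x y) (3^-1 *: y) (childy y z) q -> False) /\
  (hex p (3^-1 *: x) (childy x y) q -> ihex (rotp p x y) (3^-1 *: y) (childy y z) q -> False).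
Proof.
split.
  by move=> /ihex_childE[_ [_ h1] _] /hex_childE[_ [h2 _] _]; move: h1; rewrite ltNge h2.
by move=> /hex_childE[_ [_ h1] _] /ihex_childE[_ [h2 _] _]; move: h2; rewrite ltNge h1.
Qed.

(** Of the pieces in [below_splits] the lower copy is the cell of the child. The cut-off triangle
    meets the child only on the middle tangent, and the upper copy only at the middle point; both
    intersections lie in the lower copy too. *)
Lemma cell_first p x y : acute x y ->
  cell p x y `&` hex p (3^-1 *: x) (childy x y) = cell p (3^-1 *: x) (childy x y).
Proof.
move=> ac; have nz := acute_cross ac.
have E u v : pt p (3^-1 *: x) (- J (third (3^-1 *: x) (childy x y))) u v =
    pt p x (- J (third x y)) ((u + v) / 3) (v / 3) by peq.
apply/seteqP; split=> q; last first.
  move=> h; split; last exact: (cell_hex (acute_child ac)).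
  move: h => [u [v [bl ->]]]; rewrite E; apply/underE => //; apply/below_splits/Or32.
  rewrite (_ : 3 * _ = u); last by lra.
  by rewrite (_ : 3 * _ = v); last by lra.
move=> [[u [v [bl ->]]]] /hex_childE[_ [+ _] [+ _]].
have [-> ->] := cell_cut p x y u v.
case: ac; rewrite -/(third x y); set k1 := - dot x _; set k2 := - dot x y.
set k3 := - dot y _; set K := - cross x y => h1 h2 h3 hK e1 e2.
suff bl' : below (3 * (u - v)) (3 * v).
  exists (3 * (u - v)), (3 * v); split=> //; rewrite E.
  by congr pt; lra.
rewrite -mulrA pmulr_rge0 // in e2.
have A0 : 0 < K + k1 + k2 by lra.
have B0 : 0 < K + k1 + k3 by lra.
case/below_splits: (bl) => [[c1 c2 c3]|//|bl2].
  rewrite (_ : 3 * (u - v) = 1); last by lra.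
  apply: below_u1; rewrite mulr_ge0 //=.
  rewrite leNgt; apply/negP => v1.
  have h5 : 0 < (v - 1 / 3) * (K + k1 + k2) by rewrite mulr_gt0 //; lra.
  have h6 : 0 < (v - 1 / 3) * (K + k1 + k3) by rewrite mulr_gt0 //; lra.
  have uv : u = v + 1 / 3 by lra.
  by move: e1; rewrite uv; lra.
have [b1 [b2 b3]] := below_bound bl2.
have h5 : 0 <= (3 * u - 2) * (K + k1 + k2) by apply: mulr_ge0; lra.
have h6 : 0 <= (3 * (v - u) + 1) * (K + k1 + k3) by apply: mulr_ge0; lra.
have h7 : 0 <= (3 * u - 2) * (K + k1 + k3) by apply: mulr_ge0; lra.
have /eqP s0 : (3 * u - 2) * (K + k1 + k2) = 0 by lra.
have us : 3 * u - 2 = 0 by move: s0; rewrite mulf_eq0 (gt_eqF A0) orbF => /eqP.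
have -> : 3 * (u - v) = 1 by lra.
have -> : 3 * v = 1 by lra.
by apply: below_u1; rewrite lexx ler01.
Qed.

(** Here the upper copy is the cell of the other child that contains the circle; [m1] is the middle
    point of the arc. *)
Lemma cell_second p x y (z := third x y) (p3 := rotp (rotp p x y) y z)
    (m1 := rotp p3 (3^-1 *: z) (childy z x)) : acute x y ->
  cell p x y `&` hex p3 (3^-1 *: z) (childy z x) =
  cell m1 (childy z x) (third (3^-1 *: z) (childy z x)).
Proof.
move=> ac; have nz := acute_cross ac.
have ac3 : acute z x by have := acute_rot (acute_rot ac); rewrite third_rot.
have E u v : pt m1 (childy z x) (- J (third (childy z x) (third (3^-1 *: z) (childy z x)))) u v =
    pt p x (- J (third x y)) ((2 + u) / 3) ((1 + u + v) / 3).
  by rewrite /m1 /p3 /z; peq.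
apply/seteqP; split=> q; last first.
  move=> h; split.
    move: h => [u [v [bl ->]]]; rewrite E; apply/underE => //; apply/below_splits/Or33.
    rewrite (_ : 3 * _ - 2 = u); last by lra.
    by rewrite (_ : 3 * _ + 1 = v); last by lra.
  have := cell_hex (acute_rot (acute_child ac3)) h.
  by rewrite hex_rot.
move=> [[u [v [bl ->]]]] /hex_childE[_ [_ +] [_ +]].
rewrite /z (third_rot' x y) (_ : rotp p3 (third x y) x = p); last exact: rotp3.
have [-> ->] := cell_cut p x y u v.
case: ac; rewrite -/(third x y); set k1 := - dot x _; set k2 := - dot x y.
set k3 := - dot y _; set K := - cross x y => h1 h2 h3 hK e1 e2.
suff bl' : below (3 * u - 2) (3 * (v - u) + 1).
  exists (3 * u - 2), (3 * (v - u) + 1); split=> //; rewrite E.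
  by congr pt; lra.
rewrite -mulrA pmulr_rge0 // in e2.
have A0 : 0 < K + k1 + k2 by lra.
have B0 : 0 < K + k1 + k3 by lra.
have [v0 [vu u1]] := below_bound bl.
case/below_splits: (bl) => [[c1 c2 c3]|bl2|//].
  rewrite (_ : 3 * (v - u) + 1 = 0); last by lra.
  apply: below_v0; apply/andP; split; last by lra.
  rewrite leNgt; apply/negP => v1.
  have h5 : 0 < (2 / 3 - u) * (K + k1 + k2) by rewrite mulr_gt0 //; lra.
  have h6 : 0 < (2 / 3 - u) * (K + k1 + k3) by rewrite mulr_gt0 //; lra.
  have uv : v = u - 1 / 3 by lra.
  by move: e1; rewrite uv; lra.
have [b1 [b2 b3]] := below_bound bl2.
have h5 : 0 <= (2 / 3 - u) * (K + k1 + k2) by apply: mulr_ge0; lra.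
have h6 : 0 <= (1 / 3 - v) * (K + k1 + k3) by apply: mulr_ge0; lra.
have /eqP s0 : (2 / 3 - u) * (K + k1 + k2) = 0 by lra.
have /eqP s1 : (1 / 3 - v) * (K + k1 + k3) = 0 by lra.
have us : 2 / 3 - u = 0 by move: s0; rewrite mulf_eq0 (gt_eqF A0) orbF => /eqP.
have vs : 1 / 3 - v = 0 by move: s1; rewrite mulf_eq0 (gt_eqF B0) orbF => /eqP.
have -> : 3 * u - 2 = 0 by lra.
have -> : 3 * (v - u) + 1 = 0 by lra.
by apply: below_v0; rewrite lexx ler01.
Qed.

(** Certificate for [cell_opposite]: v <= u on the cell makes the left side at most 0, while the
    signs of [ell] on the opposite child make the right side at least kS^2 / 3. *)
Lemma chord_identity p x y u v (z := third x y) (q := pt p x (- J z) u v)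
    (k1 := - dot x z) (k2 := - dot x y) (k3 := - dot y z) (K := - cross x y)
    (kS := k1 + k2 + k3 + 2 * K) :
  kS * (k1 * (v - u)) =
    3 * (K + k1 + k3) * ell (rotp p x y) y z q
    - 3 * (K + k1 + k2) * ell (rotp (rotp p x y) y z) z x q + kS * kS / 3.
Proof. by rewrite /q /ell /hub /spoke /kS /k1 /k2 /k3 /K /z; unf; field. Qed.

Lemma cell_opposite p x y : acute x y ->
  cell p x y `&` hex (rotp p x y) (3^-1 *: y) (childy y (third x y)) = set0.
Proof.
move=> ac; rewrite -subset0 => q [[u [v [bl ->]]] /hex_childE[_ [+ +] _]].
rewrite (third_rot x y).
have := chord_identity p x y u v; cbv zeta; have [v0 [vu u1]] := below_bound bl.
case: ac; rewrite -/(third x y); set k1 := - dot x _; set k2 := - dot x y.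
set k3 := - dot y _; set K := - cross x y => h1 h2 h3 hK.
set e1 := ell _ _ _ _; set e2 := ell _ _ _ _ => i l1 l2.
have P (c d : R) : 0 <= c -> 0 < d -> 0 <= c * d by move=> ? /ltW; apply: mulr_ge0.
have S : 0 < k1 + k2 + k3 + 2 * K by lra.
have l2' : 0 <= - e2 by lra.
have c1 := P _ _ l1 h1; have c2 := P _ _ l1 h3; have c3 := P _ _ l1 hK.
have c4 := P _ _ l2' h1; have c5 := P _ _ l2' h2; have c6 := P _ _ l2' hK.
have SS := mulr_gt0 S S.
have vu' : 0 <= u - v by lra.
have c7 := P _ _ (P _ _ vu' h1) S.
suff : 0 < 0 :> R by rewrite ltxx.
lra.
Qed.

End HexagonTiling.

(** * Contacts of the pieces and shrinking of the hexagons *)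

Section HexagonTiles.
Variable R : realType.
Implicit Types (p q x y z : plane R).

(** The two forms of the right angle at [p], computed in both frames, give two linear equations.
    With v <= u and v' <= u' their positive coefficients leave only [p]. *)
Lemma cells_meet p x y : acute x y ->
  cell p x y `&` cell (rotp p x y) y (third x y) = [set p].
Proof.
move=> ac; have nz := acute_cross ac.
apply/seteqP; split=> [q|q ->]; last first.
  split; first by apply: arc_under; apply: arc_start.
  rewrite /cell third_rot; apply: arc_under.
  have := @arc_end R (rotp p x y) y (- J x).
  by rewrite (_ : rotp p x y + y + - J x = p) //; peq.
move=> [[u [v [bl ->]]] [u' [v' [bl']]]]; rewrite third_rot => e.
have [v0 [vu u1]] := below_bound bl; have [v0' [vu' u1']] := below_bound bl'.
have [[[[[e1 e2] _] _] _] _] := cell_forms p x y u v; cbv zeta in e1, e2.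
rewrite e in e1 e2.
case: ac; rewrite -/(third x y); set k1 := - dot x _; set k2 := - dot x y.
set k3 := - dot y _; set K := - cross x y => h1 h2 h3 hK.
have e3 : (1 - u') * k2 = u * (k1 + k2) + v * K.
  by rewrite -e1 /k2; unf; ring.
have e4 : (1 - u') * K + (1 - v') * (k1 + k2) = v * k1.
  by rewrite -e2 /k1 /k2 /K; unf; ring.
have P (c d : R) : 0 <= c -> 0 < d -> 0 <= c * d by move=> ? /ltW; apply: mulr_ge0.
have u2 : 0 <= 1 - u' by lra.
have uv' : 0 <= u' - v' by lra.
have uv : 0 <= u - v by lra.
have a1 := P _ _ u2 h1; have a2 := P _ _ uv' h1; have a3 := P _ _ uv' h2.
have a4 := P _ _ uv h1; have a5 := P _ _ uv h2; have a6 := P _ _ v0 hK; have a7 := P _ _ u2 hK.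
have a8 := P _ _ v0 h2; have a9 := P _ _ v0 h1.
have /eqP s0 : v * k2 = 0 by clear e1 e2 e; lra.
have /eqP s1 : (1 - u') * k1 = 0 by clear e1 e2 e; lra.
have ve : v = 0 by move: s0; rewrite mulf_eq0 (gt_eqF h2) orbF => /eqP.
have ue : 1 - u' = 0 by move: s1; rewrite mulf_eq0 (gt_eqF h1) orbF => /eqP.
have /eqP s2 : u * (k1 + k2) = 0 by move: e3; rewrite ue ve !mul0r addr0.
have u0 : u = 0 by move: s2; rewrite mulf_eq0 [k1 + k2 == 0]gt_eqF ?orbF ?addr_gt0 // => /eqP.
by rewrite u0 ve /= /pt !scale0r !addr0.
Qed.

(** In the child triple the successor is the third circle; its cell there is a third of its
    triangle, so results on cells apply to the tile. *)
Lemma lobe_cell p x y : lobe (hub p x y) (spoke x y) (spoke y (third x y)) =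
  cell (rotp (rotp p (3^-1 *: x) (childy x y)) (childy x y) (third (3^-1 *: x) (childy x y)))
    (third (3^-1 *: x) (childy x y)) (3^-1 *: x).
Proof. by rewrite /lobe /cell; congr under; rewrite /hub /spoke; peq. Qed.

Lemma lobe_child_hex p x y : acute x y ->
  lobe (hub p x y) (spoke x y) (spoke y (third x y)) `<=` hex p (3^-1 *: x) (childy x y).
Proof.
move=> ac; have ac' := acute_child ac; rewrite lobe_cell.
have ac3 := acute_rot (acute_rot ac'); rewrite third_rot in ac3.
move=> q /(cell_hex ac3).
have := hex_rot (rotp p (3^-1 *: x) (childy x y)) (childy x y) (third (3^-1 *: x) (childy x y)).
by rewrite third_rot => ->; rewrite hex_rot.
Qed.

Lemma lobe_ihex p x y : acute x y ->
  lobe (hub p x y) (spoke x y) (spoke y (third x y)) `<=` ihex p x y.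
Proof.
move=> ac q lq; have [f1 f2 f3 f4] := hex_child_far ac (lobe_child_hex ac lq).
split=> //; move: lq => [u [v [bl ->]]]; have [v0 [vu u1]] := below_bound bl.
set w := pt _ _ _ _ _.
case: ac; rewrite -/(third x y); set k1 := - dot x _; set k2 := - dot x y.
set k3 := - dot y _; set K := - cross x y => h1 h2 h3 hK.
have e1 : dot x (w - p) = ((2 - v) * (k1 + k2) + (1 - v) * K - u * k1) / 3.
  by rewrite /w /hub /spoke /k1 /k2 /K; unf; field.
have e2 : cross x (w - p) = (k1 + u * (K + k1 + k2) + v * k2) / 3.
  by rewrite /w /hub /spoke /k1 /k2 /K; unf; field.
have P (c d : R) : 0 <= c -> 0 < d -> 0 <= c * d by move=> ? /ltW; apply: mulr_ge0.
have u2 : 0 <= 1 - u by lra.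
have v2 : 0 <= 1 - v by lra.
have u0 : 0 <= u by lra.
have a1 := P _ _ u2 h1; have a2 := P _ _ v2 h1; have a3 := P _ _ v2 h2.
have a4 := P _ _ v2 hK; have a5 := P _ _ u0 hK; have a6 := P _ _ u0 h1; have a7 := P _ _ u0 h2.
have a8 := P _ _ v0 h2.
by rewrite e1 e2; split; lra.
Qed.

Lemma ihex_rot2 p x y : ihex (rotp (rotp p x y) y (third x y)) (third x y) x = ihex p x y.
Proof.
by have := ihex_rot (rotp p x y) y (third x y); rewrite third_rot => ->; rewrite ihex_rot.
Qed.

Lemma hex_rot2 p x y : hex (rotp (rotp p x y) y (third x y)) (third x y) x = hex p x y.
Proof.
by have := hex_rot (rotp p x y) y (third x y); rewrite third_rot => ->; rewrite hex_rot.
Qed.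

Lemma center_tile_ihex p x y : acute x y -> center_tile p x y `<=` ihex p x y.
Proof.
move=> ac; have ac2 := acute_rot ac; have ac3 := acute_rot ac2; rewrite third_rot in ac3.
move=> q [[|]|]; first exact: lobe_ihex.
  by rewrite -ihex_rot -hub_rot => h; apply: lobe_ihex => //; rewrite third_rot.
rewrite -ihex_rot2 -hub_rot -(hub_rot (rotp p x y)) third_rot => h.
by apply: lobe_ihex => //; rewrite third_rot'.
Qed.

Lemma deltoid_sector (O d1 d2 d3 q : plane R) : d1 + d2 + d3 = 0 -> 0 < cross d2 d1 ->
  deltoid O d1 d2 d3 q -> 0 <= cross d1 (q - O) -> cross d2 (q - O) <= 0 ->
  lobe O d1 d2 q.
Proof.
move=> s0 c0.
have d3E : d3 = - d1 - d2.
  by apply: plane_eq; have := congr1 fst s0; have := congr1 snd s0; rewrite !coordE; lra.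
move=> [[//|]|] [u [v [bl ->]]] l1 l2; have [v0 [vu u1]] := below_bound bl.
  have ve : v = 0.
    move: l2; rewrite (_ : cross _ _ = v * cross d2 d1); last by rewrite d3E; unf; ring.
    by rewrite pmulr_lle0 // => ?; apply/eqP; rewrite eq_le v0 andbT.
  exists 1, (1 - u); split; first by apply: below_u1; lra.
  by rewrite ve d3E; peq.
have ue : u = 1.
  move: l1; rewrite (_ : cross _ _ = (u - 1) * cross d2 d1); last by rewrite d3E; unf; ring.
  by rewrite pmulr_lge0 // subr_ge0 => ?; apply/eqP; rewrite eq_le u1.
exists (1 - v), 0; split; first by apply: below_v0; lra.
by rewrite ue d3E; peq.
Qed.

Lemma center_tile_child p x y : acute x y ->
  center_tile p x y `&` hex p (3^-1 *: x) (childy x y) =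
  lobe (hub p x y) (spoke x y) (spoke y (third x y)).
Proof.
move=> ac; apply/seteqP; split=> q; last first.
  by move=> h; split; [left; left|apply: lobe_child_hex].
move=> [tq /hex_childE[_ [l1 l2] _]].
apply: deltoid_sector tq _ _ => //; [exact: spoke_sum|exact: spoke_cross|].
by move: l2; rewrite /ell hub_rot.
Qed.

Lemma hub_rot2 p x y : hub (rotp (rotp p x y) y (third x y)) (third x y) x = hub p x y.
Proof. by rewrite /hub /spoke; peq. Qed.

(** Defined as the third corner of a child hexagon. The lemmas that follow recognise it as the tip
    of a spoke, as the middle of the arc of the first circle, and as a corner of the neighbouring
    child. *)
Definition contact p x y : plane R := rotp (rotp p (3^-1 *: x) (childy x y)) (childy x y)
  (third (3^-1 *: x) (childy x y)).

Lemma contactE p x y : contact p x y = hub p x y - spoke x y.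
Proof. by rewrite /contact /hub /spoke; peq. Qed.

Lemma contact_mid p x y (z := third x y) :
  contact p x y = p + 3^-1 *: x + 3^-1 *: (x + - J z).
Proof. by rewrite /contact /z; peq. Qed.

Lemma contact_second p x y (z := third x y) (p3 := rotp (rotp p x y) y z) :
  contact p x y = rotp p3 (3^-1 *: z) (childy z x).
Proof. by rewrite /contact /p3 /z; peq. Qed.

(** Lobe by lobe: two lobes are cells adjacent, in a child hexagon, to a part of the given cell, so
    [cells_meet] yields one common point; the third lies in the opposite child. *)
Lemma center_tile_cell p x y : acute x y ->
  center_tile p x y `&` cell p x y = [set contact p x y].
Proof.
move=> ac; have ac' := acute_child ac.
have ac3 : acute (third x y) x by have := acute_rot (acute_rot ac); rewrite third_rot.
have ac3' := acute_child ac3.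
have L1 : lobe (hub p x y) (spoke x y) (spoke y (third x y)) `&` cell p x y = [set contact p x y].
  have := cells_meet (contact p x y) (acute_rot (acute_rot ac')).
  rewrite third_rot /contact rotp3 third_rot' -lobe_cell -cell_first // => <-.
  apply/seteqP; split=> q [a b]; last by split=> //; case: b.
  by split=> //; split=> //; apply: lobe_child_hex.
have L2 : lobe (hub p x y) (spoke (third x y) x) (spoke x y) `&` cell p x y = [set contact p x y].
  have M := cells_meet (rotp (rotp (rotp p x y) y (third x y))
    (3^-1 *: third x y) (childy (third x y) x)) (acute_rot ac3').
  rewrite (third_rot (3^-1 *: third x y)) -lobe_cell hub_rot2 third_rot' -contact_second in M.
  have C := cell_second p ac; cbv zeta in C; rewrite -contact_second in C.
  rewrite -C in M; rewrite -M.
  apply/seteqP; split=> q [a b]; last by split=> //; case: a.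
  split=> //; split=> //.
  have := @lobe_child_hex (rotp (rotp p x y) y (third x y)) (third x y) x ac3.
  by rewrite hub_rot2 third_rot'; apply.
have L3 : lobe (hub p x y) (spoke y (third x y)) (spoke (third x y) x) `&` cell p x y = set0.
  rewrite -subset0 -(cell_opposite p ac) => q [a b]; split=> //.
  have := @lobe_child_hex (rotp p x y) y (third x y) (acute_rot ac).
  by rewrite hub_rot third_rot; apply.
by rewrite /center_tile /deltoid !setIUl L1 L2 L3 setU0 setUid.
Qed.

Lemma hex_closed p x y : closed (hex p x y).
Proof.
have -> : hex p x y =
    [set q | 0 <= dot x (q - p)] `&` [set q | 0 <= cross x (q - p)] `&`
    [set q | 0 <= dot y (q - rotp p x y)] `&` [set q | 0 <= cross y (q - rotp p x y)] `&`
    [set q | 0 <= dot (third x y) (q - rotp (rotp p x y) y (third x y))] `&`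
    [set q | 0 <= cross (third x y) (q - rotp (rotp p x y) y (third x y))].
  by apply/seteqP; split=> q; [move=> [[? ?] [? ?] [? ?]]; do ?split|
    move=> [[[[[? ?] ?] ?] ?] ?]].
have hd a r : closed [set q : plane R | 0 <= dot a (q - r)].
  apply: (@preimage_closed _ _ (fun q : plane R => dot a (q - r)) [set t : R | 0 <= t]).
    by move=> q _; apply: dot_continuous.
  exact: closed_ge.
have hc a r : closed [set q : plane R | 0 <= cross a (q - r)].
  apply: (@preimage_closed _ _ (fun q : plane R => cross a (q - r)) [set t : R | 0 <= t]).
    by move=> q _; apply: cross_continuous.
  exact: closed_ge.
by do 5?[apply: closedI]; [exact: hd|exact: hc|exact: hd|exact: hc|exact: hd|exact: hc].
Qed.

Lemma ihex_open p x y : open (ihex p x y).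
Proof.
have -> : ihex p x y =
    [set q | 0 < dot x (q - p)] `&` [set q | 0 < cross x (q - p)] `&`
    [set q | 0 < dot y (q - rotp p x y)] `&` [set q | 0 < cross y (q - rotp p x y)] `&`
    [set q | 0 < dot (third x y) (q - rotp (rotp p x y) y (third x y))] `&`
    [set q | 0 < cross (third x y) (q - rotp (rotp p x y) y (third x y))].
  by apply/seteqP; split=> q; [move=> [[? ?] [? ?] [? ?]]; do ?split|
    move=> [[[[[? ?] ?] ?] ?] ?]].
have hd a r : open [set q : plane R | 0 < dot a (q - r)].
  apply: (@open_comp _ _ (fun q : plane R => dot a (q - r)) [set t : R | 0 < t]).
    by move=> q _; apply: dot_continuous.
  exact: open_gt.
have hc a r : open [set q : plane R | 0 < cross a (q - r)].
  apply: (@open_comp _ _ (fun q : plane R => cross a (q - r)) [set t : R | 0 < t]).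
    by move=> q _; apply: cross_continuous.
  exact: open_gt.
by do 5?[apply: openI]; [exact: hd|exact: hc|exact: hd|exact: hc|exact: hd|exact: hc].
Qed.

Lemma hex_segment p x y q r (t : R) : 0 <= t <= 1 -> hex p x y q -> hex p x y r ->
  hex p x y (t *: q + (1 - t) *: r).
Proof.
move=> /andP[t0 t1] [[a1 a2] [a3 a4] [a5 a6]] [[b1 b2] [b3 b4] [b5 b6]].
have t2 : 0 <= 1 - t by lra.
have D a c : 0 <= dot a (q - c) -> 0 <= dot a (r - c) ->
    0 <= dot a (t *: q + (1 - t) *: r - c).
  move=> h1 h2; have := mulr_ge0 t0 h1; have := mulr_ge0 t2 h2.
  by rewrite /dot !coordE; lra.
have C a c : 0 <= cross a (q - c) -> 0 <= cross a (r - c) ->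
    0 <= cross a (t *: q + (1 - t) *: r - c).
  move=> h1 h2; have := mulr_ge0 t0 h1; have := mulr_ge0 t2 h2.
  by rewrite /cross !coordE; lra.
by split; (split; [exact: D|exact: C]).
Qed.

Definition size2 x y := dot x x + dot y y + dot (third x y) (third x y).

(** The three scalar products at the corners have constant sum [H], and so do the three cross
    products; hence each form lies in [0, H] on the hexagon, with [H <= size2 x y]. Lagrange's
    identity, summed over the three spinors, bounds [size2 x y] times the squared distance by six
    squares. *)
Lemma hex_diameter p x y q r : acute x y -> hex p x y q -> hex p x y r ->
  dot (q - r) (q - r) <= 6 * size2 x y.
Proof.
move=> ac; case: (ac) => h1 h2 h3 hK.
pose H := - dot x (third x y) + - dot x y + - dot y (third x y) + - cross x y.
have sD w : dot x (w - p) + dot y (w - rotp p x y) +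
    dot (third x y) (w - rotp (rotp p x y) y (third x y)) = H by rewrite /H; unf; ring.
have sC w : cross x (w - p) + cross y (w - rotp p x y) +
    cross (third x y) (w - rotp (rotp p x y) y (third x y)) = H by rewrite /H; unf; ring.
move=> [[a1 a2] [a3 a4] [a5 a6]] [[b1 b2] [b3 b4] [b5 b6]].
have M0 : 0 < size2 x y.
  rewrite /size2 (_ : _ + _ = 2 * (- dot x (- x - y) + - dot x y + - dot y (- x - y))).
    by lra.
  by unf; ring.
have HM : H <= size2 x y.
  have := sqr_ge0 (x.1 + y.2); have := sqr_ge0 (x.2 - y.1); rewrite /H /size2; unf.
  have := sqr_ge0 (x.1 + y.1); have := sqr_ge0 (x.2 + y.2).
  have := sqr_ge0 (x.1); have := sqr_ge0 (x.2); have := sqr_ge0 (y.1); have := sqr_ge0 (y.2).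
  by rewrite !expr2; lra.
have H0 : 0 <= H by move: h1 h2 h3 hK; rewrite /H /third; lra.
have sqH (s t : R) : 0 <= s <= H -> 0 <= t <= H -> (s - t) ^+ 2 <= size2 x y ^+ 2.
  move=> hs ht; rewrite -(real_normK (num_real (s - t))).
  rewrite ler_pXn2r ?nnegrE ?normr_ge0 // ?(ltW M0) // ler_norml; lra.
have dD a c : dot a (q - r) = dot a (q - c) - dot a (r - c) by unf; ring.
have dC a c : cross a (q - r) = cross a (q - c) - cross a (r - c) by unf; ring.
have sDq := sD q; have sDr := sD r; have sCq := sC q; have sCr := sC r.
have bnd a b c : 0 <= a -> 0 <= b -> 0 <= c -> a + b + c = H ->
    [/\ 0 <= a <= H, 0 <= b <= H & 0 <= c <= H] by clear; move=> *; split; lra.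
have [q1 q3 q5] := bnd _ _ _ a1 a3 a5 sDq; have [q2 q4 q6] := bnd _ _ _ a2 a4 a6 sCq.
have [r1 r3 r5] := bnd _ _ _ b1 b3 b5 sDr; have [r2 r4 r6] := bnd _ _ _ b2 b4 b6 sCr.
have e1 : dot x (q - r) ^+ 2 <= size2 x y ^+ 2 by rewrite (dD x p); exact: sqH.
have e2 : cross x (q - r) ^+ 2 <= size2 x y ^+ 2 by rewrite (dC x p); exact: sqH.
have e3 : dot y (q - r) ^+ 2 <= size2 x y ^+ 2 by rewrite (dD y (rotp p x y)); exact: sqH.
have e4 : cross y (q - r) ^+ 2 <= size2 x y ^+ 2 by rewrite (dC y (rotp p x y)); exact: sqH.
have e5 : dot (third x y) (q - r) ^+ 2 <= size2 x y ^+ 2.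
  by rewrite (dD _ (rotp (rotp p x y) y (third x y))); exact: sqH.
have e6 : cross (third x y) (q - r) ^+ 2 <= size2 x y ^+ 2.
  by rewrite (dC _ (rotp (rotp p x y) y (third x y))); exact: sqH.
have lag a : dot a (q - r) ^+ 2 + cross a (q - r) ^+ 2 = dot a a * dot (q - r) (q - r).
  by rewrite /dot /cross; ring.
rewrite -(ler_pM2l M0).
have -> : size2 x y * dot (q - r) (q - r) = dot x x * dot (q - r) (q - r) +
    dot y y * dot (q - r) (q - r) + dot (third x y) (third x y) * dot (q - r) (q - r).
  by rewrite /size2; ring.
rewrite -!lag; move: e1 e2 e3 e4 e5 e6; rewrite ![_ ^+ 2]expr2; clear; move=> *; lra.
Qed.

(** Since K^2 = k1 k2 + k2 k3 + k3 k1, K is at most k1 + k2 + k3; squared lengths therefore shrink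
    by (2/3)^2. *)
Lemma size2_child x y : acute x y -> size2 (3^-1 *: x) (childy x y) <= 4 / 9 * size2 x y.
Proof.
case; rewrite -/(third x y) => h1 h2 h3 hK.
set k1 := - dot x (third x y) in h1; set k2 := - dot x y in h2.
set k3 := - dot y (third x y) in h3; set K := - cross x y in hK.
have -> : size2 x y = 2 * (k1 + k2 + k3) by rewrite /size2 /k1 /k2 /k3; unf; ring.
have -> : size2 (3^-1 *: x) (childy x y) = 2 * (2 * k1 + 2 * k2 + k3 + 2 * K) / 9.
  by rewrite /size2 /k1 /k2 /k3 /K; unf; field.
suff : K <= k1 + k2 + k3 by lra.
rewrite leNgt; apply/negP => h.
have e : K * K = k1 * k2 + k2 * k3 + k3 * k1 by rewrite /k1 /k2 /k3 /K; unf; ring.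
have a1 := mulr_gt0 h1 h2; have a2 := mulr_gt0 h2 h3; have a3 := mulr_gt0 h1 h3.
have a4 := mulr_gt0 h1 h1; have a5 := mulr_gt0 h2 h2; have a6 := mulr_gt0 h3 h3.
have S0 : 0 < k1 + k2 + k3 by lra.
have : (k1 + k2 + k3) * (k1 + k2 + k3) < K * K by apply: ltr_pM; lra.
by rewrite e; lra.
Qed.

End HexagonTiles.

(** * Spinors of tangent circles and the Descartes relation *)

Section Spinors.
Variable R : realType.
Implicit Types (p q x y z a b w : plane R) (C D S : circle R).

Definition csq a : plane R := (a.1 ^+ 2 - a.2 ^+ 2, 2 * a.1 * a.2).
Lemma fst_csq a : (csq a).1 = a.1 ^+ 2 - a.2 ^+ 2 :> R. Proof. by []. Qed.
Lemma snd_csq a : (csq a).2 = 2 * a.1 * a.2 :> R. Proof. by []. Qed.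

Ltac unc := rewrite /third /dot /cross /csq /J /= /GRing.scale /=.

Lemma csq_surj w : exists a, csq a = w.
Proof.
pose s := sqrtc (w.1 +i* w.2)%C.
have := sqr_sqrtc (w.1 +i* w.2)%C; rewrite -/s expr2.
case: s => a b; rewrite /GRing.mul /= => -[h1 h2]; exists (a, b).
by apply: plane_eq; rewrite ?fst_csq ?snd_csq /= -?h1 -?h2; ring.
Qed.

Lemma csq_complex a : ((csq a).1 +i* (csq a).2 = (a.1 +i* a.2) ^+ 2)%C.
Proof. by rewrite expr2 /GRing.mul /=; congr (_ +i* _)%C; unc; ring. Qed.

Lemma enorm_csq a : enorm (csq a) = dot a a.
Proof.
have h0 : 0 <= dot a a by rewrite /dot addr_ge0 // -expr2 sqr_ge0.
rewrite /enorm -[RHS](ger0_norm h0) -sqrtr_sqr; congr Num.sqrt.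
by unc; ring.
Qed.

Lemma enormZ (c : R) w : 0 <= c -> enorm (c *: w) = c * enorm w.
Proof.
move=> c0; rewrite /enorm (_ : _ + _ = c ^+ 2 * (w.1 ^+ 2 + w.2 ^+ 2)); last by unc; ring.
by rewrite sqrtrM ?sqr_ge0 // sqrtr_sqr ger0_norm.
Qed.

Lemma enormN w : enorm (- w) = enorm w.
Proof. by rewrite /enorm !coordE !sqrrN. Qed.

Lemma enorm_le_sqr w (r : R) : 0 <= r -> (enorm w <= r) = (dot w w <= r ^+ 2).
Proof.
move=> r0; rewrite (_ : dot w w = enorm w ^+ 2); last by rewrite enorm_sqr; unc; ring.
by rewrite ler_pXn2r // nnegrE enorm_ge0.
Qed.

Lemma enorm_lt_sqr w (r : R) : 0 <= r -> (enorm w < r) = (dot w w < r ^+ 2).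
Proof.
move=> r0; rewrite (_ : dot w w = enorm w ^+ 2); last by rewrite enorm_sqr; unc; ring.
by rewrite ltr_pXn2r // nnegrE enorm_ge0.
Qed.

Lemma enorm_eq_sqr w (r : R) : 0 <= r -> (enorm w = r) <-> (dot w w = r ^+ 2).
Proof.
move=> r0; have -> : dot w w = enorm w ^+ 2 by rewrite enorm_sqr; unc; ring.
by split=> [->//|/eqP]; rewrite eqrXn2 ?enorm_ge0 // => /eqP.
Qed.

Lemma circle_eq C D : center C = center D -> radius C = radius D -> C = D.
Proof.
by case: C D => [c r h] [d s k] /= ec er; subst d s; congr Circle; apply: bool_irrelevance.
Qed.

Definition curv C := (radius C)^-1.

Lemma curv_gt0 C : 0 < curv C. Proof. by rewrite invr_gt0 radius_gt0. Qed.

(** A nonpositive curvature yields the junk radius 1, which keeps the successor total in its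
    spinors. *)
Definition mkcircle (c : plane R) (k : R) : circle R :=
  match pselect (0 < k^-1) with left h => Circle c h | right _ => Circle c ltr01 end.

Lemma mkcircleP c (k : R) : 0 < k -> center (mkcircle c k) = c /\ curv (mkcircle c k) = k.
Proof.
move=> k0; rewrite /mkcircle; case: pselect => [h|[]]; last by rewrite invr_gt0.
by rewrite /curv /= invrK.
Qed.

(* a is a spinor of (C, D): a square root of the direction from C to D, scaled so
   that successors correspond to sums of spinors. *)
Definition spin C D a :=
  center D = center C + (radius C * radius D) *: csq a /\ dot a a = curv C + curv D.

Lemma spin_sym C D a : spin C D a -> spin D C (J a).
Proof.
move=> [h1 h2]; split; last by rewrite [RHS]addrC -h2; unc; ring.
by rewrite h1; apply: plane_eq; unc; ring.
Qed.

Lemma spin_opp C D a : spin C D a -> spin C D (- a).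
Proof.
move=> [h1 h2]; split; last by rewrite -h2; unc; ring.
by rewrite h1; apply: plane_eq; unc; ring.
Qed.

Lemma ext_tangentC C D : ext_tangent C D -> ext_tangent D C.
Proof. by rewrite /ext_tangent => h; rewrite -enormN opprB h addrC. Qed.

Lemma spin_tangent C D a : spin C D a -> ext_tangent C D.
Proof.
move=> [h1 h2]; rewrite /ext_tangent -enormN opprB h1 addrC addKr.
have rC := radius_gt0 C; have rD := radius_gt0 D.
rewrite enormZ ?mulr_ge0 ?ltW // enorm_csq h2 /curv; field.
by rewrite !gt_eqF.
Qed.

Lemma spin_exists C D : ext_tangent C D -> exists a, spin C D a.
Proof.
have rC := radius_gt0 C; have rD := radius_gt0 D.
have rr : 0 < radius C * radius D by rewrite mulr_gt0.
move=> h; have [a ha] := csq_surj ((radius C * radius D)^-1 *: (center D - center C)).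
exists a; split; first by rewrite ha scalerA divff ?gt_eqF // scale1r addrC subrK.
rewrite -enorm_csq ha enormZ; last by rewrite invr_ge0 ltW.
by rewrite -enormN opprB h /curv; field; rewrite !gt_eqF.
Qed.

(** Once each sum of two radii is expressed by the squared length of a spinor, the formula is a
    polynomial identity. It turns tangency of two circles on [C] into the condition that their
    spinors span area [curv C]. *)
Lemma spin_dist C C1 C2 a b : spin C C1 a -> spin C C2 b ->
  dot (center C1 - center C2) (center C1 - center C2) =
  (radius C1 - radius C2) ^+ 2 +
  4 * radius C1 * radius C2 * (cross a b * radius C) ^+ 2.
Proof.
move=> [-> a2] [-> b2].
have r0 := radius_gt0 C; have r1 := radius_gt0 C1; have r2 := radius_gt0 C2.
have e1 : radius C1 * dot a a * radius C = radius C1 + radius C.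
  by rewrite a2 /curv; field; rewrite !gt_eqF.
have e2 : radius C2 * dot b b * radius C = radius C2 + radius C.
  by rewrite b2 /curv; field; rewrite !gt_eqF.
rewrite (_ : radius C1 - radius C2 =
  radius C1 * dot a a * radius C - radius C2 * dot b b * radius C); last by rewrite e1 e2; ring.
by unc; ring.
Qed.

Lemma spin_tangentP C C1 C2 a b : spin C C1 a -> spin C C2 b ->
  ext_tangent C1 C2 <-> cross a b ^+ 2 = curv C ^+ 2.
Proof.
move=> sa sb; have r0 := radius_gt0 C; have r1 := radius_gt0 C1; have r2 := radius_gt0 C2.
rewrite /ext_tangent enorm_eq_sqr ?addr_ge0 ?ltW // (spin_dist sa sb) exprMn.
have r12 : 4 * radius C1 * radius C2 != 0 by rewrite !mulf_neq0 ?gt_eqF.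
have -> : curv C ^+ 2 = (radius C ^+ 2)^-1 by rewrite /curv exprVn.
have rr : radius C ^+ 2 != 0 by rewrite expf_neq0 // gt_eqF.
split=> h; last by rewrite h mulVf // mulr1; ring.
apply: (mulIf rr); rewrite mulVf //; apply: (mulfI r12); rewrite mulr1.
by move: h; set c := 4 * _ * _ * _; lra.
Qed.

(** The sign of [cross] in [acute] orients the triple: the centers run counterclockwise, see
    [node_orient]. Triples of the other orientation are handled by exchanging two circles. *)
Record node C1 C2 C3 x y := Node {
  node12 : spin C1 C2 x;
  node23 : spin C2 C3 y;
  node31 : spin C3 C1 (third x y);
  node_acute : acute x y;
  node1 : curv C1 = - dot x (third x y);
  node2 : curv C2 = - dot x y;
  node3 : curv C3 = - dot y (third x y) }.

Lemma node_rot C1 C2 C3 x y : node C1 C2 C3 x y -> node C2 C3 C1 y (third x y).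
Proof.
case=> s1 s2 s3 ac e1 e2 e3; split; rewrite ?third_rot //; first exact: acute_rot.
  by rewrite e2 /dot; ring.
by rewrite e1 /dot; ring.
Qed.

Lemma curv_radius C k : curv C = k -> radius C = k^-1.
Proof. by move=> <-; rewrite /curv invrK. Qed.

(** Going around the triple must return to the first center; cleared of denominators this is the
    relation k3 x^2 + k1 y^2 + k2 z^2 = 0 between complex squares. *)
Lemma descartes_cancel (k1 k2 k3 X Y Z c : R) : k1 != 0 -> k2 != 0 -> k3 != 0 ->
  k3 * X + k1 * Y + k2 * Z = 0 ->
  c = c + k1^-1 * k2^-1 * X + k2^-1 * k3^-1 * Y + k3^-1 * k1^-1 * Z.
Proof.
move=> h1 h2 h3 e.
apply/eqP; rewrite -subr_eq0 (_ : _ - _ = - (k3 * X + k1 * Y + k2 * Z) / (k1 * k2 * k3)).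
  by rewrite e oppr0 mul0r.
by field; rewrite h1 h2 h3.
Qed.

Lemma descartes_cancel' (k1 k2 kS X Y Z c : R) : k1 != 0 -> k2 != 0 -> kS != 0 ->
  kS * X + k1 * Y = k2 * Z ->
  c + k1^-1 * k2^-1 * X + k2^-1 * kS^-1 * Y = c + k1^-1 * kS^-1 * Z.
Proof.
move=> h1 h2 h3 e.
have -> : Z = (kS * X + k1 * Y) / k2 by rewrite e; field.
by field; rewrite h1 h2 h3.
Qed.

(** Tangency of C3 and C1 makes the scalar product of the two spinors at C2 plus or minus k2, and
    the free sign of a spinor makes it - k2. Parallel spinors are excluded by (k1 + k2)(k2 + k3) >
    k2^2. *)
Lemma node_exists C1 C2 C3 : ext_tangent_triple C1 C2 C3 ->
  (exists x y, node C1 C2 C3 x y) \/ (exists x y, node C1 C3 C2 x y).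
Proof.
move=> [t12 t23 t31]; have [x sx] := spin_exists t12; have [y0 sy0] := spin_exists t23.
have k1 := curv_gt0 C1; have k2 := curv_gt0 C2; have k3 := curv_gt0 C3.
have : exists2 y, spin C2 C3 y & dot x y = - curv C2.
  have := (spin_tangentP (spin_sym sx) sy0).1 (ext_tangentC t31).
  rewrite (_ : cross (J x) y0 = - dot x y0); last by unc; ring.
  rewrite sqrrN => /eqP; rewrite eqf_sqr => /orP[/eqP h|/eqP h]; last by exists y0.
  by exists (- y0); [exact: spin_opp|rewrite -h; unc; ring].
move=> [y sy dxy]; have dx := sx.2; have dy := sy.2.
have e1 : curv C1 = - dot x (third x y).
  by move: dx dxy; unc; lra.
have e3 : curv C3 = - dot y (third x y).
  by move: dy dxy; unc; lra.
have e2 : curv C2 = - dot x y by rewrite dxy opprK.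
have sz : spin C3 C1 (third x y).
  split; last by rewrite e1 e3; unc; ring.
  rewrite sy.1 sx.1 !(curv_radius erefl).
  by apply: plane_eq; rewrite !coordE; apply: descartes_cancel; rewrite ?gt_eqF //
    ?e1 ?e2 ?e3; unc; ring.
have ac1 : 0 < - dot x (third x y) by rewrite -e1.
have ac2 : 0 < - dot x y by rewrite -e2.
have ac3 : 0 < - dot y (third x y) by rewrite -e3.
have [c|c|c] := ltgtP (cross x y) 0.
- by left; exists x, y; split=> //; split=> //; rewrite oppr_gt0.
(* Reading the triple in the other direction reverses every pair, which multiplies the spinors by i,
   and flips the sign of [cross]. *)
- right; exists (J (third x y)), (J y).
  have E : third (J (third x y)) (J y) = J x by apply: plane_eq; unc; ring.
  split; rewrite ?E; [exact: spin_sym sz|exact: spin_sym sy|exact: spin_sym sx| | | |].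
  + have E' : - J (third x y) - J y = J x by [].
    split; rewrite ?E'; [move: ac1|move: ac3|move: ac2|move: c]; unc; lra.
  + by rewrite e1; unc; ring.
  + by rewrite e3; unc; ring.
  + by rewrite e2; unc; ring.
- have : dot x y ^+ 2 = dot x x * dot y y.
    rewrite (_ : dot x x * _ = dot x y ^+ 2 + cross x y ^+ 2); last by unc; ring.
    by rewrite c expr0n addr0.
  have := mulr_gt0 k1 k2; have := mulr_gt0 k1 k3; have := mulr_gt0 k2 k3.
  by rewrite dx dy dxy; lra.
Qed.

(* Descartes: the curvature of the inner circle is k1 + k2 + k3 + 2 K. *)
Definition succ_curv x y : R :=
  - dot x (third x y) - dot x y - dot y (third x y) - 2 * cross x y.

(** Seen from [C1] the spinors of the other two circles are [x] and [- J (third x y)]; their sum is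
    the spinor of the successor. *)
Definition succ C1 x y : circle R :=
  mkcircle (center C1 + (radius C1 * (succ_curv x y)^-1) *: csq (x - J (third x y)))
    (succ_curv x y).

Lemma succ_curv_rot x y : succ_curv y (third x y) = succ_curv x y.
Proof. by rewrite /succ_curv third_rot; unc; ring. Qed.

Lemma succ_curv_gt0 x y : acute x y -> 0 < succ_curv x y.
Proof. by case; rewrite /succ_curv /third; lra. Qed.

Lemma succ_rot C1 C2 C3 x y : node C1 C2 C3 x y ->
  succ C2 y (third x y) = succ C1 x y.
Proof.
case=> s1 s2 s3 ac e1 e2 e3; rewrite /succ succ_curv_rot third_rot; congr mkcircle.
have k1 := curv_gt0 C1; have k2 := curv_gt0 C2; have kS := succ_curv_gt0 ac.
rewrite s1.1 !(curv_radius erefl).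
by apply: plane_eq; rewrite !coordE; apply: descartes_cancel'; rewrite ?gt_eqF // ?e1 ?e2;
  rewrite /succ_curv; unc; ring.
Qed.

Lemma succ_spin C1 C2 C3 x y : node C1 C2 C3 x y ->
  spin C1 (succ C1 x y) (x - J (third x y)) /\ curv (succ C1 x y) = succ_curv x y.
Proof.
case=> s1 s2 s3 ac e1 e2 e3; have kS := succ_curv_gt0 ac.
have [c r] := mkcircleP (center C1 + (radius C1 * (succ_curv x y)^-1) *: csq (x - J (third x y))) kS.
split=> //; split; first by rewrite (curv_radius r) c.
by rewrite r e1 /succ_curv; unc; ring.
Qed.

(** The spinor of the successor seen from the second circle: the sum of [y] for the third and
    [- J x] for the first. *)
Definition nexty x y : plane R := y - J x.

Lemma succ_node C1 C2 C3 x y : node C1 C2 C3 x y -> node C1 C2 (succ C1 x y) x (nexty x y).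
Proof.
move=> n; have [sS cS] := succ_spin n; have [sS2 _] := succ_spin (node_rot n).
rewrite (succ_rot n) third_rot in sS2.
case: n => s1 s2 s3 ac e1 e2 e3; split=> //.
- have -> : third x (nexty x y) = J (x - J (third x y)).
    by apply: plane_eq; rewrite /nexty; unc; ring.
  exact: spin_sym.
- have := acute_child ac; rewrite /childy => -[].
  move=> h1 h2 h3 h4; split.
  + by move: h1; rewrite /nexty; unc; lra.
  + by move: h2; rewrite /nexty; unc; lra.
  + by move: h3; rewrite /nexty; unc; lra.
  + by move: h4; rewrite /nexty; unc; lra.
- by rewrite e1 /nexty; unc; ring.
- by rewrite e2 /nexty; unc; ring.
- by rewrite cS /succ_curv /nexty; unc; ring.
Qed.

End Spinors.

Ltac unc := rewrite /third /dot /cross /csq /J /= /GRing.scale /=.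

(** * The gap of a triple and uniqueness of its successor *)

Section Gaps.
Variable R : realType.
Implicit Types (p q x y z a b w : plane R) (C D E S : circle R).

Lemma dot_ge0 w : 0 <= dot w w.
Proof. by rewrite /dot addr_ge0 // -expr2 sqr_ge0. Qed.

Lemma closed_diskE C q :
  closed_disk C q <-> dot (q - center C) (q - center C) <= radius C ^+ 2.
Proof. by rewrite /closed_disk /= enorm_le_sqr // ltW // radius_gt0. Qed.

Lemma open_diskE C q :
  open_disk C q <-> dot (q - center C) (q - center C) < radius C ^+ 2.
Proof. by rewrite /open_disk /= enorm_lt_sqr // ltW // radius_gt0. Qed.

(** A motion along [w] increases the distance to every center behind [q], so the ray never enters a
    disk. *)
Lemma gap_escape C D E q w : w != 0 -> 0 <= dot (q - center C) w ->
  0 <= dot (q - center D) w -> 0 <= dot (q - center E) w -> ~ gap C D E q.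
Proof.
move=> w0 hC hD hE gq; have [nq _] := gq.
have away F (t : R) : 0 <= t -> 0 <= dot (q - center F) w ->
    ~ closed_disk F q -> ~ closed_disk F (q + t *: w).
  move=> t0 hF nF; apply: contra_not nF => /closed_diskE h; apply/closed_diskE.
  apply: le_trans h; rewrite -subr_ge0.
  rewrite (_ : _ - _ = 2 * (t * dot (q - center F) w) + t ^+ 2 * dot w w).
    by rewrite addr_ge0 ?mulr_ge0 ?sqr_ge0 ?dot_ge0.
  by unc; ring.
apply: (ray_unbounded w0) gq => t t0 [[|]|]; apply: away => // h; apply: nq.
- by left; left.
- by left; right.
- by right.
Qed.

Lemma J_neq0 (v w : plane R) : cross v w != 0 -> J v != 0.
Proof.
apply: contra_neq => h; have h1 := congr1 fst h; have h2 := congr1 snd h.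
by rewrite fstJ fst0 in h1; rewrite sndJ snd0 in h2; move: h1 h2; unc => h1 h2; nra.
Qed.

Lemma gap_sides C D E q : gap C D E q ->
  0 < cross (center D - center C) (center E - center C) ->
  0 <= cross (center D - center C) (q - center C) /\
  0 <= cross (q - center C) (center E - center C).
Proof.
move=> gq o; split; rewrite leNgt; apply/negP => h.
  apply: (@gap_escape C D E q (- J (center D - center C))) gq.
  - by rewrite oppr_eq0; apply: (@J_neq0 _ (center E - center C)); rewrite gt_eqF.
  - by move: h; unc; lra.
  - by move: h; unc; lra.
  - by move: h o; unc; lra.
apply: (@gap_escape C D E q (J (center E - center C))) gq.
- apply: (@J_neq0 _ (center D - center C)).
  by rewrite lt_eqF //; move: o; unc; lra.
- by move: h; unc; lra.
- by move: h o; unc; lra.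
- by move: h; unc; lra.
Qed.

Lemma cross_csq a b : cross (csq a) (csq b) = 2 * dot a b * cross a b.
Proof. by unc; ring. Qed.

Lemma spin_cross C D E a b : spin C D a -> spin C E b ->
  cross (center D - center C) (center E - center C) =
  (radius C * radius D) * (radius C * radius E) * (2 * dot a b * cross a b).
Proof. by move=> [-> _] [-> _]; unc; ring. Qed.

(* Of the two circles tangent to all three only the one with spinor a + b lies
   in the gap; the center of the other one, with spinor a - b, is outside the
   angle between the two half-lines that bound the gap. *)
Lemma succ_spinor C0 C D S a b : spin C0 C a -> spin C0 D b ->
  cross a b = curv C0 -> 0 < dot a b -> is_successor C0 C D S -> spin C0 S (a + b).
Proof.
move=> sa sb cab dab [_ [t0 t1 t2] sub].
have k0 := curv_gt0 C0; have r0 := radius_gt0 C0; have rS := radius_gt0 S.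
have rC := radius_gt0 C; have rD := radius_gt0 D.
have [z sz] := spin_exists (ext_tangentC t0).
have e1 := (spin_tangentP sa sz).1 (ext_tangentC t1).
have e2 := (spin_tangentP sb sz).1 (ext_tangentC t2).
have zE : z = (curv C0)^-1 *: (cross z b *: a + cross a z *: b).
  have n : cross a b != 0 by rewrite cab gt_eqF.
  rewrite -cab; apply: plane_eq; move: n; unc => n; field; exact: n.
have zp : 0 < dot z z by rewrite sz.2 addr_gt0 // curv_gt0.
(* For the spinor a - b, [gap_sides] gives |a|^2 <= a.b and |b|^2 <= a.b, hence |a - b|^2 <= 0. *)
have bad : csq z = csq (a - b) -> False.
  move=> ez.
  have : gap C0 C D (center S).
    by apply: sub; apply/open_diskE; rewrite subrr /dot mulr0 addr0 exprn_gt0.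
  have o : 0 < cross (center C - center C0) (center D - center C0).
    by rewrite (spin_cross sa sb) !mulr_gt0 // cab.
  move=> /gap_sides/(_ o)[].
  have -> : cross (center C - center C0) (center S - center C0) =
      (radius C0 * radius C) * (radius C0 * radius S) * (2 * cross a b * (dot a b - dot a a)).
    rewrite sa.1 sz.1 ez; unc; ring.
  have -> : cross (center S - center C0) (center D - center C0) =
      (radius C0 * radius S) * (radius C0 * radius D) * (2 * cross a b * (dot a b - dot b b)).
    rewrite sb.1 sz.1 ez; unc; ring.
  rewrite pmulr_rge0 ?mulr_gt0 // pmulr_rge0 ?mulr_gt0 ?cab // => h1.
  rewrite pmulr_rge0 ?mulr_gt0 // pmulr_rge0 ?mulr_gt0 // => h2.
  have : dot (a - b) (a - b) <= 0.
    by rewrite (_ : dot _ _ = dot a a + dot b b - 2 * dot a b); [lra|unc; ring].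
  have : csq (a - b) = csq z by [].
  move=> /(congr1 (@enorm R)); rewrite !enorm_csq => ->.
  by rewrite leNgt zp.
have e3 : cross z b ^+ 2 = curv C0 ^+ 2 by rewrite -e2; unc; ring.
move/eqP: e1; rewrite eqf_sqr => /orP[/eqP e1|/eqP e1];
  move/eqP: e3; rewrite eqf_sqr => /orP[/eqP e3|/eqP e3].
- suff <- : z = a + b by [].
  by rewrite zE e1 e3 -scalerDr scalerA mulVf ?scale1r // gt_eqF.
- case: bad; rewrite zE e1 e3.
  have -> : (curv C0)^-1 *: (- curv C0 *: a + curv C0 *: b) = - (a - b).
    by apply: plane_eq; rewrite !coordE; field; rewrite gt_eqF.
  by apply: plane_eq; unc; ring.
- case: bad; rewrite zE e1 e3.
  have -> : (curv C0)^-1 *: (curv C0 *: a + - curv C0 *: b) = a - b.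
    by apply: plane_eq; rewrite !coordE; field; rewrite gt_eqF.
  by [].
- suff <- : - z = a + b by exact: spin_opp.
  by rewrite zE e1 e3 -scalerDr scalerA mulrN mulVf ?gt_eqF // scaleN1r opprK.
Qed.

Lemma spin_radius C0 C D a : spin C0 C a -> spin C0 D a -> C = D.
Proof.
move=> [c1 k1] [c2 k2]; have e : curv C = curv D by apply: (addrI (curv C0)); rewrite -k1 -k2.
have er : radius C = radius D by rewrite (curv_radius e) /curv invrK.
by apply: circle_eq => //; rewrite c1 c2 er.
Qed.

Lemma closed_cross (a r : plane R) : closed [set q : plane R | 0 <= cross a (q - r)].
Proof.
apply: (@preimage_closed _ _ (fun q : plane R => cross a (q - r)) [set t : R | 0 <= t]).
  by move=> q _; apply: cross_continuous.
exact: closed_ge.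
Qed.

Lemma open_cross (a r : plane R) : open [set q : plane R | 0 < cross a (q - r)].
Proof.
apply: (@open_comp _ _ (fun q : plane R => cross a (q - r)) [set t : R | 0 < t]).
  by move=> q _; apply: cross_continuous.
exact: open_gt.
Qed.

Lemma segment_disks C D (u : R) : ext_tangent C D -> 0 <= u <= 1 ->
  (closed_disk C `|` closed_disk D) (center C + u *: (center D - center C)).
Proof.
move=> h /andP[u0 u1]; have rC := radius_gt0 C; have rD := radius_gt0 D.
have hd : enorm (center D - center C) = radius C + radius D by rewrite -h -enormN opprB.
have [c|c] := lerP (u * (radius C + radius D)) (radius C).
  by left; rewrite /closed_disk /= addrC addKr enormZ // hd.
right; rewrite /closed_disk /=.
have -> : center C + u *: (center D - center C) - center D =
    (1 - u) *: (center C - center D) by apply: plane_eq; unc; ring.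
by rewrite enormZ ?subr_ge0 // h; lra.
Qed.

Definition triangle C D E : set (plane R) := [set q |
  [/\ 0 < cross (center D - center C) (q - center C),
      0 < cross (center E - center D) (q - center D) &
      0 < cross (center C - center E) (q - center E)]].

(** The sides of the triangle of centers are covered by the disks, so the open and the closed
    triangle agree off the disks. *)
Lemma triangle_gap C D E q : ext_tangent_triple C D E ->
  0 < cross (center D - center C) (center E - center C) ->
  triangle C D E q -> ~ (closed_disk C `|` closed_disk D `|` closed_disk E) q ->
  gap C D E q.
Proof.
move=> [t1 t2 t3] o Tq nq.
pose F : set (plane R) := [set q | 0 <= cross (center D - center C) (q - center C)] `&`
  [set q | 0 <= cross (center E - center D) (q - center D)] `&`
  [set q | 0 <= cross (center C - center E) (q - center E)].
have oT : open (triangle C D E).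
  rewrite (_ : triangle C D E = [set q | 0 < cross (center D - center C) (q - center C)] `&`
    [set q | 0 < cross (center E - center D) (q - center D)] `&`
    [set q | 0 < cross (center C - center E) (q - center E)]); last first.
    by apply/seteqP; split=> r; [move=> [? ? ?]|move=> [[? ?] ?]].
  by apply: openI; [apply: openI|]; exact: open_cross.
have cF : closed F by apply: closedI; [apply: closedI|]; exact: closed_cross.
have e : ~` (closed_disk C `|` closed_disk D `|` closed_disk E) `&` triangle C D E =
    ~` (closed_disk C `|` closed_disk D `|` closed_disk E) `&` F.
  apply/seteqP; split=> r [nr].
    by move=> [? ? ?]; split=> //; split; [split|]; apply: ltW.
  move=> [[f1 f2] f3]; split=> //.
  have side A B G : ext_tangent A B ->
      0 < cross (center B - center A) (center G - center A) ->
      ~ (closed_disk A `|` closed_disk B) r ->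
      0 <= cross (center B - center A) (r - center A) ->
      0 <= cross (center G - center B) (r - center B) ->
      0 <= cross (center A - center G) (r - center G) ->
      0 < cross (center B - center A) (r - center A).
    move=> tAB oo nAB g1 g2 g3; rewrite lt_neqAle g1 andbT; apply/eqP => g0; apply: nAB.
    have nz : cross (center B - center A) (center G - center A) != 0 by rewrite gt_eqF.
    have [u [v er]] := pt_surj (center A) r nz.
    have d0 := oo; move: g0 g2 g3; rewrite er.
    set d := cross (center B - center A) (center G - center A) in oo.
    have -> : cross (center B - center A) (pt (center A) (center B - center A)
        (center G - center A) u v - center A) = v * d by rewrite /d /pt; unc; ring.
    have -> : cross (center G - center B) (pt (center A) (center B - center A)
        (center G - center A) u v - center B) = (1 - u - v) * d by rewrite /d /pt; unc; ring.
    have -> : cross (center A - center G) (pt (center A) (center B - center A)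
        (center G - center A) u v - center G) = u * d by rewrite /d /pt; unc; ring.
    move=> /esym/eqP; rewrite mulf_eq0 (gt_eqF oo) orbF => /eqP ->.
    rewrite pmulr_lge0 // pmulr_lge0 // => i1 i2.
    rewrite /pt scale0r addr0; apply: segment_disks => //; lra.
  split.
  - apply: (side C D E) => // h; apply: nr; left; exact: h.
  - apply: (side D E C) => //; first by move: o; unc; lra.
    by move=> [h|h]; apply: nr; [left; right|right].
  - apply: (side E C D) => //; first by move: o; unc; lra.
    by move=> [h|h]; apply: nr; [right|left; left].
apply: (bounded_complement_clopen oT cF e); last by [].
apply/bounded_planeP.
exists (`|(center C).1 : R| + `|(center D).1 : R| + `|(center E).1 : R| +
  `|(center C).2 : R| + `|(center D).2 : R| + `|(center E).2 : R|).
have nz : cross (center D - center C) (center E - center C) != 0 by rewrite gt_eqF.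
move=> r; have [u [v ->]] := pt_surj (center C) r nz.
set d := cross (center D - center C) (center E - center C) in o.
move=> [].
have -> : cross (center D - center C) (pt (center C) (center D - center C)
    (center E - center C) u v - center C) = v * d by rewrite /d /pt; unc; ring.
have -> : cross (center E - center D) (pt (center C) (center D - center C)
    (center E - center C) u v - center D) = (1 - u - v) * d by rewrite /d /pt; unc; ring.
have -> : cross (center C - center E) (pt (center C) (center D - center C)
    (center E - center C) u v - center E) = u * d by rewrite /d /pt; unc; ring.
rewrite !pmulr_lgt0 // => v0 uv u0.
have bnd (f g h : R) : `|(1 - u - v) * f + u * g + v * h| <= `|f| + `|g| + `|h|.
  apply: le_trans (ler_normD _ _) _; apply: lerD.
    apply: le_trans (ler_normD _ _) _; apply: lerD; rewrite normrM ler_piMl // ger0_norm; lra.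
  by rewrite normrM ler_piMl // ger0_norm; lra.
have := bnd (center C).1 (center D).1 (center E).1.
have := bnd (center C).2 (center D).2 (center E).2.
have := normr_ge0 ((center C).1 : R); have := normr_ge0 ((center D).1 : R).
have := normr_ge0 ((center E).1 : R); have := normr_ge0 ((center C).2 : R).
have := normr_ge0 ((center D).2 : R); have := normr_ge0 ((center E).2 : R).
move=> n1 n2 n3 n4 n5 n6 b2 b1; split.
  rewrite (_ : _.1 = (1 - u - v) * (center C).1 + u * (center D).1 + v * (center E).1); first lra.
  by rewrite /pt; unc; ring.
rewrite (_ : _.2 = (1 - u - v) * (center C).2 + u * (center D).2 + v * (center E).2); first lra.
by rewrite /pt; unc; ring.
Qed.

Lemma dot_le_enorm p q : dot p q <= enorm p * enorm q.
Proof.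
apply: le_trans (ler_norm _) _.
rewrite -(@ler_pXn2r _ 2) ?nnegrE ?mulr_ge0 ?enorm_ge0 ?normr_ge0 //.
rewrite real_normK ?num_real // exprMn !enorm_sqr /dot -subr_ge0.
by rewrite (_ : _ - _ = (p.1 * q.2 - p.2 * q.1) ^+ 2) ?sqr_ge0 //; ring.
Qed.

Lemma enormD p q : enorm (p + q) <= enorm p + enorm q.
Proof.
rewrite enorm_le_sqr ?addr_ge0 ?enorm_ge0 //.
rewrite (_ : dot _ _ = enorm p ^+ 2 + enorm q ^+ 2 + 2 * dot p q).
  by rewrite sqrrD; have := dot_le_enorm p q; lra.
by rewrite !enorm_sqr; unc; ring.
Qed.

Lemma ext_tangent_disjoint S C q : ext_tangent S C -> open_disk S q -> ~ closed_disk C q.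
Proof.
rewrite /ext_tangent /open_disk /closed_disk /= => t o c.
have := enormD (center S - q) (q - center C); rewrite addrA subrK t.
by rewrite -[enorm (center S - q)]enormN opprB; lra.
Qed.

Lemma node_tangent C1 C2 C3 x y : node C1 C2 C3 x y -> ext_tangent_triple C1 C2 C3.
Proof. by case=> s1 s2 s3 _ _ _ _; split; apply: spin_tangent; eassumption. Qed.

Lemma node_spinors C1 C2 C3 x y : node C1 C2 C3 x y ->
  [/\ spin C1 C2 x, spin C1 C3 (- J (third x y)), cross x (- J (third x y)) = curv C1 &
      0 < dot x (- J (third x y))].
Proof.
case=> s1 s2 s3 [h1 h2 h3 hK] e1 _ _; split=> //; first exact/spin_opp/spin_sym.
  by rewrite e1; unc; ring.
by move: hK; unc; lra.
Qed.

Lemma node_orient C1 C2 C3 x y : node C1 C2 C3 x y ->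
  0 < cross (center C2 - center C1) (center C3 - center C1).
Proof.
move=> /node_spinors[s1 s2 c d]; rewrite (spin_cross s1 s2) c.
by rewrite !mulr_gt0 ?radius_gt0 ?curv_gt0.
Qed.

Lemma succ_cross C1 C2 C3 x y : node C1 C2 C3 x y ->
  0 < cross (center C2 - center C1) (center (succ C1 x y) - center C1).
Proof.
move=> n; have [s1 s2 c d] := node_spinors n; have [sS _] := succ_spin n.
rewrite (spin_cross s1 sS).
have -> : cross x (x - J (third x y)) = curv C1 by rewrite -c; unc; ring.
have dd : 0 < dot x (x - J (third x y)).
  rewrite (_ : dot _ _ = dot x x + dot x (- J (third x y))); last by unc; ring.
  by rewrite ltr_wpDl ?dot_ge0.
by rewrite !mulr_gt0 ?radius_gt0 ?curv_gt0.
Qed.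

(** The center lies in the triangle of centers; segments inside the disk carry the rest of it into
    the same bounded component. *)
Lemma succ_is_successor C1 C2 C3 x y : node C1 C2 C3 x y ->
  is_successor C1 C2 C3 (succ C1 x y).
Proof.
move=> n; have T := node_tangent n; have o := node_orient n.
set S := succ C1 x y.
have n' := succ_node n; have n2 := succ_node (node_rot n).
rewrite (succ_rot n) -/S in n2; rewrite -/S in n'.
have t1 : ext_tangent S C1 by case: (node_tangent n').
have t2 : ext_tangent S C2 by case: (node_tangent n') => _ /ext_tangentC.
have t3 : ext_tangent S C3 by case: (node_tangent n2) => _ /ext_tangentC.
split=> // q qS.
have out r : open_disk S r -> ~ (closed_disk C1 `|` closed_disk C2 `|` closed_disk C3) r.
  by move=> rS [[|]|]; apply: ext_tangent_disjoint rS.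
have cS : open_disk S (center S).
  by apply/open_diskE; rewrite subrr /dot mulr0 addr0 exprn_gt0 ?radius_gt0.
have : gap C1 C2 C3 (center S).
  apply: triangle_gap => //; last exact: out.
  have c1 := succ_cross n; have c2 := succ_cross (node_rot n).
  have c3 := succ_cross (node_rot (node_rot n)).
  rewrite (succ_rot (node_rot n)) (succ_rot n) in c3.
  by rewrite (succ_rot n) in c2.
rewrite /gap /bounded_complement /=.
have -> : center S = q + (center S - q) by rewrite addrC subrK.
rewrite -segment_component.
  by move=> [_ ?]; split=> //; apply: out.
move=> t /andP[t0 t1']; apply: out; apply/open_diskE.
move/open_diskE: qS; apply: le_lt_trans.
rewrite (_ : dot (q + _ - _) _ = (1 - t) ^+ 2 * dot (q - center S) (q - center S)); last by unc; ring.
by rewrite ler_piMl ?dot_ge0 // expr_le1 //; lra.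
Qed.

Lemma successor_unique C1 C2 C3 x y S : node C1 C2 C3 x y ->
  is_successor C1 C2 C3 S -> S = succ C1 x y.
Proof.
move=> n h; have [s1 s2 c d] := node_spinors n; have [sS _] := succ_spin n.
exact: spin_radius (succ_spinor s1 s2 c d h) sS.
Qed.

End Gaps.

(** * The arc of a circle that borders the gap *)

Section ApollonianArcs.
Variable R : realType.
Implicit Types (p q x y z a b w : plane R) (C D E S : circle R).

Lemma polar_upper (u v : R) : u ^+ 2 + v ^+ 2 = 1 -> 0 <= v ->
  exists t : R, [/\ cos t = u, sin t = v, 0 <= t & t <= pi].
Proof.
move=> uv v0; have u1 : -1 <= u <= 1.
  by rewrite -ler_norml -(@ler_pXn2r _ 2) ?nnegrE // expr1n real_normK ?num_real //;
    have := sqr_ge0 v; lra.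
have [/andP[t0 tp] tu] := acos_def u1.
exists (acos u); split=> //; rewrite sin_acos //.
by rewrite (_ : 1 - u ^+ 2 = v ^+ 2) ?sqrtr_sqr ?ger0_norm //; lra.
Qed.

Lemma polar_unit (u v : R) : u ^+ 2 + v ^+ 2 = 1 -> exists t : R, cos t = u /\ sin t = v.
Proof.
move=> uv; have [v0|/ltW v0] := lerP 0 v.
  by have [t [? ? _ _]] := polar_upper uv v0; exists t.
have [||t [tu tv _ _]] := @polar_upper u (- v); first by rewrite sqrrN.
  by rewrite oppr_ge0.
by exists (- t); rewrite cosN sinN tv opprK.
Qed.

Definition dir (t : R) : plane R := (cos t, sin t).
Lemma fst_dir t : (dir t).1 = cos t :> R. Proof. by []. Qed.
Lemma snd_dir t : (dir t).2 = sin t :> R. Proof. by []. Qed.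

Lemma dot_dir t : dot (dir t) (dir t) = 1.
Proof. by rewrite -(cos2Dsin2 t) /dot fst_dir snd_dir; ring. Qed.

Lemma csq_dir t : csq (dir t) = dir (t + t).
Proof.
apply: plane_eq; rewrite ?fst_csq ?snd_csq ?fst_dir ?snd_dir ?cosD ?sinD; ring.
Qed.

Lemma cross_dir s t : cross (dir s) (dir t) = sin (t - s).
Proof. by rewrite sinB /cross !fst_dir !snd_dir; ring. Qed.

Lemma enorm_gt0 w : 0 < dot w w -> 0 < enorm w.
Proof.
move=> h; rewrite lt_neqAle enorm_ge0 andbT eq_sym; apply/eqP => /enorm_eq0 e.
by move: h; rewrite e /dot !mul0r addr0 ltxx.
Qed.

Lemma enorm_dot w : enorm w ^+ 2 = dot w w.
Proof. by rewrite enorm_sqr; unc; ring. Qed.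

(** The angles of spinors are half the angles alpha. Choosing the second within pi after the first
    fixes compatible determinations, as [angle_range] needs. *)
Lemma half_angles a b : 0 < cross a b ->
  exists s d : R, [/\ a = enorm a *: dir s, b = enorm b *: dir (s + d), 0 < d & d < pi].
Proof.
move=> ab; have [a0 b0] := dot_gt0 ab.
have ea := enorm_gt0 a0; have eb := enorm_gt0 b0.
have na : enorm a != 0 by rewrite gt_eqF.
have nb : enorm b != 0 by rewrite gt_eqF.
have [|s [cs ss]] := @polar_unit (a.1 / enorm a) (a.2 / enorm a).
  by rewrite !expr_div_n -mulrDl -enorm_sqr divff // expf_neq0.
have [||d [cd sd d0 dpi]] := @polar_upper (dot a b / (enorm a * enorm b)) (cross a b / (enorm a * enorm b)).
- rewrite !expr_div_n -mulrDl exprMn !enorm_dot.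
  rewrite (_ : _ + _ = dot a a * dot b b); last by unc; ring.
  by rewrite divff // mulf_neq0 ?gt_eqF.
- by rewrite divr_ge0 ?ltW // mulr_gt0.
have sd0 : 0 < sin d by rewrite sd divr_gt0 // mulr_gt0.
have aE : a = enorm a *: dir s.
  by apply: plane_eq; rewrite !coordE ?fst_dir ?snd_dir ?cs ?ss mulrCA divff // mulr1.
exists s, d; split=> //.
- apply: plane_eq; rewrite !coordE ?fst_dir ?snd_dir ?cosD ?sinD cs ss cd sd.
    rewrite [RHS](_ : _ = (a.1 * dot a b - a.2 * cross a b) / (enorm a ^+ 2)); last by field; rewrite na nb.
    rewrite enorm_dot (_ : _ - _ = b.1 * dot a a); last by unc; ring.
    by rewrite mulfK ?gt_eqF.
  rewrite [RHS](_ : _ = (a.2 * dot a b + a.1 * cross a b) / (enorm a ^+ 2)); last by field; rewrite na nb.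
  rewrite enorm_dot (_ : _ + _ = b.2 * dot a a); last by unc; ring.
  by rewrite mulfK ?gt_eqF.
- rewrite lt_neqAle d0 andbT; apply/eqP => e; by rewrite -e sin0 ltxx in sd0.
- rewrite lt_neqAle dpi andbT; apply/eqP => e; by rewrite e sinpi ltxx in sd0.
Qed.

Section OneArc.
Variables (C0 C1 C2 : circle R) (a b : plane R).
Hypothesis sa : spin C0 C1 a.
Hypothesis sb : spin C0 C2 b.
Hypothesis cab : cross a b = curv C0.
Hypothesis dab : 0 < dot a b.

Let k0 : 0 < curv C0. Proof. exact: curv_gt0. Qed.
Let cab0 : 0 < cross a b. Proof. by rewrite cab. Qed.

Let t12 : ext_tangent C1 C2.
Proof. by apply/(spin_tangentP sa sb); rewrite cab. Qed.

(* Every direction strictly between those of C1 and C2, seen from C0, is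
   [csq e] for a unit vector [e] strictly between [a] and [b]; the points just
   outside C0 in that direction are in the gap. *)
Lemma arc_gap e : dot e e = 1 -> 0 < cross a e -> 0 < cross e b ->
  closure (gap C0 C1 C2) (center C0 + radius C0 *: csq e).
Proof.
move=> e1 X0 Y0; apply/closure_planeP => d d0.
have r0 := radius_gt0 C0; have r1 := radius_gt0 C1; have r2 := radius_gt0 C2.
have A0 : 0 < dot a a by case: (dot_gt0 cab0).
have B0 : 0 < dot b b by case: (dot_gt0 cab0).
have eE : curv C0 *: e = cross e b *: a + cross a e *: b.
  by rewrite -cab; apply: plane_eq; unc; ring.
have dae : 0 < dot a e.
  rewrite -(pmulr_rgt0 _ k0) (_ : _ * _ = dot a (curv C0 *: e)); last by unc; ring.
  rewrite eE (_ : dot _ _ = cross e b * dot a a + cross a e * dot a b); last by unc; ring.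
  by rewrite addr_gt0 // mulr_gt0.
have deb : 0 < dot e b.
  rewrite -(pmulr_rgt0 _ k0) (_ : _ * _ = dot (curv C0 *: e) b); last by unc; ring.
  rewrite eE (_ : dot _ _ = cross e b * dot a b + cross a e * dot b b); last by unc; ring.
  by rewrite addr_gt0 // mulr_gt0.
pose P := radius C1 * (dot a e * cross a e) + radius C2 * (dot e b * cross e b).
have P0 : 0 < P by rewrite addr_gt0 // mulr_gt0 // mulr_gt0.
have rk : radius C0 * curv C0 = 1 by rewrite /curv divff // gt_eqF.
have rA : radius C1 * dot a a = radius C1 * curv C0 + 1.
  by rewrite sa.2 mulrDr /curv [X in _ + X]divff // gt_eqF.
have rB : radius C2 * dot b b = radius C2 * curv C0 + 1.
  by rewrite sb.2 mulrDr /curv [X in _ + X]divff // gt_eqF.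
(* This puts the point of C0 in direction [csq e] on the inner side of the line through the centers
   of C1 and C2. After multiplication by the squared curvature and expansion of [e] in [a], [b] only
   positive terms remain. *)
have Q0 : 0 < radius C1 * radius C2 * dot a b - radius C0 * P.
  have E1 : curv C0 * dot a e = cross e b * dot a a + cross a e * dot a b.
    by rewrite [LHS](_ : _ = dot a (curv C0 *: e)); [rewrite eE|]; unc; ring.
  have E2 : curv C0 * dot e b = cross e b * dot a b + cross a e * dot b b.
    by rewrite [LHS](_ : _ = dot (curv C0 *: e) b); [rewrite eE|]; unc; ring.
  have E3 : curv C0 ^+ 2 = cross e b ^+ 2 * dot a a + cross a e ^+ 2 * dot b b +
      2 * cross a e * cross e b * dot a b.
    transitivity (curv C0 ^+ 2 * dot e e); first by rewrite e1 mulr1.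
    by rewrite [LHS](_ : _ = dot (curv C0 *: e) (curv C0 *: e)); [rewrite eE|]; unc; ring.
  have E4 : radius C1 * radius C2 * dot a b ^+ 2 =
      (radius C1 * dot a a) * (radius C2 * dot b b) - radius C1 * radius C2 * curv C0 ^+ 2.
    by rewrite -cab; unc; ring.
  have k2 : 0 < curv C0 ^+ 2 by rewrite exprn_gt0.
  rewrite -(pmulr_rgt0 _ k2).
  rewrite [X in 0 < X](_ : _ = radius C1 * radius C2 * dot a b * curv C0 ^+ 2 -
    (radius C0 * curv C0) * (radius C1 * cross a e * (curv C0 * dot a e) +
      radius C2 * cross e b * (curv C0 * dot e b))); last by rewrite /P; ring.
  rewrite rk E1 E2 mul1r {1}E3.
  rewrite [X in 0 < X](_ : _ = dot a b * radius C2 * cross e b ^+ 2 * (radius C1 * dot a a)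
    + dot a b * radius C1 * cross a e ^+ 2 * (radius C2 * dot b b)
    + 2 * cross a e * cross e b * (radius C1 * radius C2 * dot a b ^+ 2)
    - cross a e * cross e b * (radius C1 * dot a a + radius C2 * dot b b)
    - dot a b * (radius C1 * cross a e ^+ 2 + radius C2 * cross e b ^+ 2)); last by ring.
  rewrite E4 rA rB.
  rewrite [X in 0 < X](_ : _ = dot a b * radius C1 * radius C2 * curv C0 * (cross a e ^+ 2 + cross e b ^+ 2)
    + cross a e * cross e b * curv C0 * (radius C1 + radius C2)); last by ring.
  by rewrite addr_gt0 // !mulr_gt0 // addr_gt0 // exprn_gt0.
(* [h] is the height above C0: smaller than [d] for closeness, than the two squares to avoid C1 and
   C2, and with [h * P] small enough to stay in the triangle of centers. *)
have : exists2 h : R, 0 < h & [/\ h < d, h < 2 * radius C0 ^+ 2 * cross a e ^+ 2,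
    h < 2 * radius C0 ^+ 2 * cross e b ^+ 2 &
    h * P < radius C1 * radius C2 * dot a b - radius C0 * P].
  set Q := _ - _ in Q0 *.
  have x0 : 0 < 2 * radius C0 ^+ 2 * cross a e ^+ 2 by rewrite !mulr_gt0 ?exprn_gt0.
  have y0 : 0 < 2 * radius C0 ^+ 2 * cross e b ^+ 2 by rewrite !mulr_gt0 ?exprn_gt0.
  have qp : 0 < Q / P by rewrite divr_gt0.
  exists (Num.min (Num.min d (Q / P))
    (Num.min (2 * radius C0 ^+ 2 * cross a e ^+ 2) (2 * radius C0 ^+ 2 * cross e b ^+ 2)) / 2).
    by rewrite divr_gt0 // !lt_min d0 qp x0 y0.
  set m := Num.min _ _.
  have [m1 [m2 [m3 m4]]] : m <= d /\ m <= Q / P /\ m <= 2 * radius C0 ^+ 2 * cross a e ^+ 2 /\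
      m <= 2 * radius C0 ^+ 2 * cross e b ^+ 2.
    by rewrite /m !ge_min !lexx !orbT.
  have m0 : 0 < m by rewrite !lt_min d0 qp x0 y0.
  split; [lra|lra|lra|rewrite -(ltr_pdivlMr _ _ P0); lra].
move=> [h h0 [hd h1 h2 h3]].
exists (center C0 + (radius C0 + h) *: csq e); split; last 2 first.
- have n1 : `|(csq e).1 : R| <= 1.
    rewrite -(@ler_pXn2r _ 2) ?nnegrE // expr1n real_normK ?num_real //.
    have := sqr_ge0 ((csq e).2 : R); rewrite -(_ : dot (csq e) (csq e) = 1).
      by rewrite /dot !expr2; lra.
    by rewrite -[RHS](expr1n _ 2) -e1; unc; ring.
  rewrite (_ : _ - _ = h * (csq e).1); last by rewrite !coordE; ring.
  rewrite normrM gtr0_norm //; apply: le_lt_trans hd; rewrite ler_piMr // ltW //.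
- have n1 : `|(csq e).2 : R| <= 1.
    rewrite -(@ler_pXn2r _ 2) ?nnegrE // expr1n real_normK ?num_real //.
    have := sqr_ge0 ((csq e).1 : R); rewrite -(_ : dot (csq e) (csq e) = 1).
      by rewrite /dot !expr2; lra.
    by rewrite -[RHS](expr1n _ 2) -e1; unc; ring.
  rewrite (_ : _ - _ = h * (csq e).2); last by rewrite !coordE; ring.
  rewrite normrM gtr0_norm //; apply: le_lt_trans hd; rewrite ler_piMr // ltW //.
have rh : 0 < radius C0 + h by rewrite addr_gt0.
apply: triangle_gap.
- by split; [exact: spin_tangent sa|exact: t12|exact: ext_tangentC (spin_tangent sb)].
- by rewrite (spin_cross sa sb) !mulr_gt0.
- split.
  + rewrite sa.1 (_ : cross _ _ = radius C0 * radius C1 * (radius C0 + h) * (2 * dot a e * cross a e)).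
      by rewrite !mulr_gt0.
    by unc; ring.
  + rewrite sa.1 sb.1 (_ : cross _ _ = 2 * radius C0 * (radius C1 * radius C2 * dot a b *
      (radius C0 * cross a b) - (radius C0 + h) * P)).
      by rewrite cab rk mulr1 !mulr_gt0 // subr_gt0; lra.
    by rewrite /P; unc; ring.
  + rewrite sb.1 (_ : cross _ _ = radius C0 * radius C2 * (radius C0 + h) * (2 * dot e b * cross e b)).
      by rewrite !mulr_gt0.
    by unc; ring.
have out D x : spin C0 D x -> h < 2 * radius C0 ^+ 2 * cross x e ^+ 2 ->
    ~ closed_disk D (center C0 + (radius C0 + h) *: csq e).
  move=> sx hx /closed_diskE; apply/negP; rewrite -ltNge sx.1.
  have rD := radius_gt0 D.
  have rx : radius C0 * radius D * dot x x = radius C0 + radius D.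
    by rewrite sx.2 /curv; field; rewrite !gt_eqF.
  rewrite (_ : dot _ _ = ((radius C0 + h) * dot e e - radius C0 * radius D * dot x x) ^+ 2 +
    4 * (radius C0 + h) * radius C0 * radius D * cross x e ^+ 2); last by unc; ring.
  rewrite e1 rx.
  have c1 : 0 < radius D * (2 * radius C0 ^+ 2 * cross x e ^+ 2 - h) by rewrite mulr_gt0 ?subr_gt0.
  have c2 : 0 <= h * radius C0 * radius D * cross x e ^+ 2.
    by rewrite mulr_ge0 ?sqr_ge0 // !mulr_ge0 // ltW.
  have c3 := sqr_ge0 h; rewrite !expr2 in c1 c2 c3 *; lra.
move=> [[/closed_diskE|]|].
- apply/negP; rewrite -ltNge.
  rewrite (_ : dot _ _ = (radius C0 + h) ^+ 2 * dot e e ^+ 2); last by unc; ring.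
  rewrite e1 expr1n mulr1 ltr_pXn2r ?nnegrE ?ltW //; lra.
- exact: (out _ _ sa h1).
- apply: (out _ _ sb); rewrite (_ : cross b e = - cross e b); last by unc; ring.
  by rewrite sqrrN.
Qed.

End OneArc.
End ApollonianArcs.

(** * The Farey circles on C0 and the Apollonian curve *)

Section FareyArc.
Variable R : realType.
Implicit Types (p q x y z w : plane R) (C D E S : circle R).

Lemma near_scaled (r u v m q e : R) : 0 < r -> `|u - v| < e / (2 * r) ->
  `|q - (m + r * v)| < e / 2 -> `|q - (m + r * u)| < e.
Proof.
move=> r0 h1; have : `|r * (u - v)| < e / 2.
  rewrite normrM gtr0_norm // mulrC -ltr_pdivlMr // (_ : _ / _ / _ = e / (2 * r)) //.
  by field; rewrite gt_eqF.
by rewrite !ltr_norml => /andP[? ?] /andP[? ?]; apply/andP; split; lra.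
Qed.

Lemma is_successor_swap C D E S : is_successor C D E S -> is_successor C E D S.
Proof.
move=> [[t1 t2 t3] [s1 s2 s3] h]; split; first by split; exact: ext_tangentC.
  by [].
by rewrite /gap -setUA [closed_disk E `|` _]setUC setUA.
Qed.

Variables (C0 C1 C2 : circle R) (a b : plane R).
Hypothesis sa : spin C0 C1 a.
Hypothesis sb : spin C0 C2 b.
Hypothesis cab : cross a b = curv C0.
Hypothesis dab : 0 < dot a b.

Let k0 : 0 < curv C0. Proof. exact: curv_gt0. Qed.
Let cab0 : 0 < cross a b. Proof. by rewrite cab. Qed.

Definition farey_vector (m n : nat) : plane R := m%:R *: a + n%:R *: b.

Definition farey_circle C := exists m n : nat, spin C0 C (farey_vector m n).

Lemma farey_cross m n m' n' : cross (farey_vector m n) (farey_vector m' n') =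
  (m%:R * n'%:R - m'%:R * n%:R) * curv C0.
Proof. by rewrite -cab /farey_vector; unc; ring. Qed.

(** [cross a b] equals the curvature of C0, so by [spin_tangentP] tangent circles have index
    determinant plus or minus 1. *)
Lemma farey_det C D m n m' n' : spin C0 C (farey_vector m n) ->
  spin C0 D (farey_vector m' n') -> ext_tangent C D ->
  (m * n' = m' * n + 1)%N \/ (m' * n = m * n' + 1)%N.
Proof.
move=> sC sD /(spin_tangentP sC sD); rewrite farey_cross exprMn.
move=> /(canRL (mulfK _)); rewrite expf_neq0 ?gt_eqF // => /(_ isT).
rewrite divff ?expf_neq0 ?gt_eqF // => /eqP; rewrite sqrf_eq1 => /orP[] /eqP e; [left|right];
  apply/eqP; rewrite -(eqr_nat R) natrD !natrM; apply/eqP; lra.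
Qed.

Lemma farey_succ C D S m n m' n' : spin C0 C (farey_vector m n) ->
  spin C0 D (farey_vector m' n') -> (m * n' = m' * n + 1)%N ->
  is_successor C0 C D S -> spin C0 S (farey_vector (m + m') (n + n')).
Proof.
move=> sC sD e h.
have -> : farey_vector (m + m') (n + n') = farey_vector m n + farey_vector m' n'.
  by apply: plane_eq; rewrite /farey_vector !natrD; unc; ring.
have er : m%:R * n'%:R = m'%:R * n%:R + 1 :> R by rewrite -!natrM e natrD.
apply: succ_spinor sC sD _ _ h; first by rewrite farey_cross er; ring.
have [A0 B0] := dot_gt0 cab0.
rewrite (_ : dot _ _ = m%:R * m'%:R * dot a a + n%:R * n'%:R * dot b b +
  (m%:R * n'%:R + m'%:R * n%:R) * dot a b); last by rewrite /farey_vector; unc; ring.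
have P1 : 0 <= m%:R * m'%:R * dot a a by rewrite !mulr_ge0 // ltW.
have P2 : 0 <= n%:R * n'%:R * dot b b by rewrite !mulr_ge0 // ltW.
have P3 : 0 < (m%:R * n'%:R + m'%:R * n%:R) * dot a b.
  rewrite mulr_gt0 // er; have : 0 <= m'%:R * n%:R :> R by rewrite mulr_ge0.
  by lra.
lra.
Qed.

Lemma successor_chain_farey C : successor_chain C0 C1 C2 C -> farey_circle C.
Proof.
move=> /(_ farey_circle); apply; split; last first.
  move=> D [->|->]; [exists 1%N, 0%N|exists 0%N, 1%N];
    by rewrite /farey_vector scale1r scale0r ?addr0 ?add0r.
move=> D E S [m [n sD]] [m' [n' sE]] t h.
have [e|e] := farey_det sD sE t.
  by exists (m + m')%N, (n + n')%N; apply: farey_succ sD sE e h.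
exists (m' + m)%N, (n' + n)%N; apply: farey_succ sE sD e _.
exact: is_successor_swap.
Qed.

Lemma farey_quadrant C m n : spin C0 C (farey_vector m n) -> @quadrant R m%:R n%:R.
Proof.
move=> [_ h]; split; rewrite ?ler0n // -natrD ltr0n lt0n; apply/eqP => /eqP.
rewrite addn_eq0 => /andP[/eqP m0 /eqP n0]; move: h; rewrite m0 n0 /farey_vector.
rewrite !scale0r addr0 /dot fst0 snd0 mulr0 addr0 => h.
by have := curv_gt0 C; have := k0; lra.
Qed.

Section Curve.
Variables (th d : R).
Hypothesis aE : a = enorm a *: dir th.
Hypothesis bE : b = enorm b *: dir (th + d).
Hypothesis d0 : 0 < d.
Hypothesis dpi : d < pi.

(** Up to the factor [cross a b], [X t] and [Y t] are the coordinates in [a], [b] of the unit vector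
    of angle t / 2, a square root of the direction t. They are the Farey parameter of that
    direction. *)
Let X (t : R) := cross (dir (t / 2)) b.
Let Y (t : R) := cross a (dir (t / 2)).
Let t1 := th + th.
Let t2 := (th + d) + (th + d).

Lemma arc_segm t : segm t1 t2 t <-> t1 <= t <= t2.
Proof.
rewrite /segm /= in_itv /=.
have h : t1 <= t2 by rewrite /t1 /t2; have := d0; lra.
by rewrite (min_l h) (max_r h).
Qed.

Lemma ea0 : 0 < enorm a. Proof. by apply: enorm_gt0; case: (dot_gt0 cab0). Qed.
Lemma eb0 : 0 < enorm b. Proof. by apply: enorm_gt0; case: (dot_gt0 cab0). Qed.

Lemma XE t : X t = enorm b * sin (th + d - t / 2).
Proof. by rewrite -cross_dir /X {1}bE; unc; ring. Qed.

Lemma YE t : Y t = enorm a * sin (t / 2 - th).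
Proof. by rewrite -cross_dir /Y {1}aE; unc; ring. Qed.

Lemma XY_quadrant t : segm t1 t2 t -> quadrant (X t) (Y t).
Proof.
move=> /arc_segm; rewrite /t1 /t2 => /andP[h1 h2].
have X0 : 0 <= X t by rewrite XE mulr_ge0 ?(ltW eb0) // sin_ge0_pi //; have := dpi; have := d0; lra.
have Y0 : 0 <= Y t by rewrite YE mulr_ge0 ?(ltW ea0) // sin_ge0_pi //; have := dpi; have := d0; lra.
split=> //; rewrite lt_neqAle addr_ge0 // andbT eq_sym paddr_eq0 //.
apply/negP => /andP[/eqP x0 /eqP y0].
have : cross a b *: dir (t / 2) = X t *: a + Y t *: b.
  by apply: plane_eq; rewrite /X /Y; unc; ring.
rewrite x0 y0 !scale0r addr0 => e.
have : cross a b * dot (dir (t / 2)) (dir (t / 2)) = 0.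
  rewrite (_ : _ * _ = dot (cross a b *: dir (t / 2)) (dir (t / 2))); last by unc; ring.
  by rewrite e /dot fst0 snd0 !mul0r addr0.
by rewrite dot_dir mulr1 => e0; move: cab0; rewrite e0 ltxx.
Qed.

Lemma XY_gt0 t : t1 < t < t2 -> 0 < X t /\ 0 < Y t.
Proof.
rewrite /t1 /t2 => /andP[h1 h2]; rewrite XE YE.
by split; rewrite mulr_gt0 ?ea0 ?eb0 // sin_gt0_pi //; have := dpi; have := d0; lra.
Qed.

Lemma dir_half_continuous : continuous (fun t : R => X t) /\ continuous (fun t : R => Y t).
Proof.
have ch (f : R -> R) : continuous f -> continuous (fun t : R => f (t / 2)).
  move=> cf t; apply: (@continuous_comp _ _ _ (fun t : R => t / 2) f); last exact: cf.
  by apply: continuousM; [exact: cvg_id|exact: cst_continuous].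
have cc := ch _ (@continuous_cos R); have cs := ch _ (@continuous_sin R).
split=> t.
  rewrite (_ : (fun t => X t) = (fun s => b.2 * cos (s / 2) + (- b.1) * sin (s / 2) + 0)).
    exact: affine_continuous_at (cc t) (cs t).
  by apply/funext => s; rewrite /X /cross fst_dir snd_dir; ring.
rewrite (_ : (fun t => Y t) = (fun s => (- a.2) * cos (s / 2) + a.1 * sin (s / 2) + 0)).
  exact: affine_continuous_at (cc t) (cs t).
by apply/funext => s; rewrite /Y /cross fst_dir snd_dir; ring.
Qed.

Lemma polar_csq (r t : R) : polar r t = r *: csq (dir (t / 2)).
Proof.
rewrite csq_dir (_ : t / 2 + t / 2 = t); last by field.
by [].
Qed.

Lemma arc_angle_range : angle_range C0 C1 C2 t1 t2.
Proof.
have ang D x (e r : R) : spin C0 D x -> 0 <= r -> x = r *: dir e -> is_angle (center D - center C0) (e + e).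
  move=> [-> _] r0 xE; rewrite /is_angle addrC addKr.
  have r1 : 0 <= radius C0 * radius D by rewrite mulr_ge0 // ltW // radius_gt0.
  rewrite enormZ // enorm_csq xE polar_csq (_ : (e + e) / 2 = e); last by field.
  have := dot_dir e; move=> h; rewrite (_ : dot _ _ = r ^+ 2 * dot (dir e) (dir e)); last by unc; ring.
  by rewrite h; apply: plane_eq; unc; ring.
split; [exact: ang sa (enorm_ge0 a) aE|exact: ang sb (enorm_ge0 b) bE|].
move=> t /arc_segm ht.
have inner s : t1 < s < t2 -> closure (gap C0 C1 C2) (center C0 + polar (radius C0) s).
  move=> /XY_gt0[X0 Y0]; rewrite polar_csq.
  exact: (arc_gap sa sb cab dab (dot_dir _) Y0 X0).
apply/closure_planeP => eps eps0; have r0 := radius_gt0 C0.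
have eps1 : 0 < eps / (2 * radius C0) by rewrite divr_gt0 // mulr_gt0.
have [e e0 he] : exists2 e : R, 0 < e & forall s : R, `|t - s| < e ->
    `|cos t - cos s| < eps / (2 * radius C0) /\ `|sin t - sin s| < eps / (2 * radius C0).
  have /cvgrPdist_lt/(_ _ eps1) cc := @continuous_cos R t.
  have /cvgrPdist_lt/(_ _ eps1) cs := @continuous_sin R t.
  have : nbhs t [set s : R | `|cos t - cos s| < eps / (2 * radius C0) /\ `|sin t - sin s| < eps / (2 * radius C0)].
    by apply: filterS2 cc cs => s.
  by move=> /nbhs_ballP[e /= e0 h]; exists e.
have [h1 h2] : t1 <= t /\ t <= t2 by case/andP: ht.
have tt : t1 < t2 by rewrite /t1 /t2; have := d0; lra.
pose l := Num.min (1 / 2) (e / (2 * (t2 - t1))).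
have q0 : 0 < e / (2 * (t2 - t1)) by rewrite divr_gt0 // mulr_gt0 // subr_gt0.
have l0 : 0 < l by rewrite lt_min q0 andbT; lra.
have l1 : l <= 1 / 2 by rewrite ge_min lexx.
have l2 : l <= e / (2 * (t2 - t1)) by rewrite ge_min lexx orbT.
(* [arc_gap] covers interior angles only; a small move towards the middle of the interval also
   treats the ends. *)
pose s := t + l * ((t1 + t2) / 2 - t).
have st1 : 0 < l * (t2 - t1) by rewrite mulr_gt0 // subr_gt0.
have p1 : 0 <= (1 - l) * (t - t1) by rewrite mulr_ge0 //; lra.
have p2 : 0 <= (1 - l) * (t2 - t) by rewrite mulr_ge0 //; lra.
have le : l * (t2 - t1) <= e / 2.
  move: l2; rewrite ler_pdivlMr; last by rewrite mulr_gt0 // subr_gt0.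
  lra.
have p3 : 0 <= l * (t - t1) by apply: mulr_ge0; [exact: ltW|lra].
have p4 : 0 <= l * (t2 - t) by apply: mulr_ge0; [exact: ltW|lra].
have [|f1 f2] := he s; first by rewrite ltr_norml /s; apply/andP; split; lra.
have : closure (gap C0 C1 C2) (center C0 + polar (radius C0) s).
  by apply: inner; rewrite /s; apply/andP; split; lra.
have eps2 : 0 < eps / 2 by rewrite divr_gt0.
move=> /closure_planeP/(_ _ eps2)[q [gq n1 n2]]; exists q; split=> //.
- by move: n1; rewrite !coordE /polar /=; exact: near_scaled.
- by move: n2; rewrite !coordE /polar /=; exact: near_scaled.
Qed.

Variables (p : plane R) (c : R).
Hypothesis c0 : 0 < c.

Definition arc_curve (t : R) : plane R := pt p (c *: a) (c *: b)
  (curve1 (Num.max (X t) 0) (Num.max (Y t) 0)) (curve2 (Num.max (X t) 0) (Num.max (Y t) 0)).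

Lemma arc_curveE t : segm t1 t2 t ->
  arc_curve t = pt p (c *: a) (c *: b) (curve1 (X t) (Y t)) (curve2 (X t) (Y t)).
Proof. by move=> /XY_quadrant[x0 y0 _]; rewrite /arc_curve !max_l. Qed.

Lemma segm_ends : segm t1 t2 t1 /\ segm t1 t2 t2.
Proof. by split; apply/arc_segm; rewrite /t1 /t2; apply/andP; split; have := d0; lra. Qed.

Lemma arc_curve_start : arc_curve t1 = p.
Proof.
have [h _] := segm_ends; rewrite arc_curveE //; have [x0 _ xy] := XY_quadrant h.
have y0 : Y t1 = 0 by rewrite YE /t1 (_ : _ - _ = 0) ?sin0 ?mulr0 //; field.
rewrite y0 addr0 in xy; rewrite y0; have [-> ->] := curve0r xy.
by rewrite /pt !scale0r !addr0.
Qed.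

Lemma arc_curve_end : arc_curve t2 = p + c *: a + c *: b.
Proof.
have [_ h] := segm_ends; rewrite arc_curveE //; have [_ y0 xy] := XY_quadrant h.
have x0 : X t2 = 0 by rewrite XE /t2 (_ : _ - _ = 0) ?sin0 ?mulr0 //; field.
rewrite x0 add0r in xy; rewrite x0; have [-> ->] := curve0l xy.
by rewrite /pt !scale1r.
Qed.

Lemma arc_curve_image : arc_curve @` segm t1 t2 = arc p (c *: a) (c *: b).
Proof.
apply/seteqP; split=> q.
  move=> [t ht <-]; rewrite arc_curveE //.
  by have [<- <-] := unit_curve (XY_quadrant ht); exists (Y t / (X t + Y t)).
move=> [s ->]; rewrite /unit1 /unit2; have := quadrant_clamp s.
move: (Num.max _ _) (Num.max _ _) => y x q'; have [x0 y0 xy] := q'.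
have [h1 h2] := segm_ends.
have tt : t1 <= t2 by rewrite /t1 /t2; have := d0; lra.
have [cX cY] := dir_half_continuous.
(* At a zero of [f] the ratio X : Y is x : y. The sign changes because [Y] vanishes at the start and
   [X] at the end. *)
pose f (t : R) := x * Y t - y * X t.
have cf : continuous f.
  move=> t; rewrite (_ : f = (fun t => (- y) * X t + x * Y t + 0)).
    exact: affine_continuous_at (cX t) (cY t).
  by apply/funext => r; rewrite /f; ring.
have f1 : f t1 <= 0.
  have [X0 _ _] := XY_quadrant h1.
  have Y0 : Y t1 = 0 by rewrite YE /t1 (_ : _ - _ = 0) ?sin0 ?mulr0 //; field.
  by rewrite /f Y0 mulr0 sub0r oppr_le0 mulr_ge0.
have f2 : 0 <= f t2.
  have [_ Y0 _] := XY_quadrant h2.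
  have X0 : X t2 = 0 by rewrite XE /t2 (_ : _ - _ = 0) ?sin0 ?mulr0 //; field.
  by rewrite /f X0 mulr0 subr0 mulr_ge0.
have [|t] := @IVT R f t1 t2 0 tt (continuous_subspaceT cf).
  by rewrite ge_min f1 le_max f2 orbT.
rewrite in_itv /= => /arc_segm ht ft; exists t => //; rewrite arc_curveE //.
by have [|-> ->] := @curve_homog R (X t) (Y t) x y (XY_quadrant ht) q'; first by move: ft; rewrite /f; lra.
Qed.

Lemma arc_curve_continuous : {within segm t1 t2, continuous arc_curve}.
Proof.
apply: continuous_in_subspaceT => t; rewrite inE => ht.
have [cX cY] := dir_half_continuous.
have q := XY_quadrant ht.
have [|g1 g2] := @curve_continuous R _ X Y t (cX t) (cY t).
  by have [x0 y0 xy] := q; rewrite !max_l.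
apply: plane_continuous.
  rewrite (_ : (fun s => _) = (fun s => (c * a.1) * curve1 (Num.max (X s) 0) (Num.max (Y s) 0)
      + (c * b.1) * curve2 (Num.max (X s) 0) (Num.max (Y s) 0) + p.1)).
    exact: affine_continuous_at g1 g2.
  by apply/funext => s; rewrite /arc_curve /pt !coordE; ring.
rewrite (_ : (fun s => _) = (fun s => (c * a.2) * curve1 (Num.max (X s) 0) (Num.max (Y s) 0)
    + (c * b.2) * curve2 (Num.max (X s) 0) (Num.max (Y s) 0) + p.2)).
  exact: affine_continuous_at g1 g2.
by apply/funext => s; rewrite /arc_curve /pt !coordE; ring.
Qed.

(** At an angle of [C] the squares of [dir (t / 2)] and of the spinor point the same way. So the two
    vectors are parallel, not orthogonal, and (X t : Y t) = (m : n). *)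
Lemma arc_curve_farey C m n t : spin C0 C (farey_vector m n) -> segm t1 t2 t ->
  is_angle (center C - center C0) t ->
  arc_curve t = pt p (c *: a) (c *: b) (curve1 m%:R n%:R) (curve2 m%:R n%:R).
Proof.
move=> sC ht; set z := farey_vector m n in sC *; set e := dir (t / 2).
have [cC kC] := sC; rewrite /is_angle cC addrC addKr.
have r0 : 0 < radius C0 * radius C by rewrite mulr_gt0 // radius_gt0.
rewrite enormZ ?ltW // enorm_csq polar_csq -/e => hz.
have ze : csq z = dot z z *: csq e.
  by apply: (scalerI (lt0r_neq0 r0)); rewrite [RHS]scalerA.
have zz : 0 < dot z z by rewrite kC addr_gt0 // curv_gt0.
have c1 : cross (csq e) (csq z) = 0 by rewrite ze; unc; ring.
have d1 : dot (csq e) (csq z) = dot z z.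
  rewrite {1}ze (_ : dot _ _ = dot z z * (dot e e) ^+ 2); last by unc; ring.
  by rewrite dot_dir expr1n mulr1.
have ez : cross e z = 0.
  move: c1; rewrite cross_csq => /eqP; rewrite !mulf_eq0 pnatr_eq0 /= => /orP[/eqP h|/eqP //].
  move: d1; rewrite (_ : dot (csq e) (csq z) = dot e z ^+ 2 - cross e z ^+ 2); last by unc; ring.
  rewrite h => h'; have := sqr_ge0 (cross e z); move: h' zz; rewrite expr0n /=; lra.
rewrite arc_curveE //.
have [|-> ->] // := @curve_homog R (X t) (Y t) m%:R n%:R (XY_quadrant ht) (farey_quadrant sC).
have : cross e z = n%:R * X t - m%:R * Y t by rewrite /X /Y /z /e /farey_vector; unc; ring.
by rewrite ez; lra.
Qed.

Lemma arc_curve_step C D S m n m' n' t t' :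
  spin C0 C (farey_vector m n) -> spin C0 D (farey_vector m' n') ->
  (m * n' = m' * n + 1)%N -> is_successor C0 C D S ->
  segm t1 t2 t -> is_angle (center C - center C0) t ->
  segm t1 t2 t' -> is_angle (center D - center C0) t' ->
  exists l : R, arc_curve t' - arc_curve t = l *: (farey_vector (m + m') (n + n')).
Proof.
move=> sC sD e h ht At ht' At'.
rewrite (arc_curve_farey sC ht At) (arc_curve_farey sD ht' At').
have [l [l1 l2]] := farey_increment R e; exists (c * l).
apply: plane_eq; rewrite /pt /farey_vector !coordE.
  have := congr1 (fun r => r * (c * a.1)) l1; have := congr1 (fun r => r * (c * b.1)) l2.
  by rewrite /=; lra.
have := congr1 (fun r => r * (c * a.2)) l1; have := congr1 (fun r => r * (c * b.2)) l2.
by rewrite /=; lra.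
Qed.

Lemma spin_sqrt_line C x (l : R) : spin C0 C x -> sqrt_line (center C - center C0) (l *: x).
Proof.
move=> [-> _]; rewrite addrC addKr; set r := radius C0 * radius C.
have r0 : 0 < r by rewrite mulr_gt0 // radius_gt0.
have s0 : Num.sqrt r != 0 by rewrite gt_eqF // sqrtr_gt0.
exists (Num.sqrt r *: x); split; last first.
  by exists (l / Num.sqrt r); rewrite scalerA mulfVK.
rewrite -csq_complex; congr (_ +i* _)%C; unc;
  have := sqr_sqrtr (ltW r0); rewrite expr2 => e; rewrite -{3}e; ring.
Qed.

Lemma arc_is_curve : apollonian_curve C0 C1 C2 t1 t2 arc_curve.
Proof.
split; [exact: arc_angle_range|exact: arc_curve_continuous| |].
  have [h1 h2] := segm_ends; exists t1, t2; split=> //.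
  rewrite arc_curve_start arc_curve_end -addrA => e.
  have e0 : c *: a + c *: b = 0 by apply: (addrI p); rewrite addr0 -e.
  have : cross a (c *: a + c *: b) = c * curv C0 by rewrite -cab; unc; ring.
  rewrite e0 /cross fst0 snd0 !mulr0 subrr => h.
  by have := mulr_gt0 c0 k0; rewrite -h ltxx.
move=> C D S t t' /successor_chain_farey[m [n sC]] /successor_chain_farey[m' [n' sD]] tCD h ht At ht' At'.
have [e|e] := farey_det sC sD tCD.
  have [l hl] := arc_curve_step sC sD e h ht At ht' At'.
  rewrite -[arc_curve t - _]opprB hl -scaleNr; apply: spin_sqrt_line.
  exact: farey_succ sC sD e h.
have h' := is_successor_swap h.
have [l ->] := arc_curve_step sD sC e h' ht' At' ht At.
by apply: spin_sqrt_line; exact: farey_succ sD sC e h'.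
Qed.

End Curve.

Lemma arc_apollonian p (c : R) : 0 < c ->
  apollonian_arc C0 C1 C2 p (p + c *: a + c *: b) (arc p (c *: a) (c *: b)).
Proof.
move=> c0; have [th [d [aE bE d0 dpi]]] := half_angles cab0.
exists (th + th), (th + d + (th + d)), (arc_curve p c); split.
- exact: (arc_is_curve aE bE d0 dpi p c0).
- exact: (arc_curve_start aE bE d0 dpi).
- exact: (arc_curve_end aE bE d0 dpi).
- by rewrite (arc_curve_image aE bE d0 dpi).
Qed.

End FareyArc.

(** * Separation of circles by the inversive distance *)

Section Separation.
Variable R : realType.
Implicit Types (p q x y z a b w : plane R) (C D E S : circle R) (L : circle R -> R).

(* Inversive distance: -1 for equal circles, 1 for externally tangent ones,
   > 1 for circles with disjoint closed disks. *)
Definition invdist C D : R :=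
  (dot (center C - center D) (center C - center D) - radius C ^+ 2 - radius D ^+ 2) /
  (2 * radius C * radius D).

Lemma invdist_sym C D : invdist C D = invdist D C.
Proof.
rewrite /invdist (_ : dot (center C - center D) _ = dot (center D - center C) (center D - center C)).
  by rewrite -mulrA [radius C * _]mulrC mulrA addrAC.
by unc; ring.
Qed.

Lemma invdist_self C : invdist C C = -1.
Proof.
have r := radius_gt0 C; rewrite /invdist subrr (_ : dot 0 0 = 0); last by rewrite /dot fst0 snd0 mulr0 addr0.
by field; rewrite gt_eqF.
Qed.

Lemma invdist_tangent C D : ext_tangent C D <-> invdist C D = 1.
Proof.
have rC := radius_gt0 C; have rD := radius_gt0 D.
have n0 : 2 * radius C * radius D != 0 by rewrite !mulf_neq0 ?gt_eqF.
rewrite /ext_tangent enorm_eq_sqr ?addr_ge0 ?ltW // /invdist.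
split=> [->|/(canRL (mulfVK n0))]; first by field; rewrite !gt_eqF.
by rewrite mul1r => h; rewrite sqrrD -mulr_natl; lra.
Qed.

(* The functions of a circle that are linear in its curvature, curvature times
   center, and co-curvature. *)
Definition lin L := exists a0 a1 a2 a3 : R, forall D, L D =
  curv D * (a0 + a1 * (center D).1 + a2 * (center D).2 +
            a3 * (dot (center D) (center D) - radius D ^+ 2)).

Lemma lin_invdist C : lin (invdist C).
Proof.
have r := radius_gt0 C; pose k := (2 * radius C)^-1.
exists (k * (dot (center C) (center C) - radius C ^+ 2)), (- 2 * k * (center C).1), (- 2 * k * (center C).2), k.
move=> D; have s := radius_gt0 D; rewrite /invdist /curv /k.
rewrite (_ : dot (_ - _) _ = dot (center C) (center C) + dot (center D) (center D)
  - 2 * ((center C).1 * (center D).1 + (center C).2 * (center D).2)).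
  by field; rewrite !gt_eqF.
by unc; ring.
Qed.

Lemma lin_add L L' : lin L -> lin L' -> lin (fun D => L D + L' D).
Proof.
move=> [a0 [a1 [a2 [a3 h]]]] [b0 [b1 [b2 [b3 h']]]].
by exists (a0 + b0), (a1 + b1), (a2 + b2), (a3 + b3) => D; rewrite h h'; ring.
Qed.

Lemma lin_opp L : lin L -> lin (fun D => - L D).
Proof.
move=> [a0 [a1 [a2 [a3 h]]]].
by exists (- a0), (- a1), (- a2), (- a3) => D; rewrite h; ring.
Qed.

(* Seen from C, such a function is a quadratic form of the spinor, up to a
   constant. *)
Lemma lin_form L C : lin L -> exists A B1 B2 : R, forall D z, spin C D z ->
  L D = A * dot z z + B1 * (csq z).1 + B2 * (csq z).2 - L C.
Proof.
move=> [a0 [a1 [a2 [a3 h]]]]; have r := radius_gt0 C.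
exists (a0 + a1 * (center C).1 + a2 * (center C).2 + a3 * (dot (center C) (center C) + radius C ^+ 2)),
  (radius C * (a1 + 2 * a3 * (center C).1)), (radius C * (a2 + 2 * a3 * (center C).2)).
move=> D z [cD kD]; have s := radius_gt0 D; rewrite !h kD.
have sz : dot (csq z) (csq z) = (curv C + curv D) ^+ 2 by rewrite -kD; unc; ring.
rewrite (_ : dot (center D) (center D) = dot (center C) (center C)
  + 2 * radius C * radius D * ((center C).1 * (csq z).1 + (center C).2 * (csq z).2)
  + (radius C * radius D) ^+ 2 * dot (csq z) (csq z)).
  rewrite sz cD !coordE /curv; set u := (csq z).1; set v := (csq z).2.
  by field; rewrite !gt_eqF.
by rewrite cD /dot !coordE; ring.
Qed.

(** From C1, with [w] the spinor of C3, the circles C2, S and the next successor have spinors x, x +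
    w and 2 x + w. The parallelogram law for the quadratic form of [lin_form] gives the relation. *)
Lemma reflection L C1 C2 C3 x y : lin L -> node C1 C2 C3 x y ->
  L (succ C1 x (nexty x y)) = 2 * (L C1 + L C2 + L (succ C1 x y)) - L C3.
Proof.
move=> /(@lin_form _ C1)[A [B1 [B2 h]]] n.
have [s1 s2 _ _] := node_spinors n; have [sS _] := succ_spin n.
have [sS' _] := succ_spin (succ_node n).
rewrite (h _ _ sS') (h _ _ s1) (h _ _ s2) (h _ _ sS) /nexty; unc; ring.
Qed.

(** An invariant of the recurrence in [reflection]: for c >= 0 the excess grows by 2 (L C1 + L C2)
    in a child, so it never becomes negative. *)
Definition dominated (c : R) L C1 C2 C3 S :=
  [/\ c <= L C1, c <= L C2, c <= L C3 & 0 < L S - (L C1 + L C2 + L C3)].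

Lemma dominated_child c L C1 C2 C3 x y : 0 <= c -> lin L -> node C1 C2 C3 x y ->
  dominated c L C1 C2 C3 (succ C1 x y) ->
  dominated c L C1 C2 (succ C1 x y) (succ C1 x (nexty x y)).
Proof.
by move=> c0 lL n [h1 h2 h3 h4]; split; rewrite ?(reflection lL n); lra.
Qed.

Lemma dominated_rot c L C1 C2 C3 S : dominated c L C1 C2 C3 S -> dominated c L C2 C3 C1 S.
Proof. by move=> [h1 h2 h3 h4]; split=> //; lra. Qed.

Lemma node_invdist C1 C2 C3 x y : node C1 C2 C3 x y ->
  [/\ invdist C1 C2 = 1, invdist C2 C3 = 1 & invdist C3 C1 = 1] /\
  [/\ invdist C1 (succ C1 x y) = 1, invdist C2 (succ C1 x y) = 1 &
      invdist C3 (succ C1 x y) = 1].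
Proof.
move=> n; have [t1 t2 t3] := node_tangent n.
have [_ t4 t5] := node_tangent (succ_node n).
have [_ t6 _] := node_tangent (succ_node (node_rot n)); rewrite (succ_rot n) in t6.
by split; split; apply/invdist_tangent => //; exact: ext_tangentC.
Qed.

(** A circle that drops out of the triple has inversive distance 1 to the three circles of the child
    and 2 (1 + 1 + 1) + 1 = 7 to its successor. *)
Lemma third_dominated C1 C2 C3 x y : node C1 C2 C3 x y ->
  dominated 1 (invdist C3) C1 C2 (succ C1 x y) (succ C1 x (nexty x y)).
Proof.
move=> n; have [[q1 q2 q3] [q4 q5 q6]] := node_invdist n.
have e : invdist C3 C2 = 1 by rewrite invdist_sym.
by split; rewrite ?(reflection (lin_invdist C3) n) ?q3 ?q6 ?e ?invdist_self; lra.
Qed.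

(* The linear form given by the circle through the tangency points of the
   triple (C1, C2, S): it separates the gap of (C1, C2, S) from that of
   (C2, C3, S). *)
Definition dual C1 C2 S S' D : R :=
  invdist S' D - (invdist C1 D + invdist C2 D + invdist S D).

Lemma lin_dual C1 C2 S S' : lin (dual C1 C2 S S').
Proof.
apply: lin_add; first exact: lin_invdist.
by apply: lin_opp; apply: lin_add; [apply: lin_add|]; exact: lin_invdist.
Qed.

(** One reflection yields inversive distance 7, two yield 17. Thus [dual] takes the values 0, 4, 0
    on the sibling triple and 8 on its successor. *)
Lemma dual_dominated C1 C2 C3 x y (z := third x y) (S := succ C1 x y) : node C1 C2 C3 x y ->
  dominated 0 (dual C1 C2 S (succ C1 x (nexty x y))) C2 C3 S (succ C2 y (nexty y z)).
Proof.
move=> n; set S1 := succ C1 x (nexty x y); set S2 := succ C2 y _.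
have [[q1 q2 q3] [q4 q5 q6]] := node_invdist n.
have [_ [r4 r5 r6]] := node_invdist (succ_node n); rewrite -/S1 -/S in r4 r5 r6.
have [_ [t4 t5 t6]] := node_invdist (succ_node (node_rot n)).
rewrite (succ_rot n) -/z -/S2 -/S in t4 t5 t6.
have e3 : invdist S1 C3 = 7.
  rewrite invdist_sym (reflection (lin_invdist C3) n) invdist_self q3 q6.
  by rewrite invdist_sym q2; lra.
have refl D : invdist D S2 = 2 * (invdist D C2 + invdist D C3 + invdist D S) - invdist D C1.
  by have := reflection (lin_invdist D) (node_rot n); rewrite (succ_rot n).
have e1 : invdist C1 S2 = 7.
  by rewrite refl q1 (invdist_sym C1 C3) q3 q4 invdist_self; lra.
have e12 : invdist S1 S2 = 17.
  rewrite refl (invdist_sym S1 C2) r5 e3 (invdist_sym S1 S) r6 (invdist_sym S1 C1) r4; lra.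
have s2 : invdist S C2 = 1 by rewrite invdist_sym.
have s3 : invdist S C3 = 1 by rewrite invdist_sym.
have c13 : invdist C1 C3 = 1 by rewrite invdist_sym.
have d1 : invdist S1 C2 = 1 by rewrite invdist_sym.
have d2 : invdist S1 S = 1 by rewrite invdist_sym.
rewrite /dual; split;
  rewrite ?e12 ?e3 ?e1 ?t4 ?t6 ?d1 ?d2 ?s2 ?s3 ?c13 ?q1 ?q2 ?q4 ?q5 ?invdist_self; lra.
Qed.

End Separation.

(** * Boundaries inside a hexagon and right angles *)

Section LocalBoundary.
Variable R : realType.
Implicit Types (p q x y : plane R) (T : set (plane R)).

Lemma arc_ihex p x y t : acute x y -> unit1 t < 1 -> 0 < unit2 t ->
  ihex p x y (pt p x (- J (third x y)) (unit1 t) (unit2 t)).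
Proof.
case; rewrite -/(third x y) => h1 h2 h3 hK u1 v0.
have [v1 [vu _]] := below_bound (curve_below t).
rewrite /ihex /=; have [[[[[-> ->] ->] ->] ->] ->] := cell_forms p x y (unit1 t) (unit2 t).
move: (unit1 t) (unit2 t) u1 v0 v1 vu => u v u1 v0 v1 vu.
move: h1 h2 h3 hK; set k1 := - dot x (third x y); set k2 := - dot x y.
set k3 := - dot y (third x y); set K := - cross x y => h1 h2 h3 hK.
have P (c d : R) : 0 <= c -> 0 < d -> 0 <= c * d by move=> ? /ltW; apply: mulr_ge0.
have u0 : 0 <= u by lra.
have u2 : 0 < 1 - u by lra.
have v2 : 0 <= 1 - v by lra.
have := P _ _ u0 h1; have := P _ _ u0 h2; have := P _ _ u0 hK.
have := mulr_gt0 v0 h1; have := P _ _ v1 h3; have := mulr_gt0 v0 hK.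
have := mulr_gt0 u2 h1; have := mulr_gt0 u2 h2; have := mulr_gt0 u2 hK.
have := P _ _ v2 h1; have := P _ _ v2 h3; have := P _ _ v2 hK.
by move=> *; split; split; lra.
Qed.

(** [T] is known only in the hexagon, whose interior contains this part of the arc; there a small
    shift by (-d, d) leaves the cell. *)
Lemma arc_boundary p x y T t : acute x y -> T `&` hex p x y = cell p x y ->
  unit1 t < 1 -> 0 < unit2 t -> boundary T (pt p x (- J (third x y)) (unit1 t) (unit2 t)).
Proof.
move=> ac e u1 v0; have ih := arc_ihex p ac u1 v0; have nz := acute_cross ac.
have cq : cell p x y (pt p x (- J (third x y)) (unit1 t) (unit2 t)) by apply: arc_under; exists t.
split; first by apply: subset_closure; rewrite -e in cq; case: cq.
move=> nT; have nI : nbhs (pt p x (- J (third x y)) (unit1 t) (unit2 t)) (T `&` ihex p x y).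
  by apply: filterI => //; apply: open_nbhs_nbhs; split=> //; exact: ihex_open.
have [d d0 [Tq /ihex_hex hq]] := arc_shift_out nI.
have : (T `&` hex p x y) (pt p x (- J (third x y)) (unit1 t - d) (unit2 t + d)) by [].
by rewrite e => /(underE _ _ _ nz); apply: curve_shift.
Qed.

Lemma boundary_arc p x y T q : acute x y -> closed T -> T `&` hex p x y = cell p x y ->
  ihex p x y q -> boundary T q -> arc p x (- J (third x y)) q.
Proof.
move=> ac cT e ih []; rewrite -(closure_id T).1 // => Tq nT; have nz := acute_cross ac.
have : cell p x y q by rewrite -e; split=> //; exact: ihex_hex.
move=> [u [v [bl eq]]]; have := ih; rewrite eq /ihex /=.
have [[[[[_ ->] _] _] ->] _] := cell_forms p x y u v.
case: (ac) => k1 _ _ _; rewrite -/(third x y) in k1.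
move=> [[_ f1] _ [f2 _]]; rewrite pmulr_lgt0 // in f1; rewrite pmulr_lgt0 // subr_gt0 in f2.
have [ov|ov] := pselect (above u v).
  by apply: over_under => //; [apply/overE|apply/underE].
case: nT; rewrite eq; apply: filterS (under_interior p nz f2 f1 ov) => r [u' [v' [-> h1 h2 h3]]].
suff : cell p x y (pt p x (- J (third x y)) u' v') by rewrite -e => -[].
by apply/underE => //; apply: not_above_below.
Qed.

Lemma limit_boundary_start p x y T : acute x y -> T `&` hex p x y = cell p x y ->
  limit_point (boundary T) p.
Proof.
move=> ac e; have nz := acute_cross ac; apply: limit_pointP => U.
move=> /(@arc_near_start R p x (- J (third x y)))[t [Ut h1 h2 h3 h4]].
exists (pt p x (- J (third x y)) (unit1 t) (unit2 t)); split=> //; last exact: arc_boundary.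
have {2}<- : pt p x (- J (third x y)) 0 0 = p by rewrite /pt !scale0r !addr0.
by move=> /(pt_inj nz)[]; lra.
Qed.

Lemma limit_boundary_end p x y T : acute x y -> T `&` hex p x y = cell p x y ->
  limit_point (boundary T) (p + x - J (third x y)).
Proof.
move=> ac e; have nz := acute_cross ac; apply: limit_pointP => U.
set b := - J (third x y) => nU.
have [t [Ut h1 h2 h3 h4]] := @arc_near_start R _ (- b) (- x) _ nU.
have E : pt (p + x + b) (- b) (- x) (unit1 t) (unit2 t) = pt p x b (unit1 (1 - t)) (unit2 (1 - t)).
  have [-> ->] := unit_sym t; rewrite -[in RHS](pt_rev p x b).
  by congr pt; lra.
rewrite E in Ut; have [e1 e2] := unit_sym t.
exists (pt p x b (unit1 (1 - t)) (unit2 (1 - t))); split=> //; last first.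
  by apply: arc_boundary => //; rewrite ?e1 ?e2; lra.
have <- : pt p x b 1 1 = p + x + b by rewrite /pt !scale1r.
by move=> /(pt_inj nz)[]; lra.
Qed.

Lemma limit_boundary_mid p x y T (b := - J (third x y)) : acute x y ->
  T `&` hex p x y = cell p x y ->
  limit_point (boundary T) (p + 3^-1 *: x + 3^-1 *: (x + b)).
Proof.
move=> ac e; have nz := acute_cross ac; apply: limit_pointP => U.
move=> /(@arc_near_start R _ (3^-1 *: (x + b)) (3^-1 *: b))[t [Ut h1 h2 h3 h4]].
have [s [s1 s2]] := unit_high' t.
have E : pt (p + 3^-1 *: x + 3^-1 *: (x + b)) (3^-1 *: (x + b)) (3^-1 *: b) (unit1 t) (unit2 t)
    = pt p x b (unit1 s) (unit2 s).
  by rewrite s1 s2; apply: plane_eq; rewrite /pt !coordE; field.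
rewrite E in Ut; exists (pt p x b (unit1 s) (unit2 s)); split=> //; last first.
  by apply: arc_boundary => //; rewrite ?s1 ?s2; lra.
have -> : p + 3^-1 *: x + 3^-1 *: (x + b) = pt p x b (2 / 3) (1 / 3).
  by apply: plane_eq; rewrite /pt !coordE; field.
by move=> /(pt_inj nz)[]; lra.
Qed.

Lemma contact_ihex p x y : acute x y -> ihex p x y (contact p x y).
Proof.
move=> ac; apply: (center_tile_ihex ac).
by have := center_tile_cell p ac => h; have : (center_tile p x y `&` cell p x y) (contact p x y);
  [rewrite h|case].
Qed.

Lemma nonzero_cross (a b : plane R) : cross a b != 0 -> a != 0 /\ b != 0.
Proof.
move=> h; split; apply: contraNneq h => ->; rewrite /cross fst0 snd0.
  by rewrite !mul0r subrr.
by rewrite !mulr0 subrr.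
Qed.

Lemma tangent_mid p x y T : acute x y -> closed T -> T `&` hex p x y = cell p x y ->
  tangent_direction (boundary T) (contact p x y) (3^-1 *: (x - J (third x y))).
Proof.
move=> ac cT e; have nz := acute_cross ac; apply: hugs_tangent.
- apply: (proj1 (@nonzero_cross _ (- J (third x y)) _)).
  rewrite (_ : cross _ _ = 3^-1 * cross x (- J (third x y))).
    by rewrite mulf_neq0 // invr_eq0 pnatr_eq0.
  by rewrite /cross !coordE; ring.
- by rewrite contact_mid; apply: limit_boundary_mid e.
- apply: (hugs_near (L := arc p x (- J (third x y)))).
    have nI : nbhs (contact p x y) (ihex p x y).
      by apply: open_nbhs_nbhs; split; [exact: ihex_open|exact: contact_ihex].
    by apply: filterS nI => q; exact: boundary_arc.
  by rewrite contact_mid; apply: arc_hugs_mid.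
Qed.

(** Two lobes meet at the contact with the spoke as common tangent; the third is closed and misses
    it by [cell_opposite]. *)
Lemma hugs_center_tile p x y : acute x y ->
  hugs (boundary (center_tile p x y)) (contact p x y) (spoke x y).
Proof.
move=> ac; have s0 := spoke_sum x y; have c0 := spoke_cross ac.
have ac2 := acute_rot ac; have c2 := spoke_cross ac2; rewrite third_rot in c2.
have ac3 := acute_rot ac2; rewrite third_rot in ac3.
have c3 := spoke_cross ac3; rewrite third_rot' in c3.
have cl O d d' : 0 < cross d' d -> closed (lobe O d d') by move=> h; apply/under_closed/cross_lobe.
rewrite /center_tile /deltoid; set O := hub p x y.
apply: hugs_sub (boundary_setU _ _) _; [apply: closedU; exact: cl|exact: cl|].
apply: hugs_setU; first apply: hugs_sub (boundary_setU _ _) _; [exact: cl|exact: cl| |].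
  apply: hugs_setU; first by rewrite contactE; apply/under_hugs_start/cross_lobe.
  apply: (@hugs_sub _ _ (lobe O (spoke y (third x y)) (spoke (third x y) x))).
    by move=> q [+ _]; rewrite -(closure_id _).1 //; exact: cl.
  apply: hugs_far; first exact: cl.
  move=> h; have := @lobe_child_hex R (rotp p x y) y (third x y) ac2 (contact p x y).
  rewrite hub_rot third_rot => /(_ h) h'.
  have := cell_opposite p ac; rewrite -subset0; apply; split; last exact: h'.
  have := center_tile_cell p ac => E; have : [set contact p x y] (contact p x y) by [].
  by rewrite -E => -[].
have := under_hugs_end (O - spoke (third x y) x) (cross_lobe c3).
rewrite subrK => /(hugs_scale (-1)); rewrite scaleN1r opprK contactE; exact.
Qed.

Lemma dot_spoke x y : dot (spoke x y) (3^-1 *: (x - J (third x y))) = 0.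
Proof. by rewrite /spoke /dot /third !coordE !fstJ !sndJ !coordE; field. Qed.

Lemma center_tile_lobe p x y (X := 3^-1 *: x) (Y := childy x y) (Z := third X Y) : acute x y ->
  center_tile p x y `&` hex (contact p x y) Z X = cell (contact p x y) Z X.
Proof.
move=> ac; have := hex_rot2 p X Y; rewrite -/Z -/(contact p x y) => ->.
by rewrite center_tile_child // lobe_cell.
Qed.

Lemma center_tile_closed p x y : acute x y -> closed (center_tile p x y).
Proof. by move=> ac; apply: deltoid_closed; [exact: spoke_sum|exact: spoke_cross]. Qed.

Lemma contact_right_angle p x y T : acute x y -> closed T -> T `&` hex p x y = cell p x y ->
  meet_at_right_angle (center_tile p x y) T (contact p x y).
Proof.
move=> ac cT e; exists (spoke x y), (3^-1 *: (x - J (third x y))); split.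
- apply: hugs_tangent.
  + have c0 := spoke_cross ac; apply: (proj2 (@nonzero_cross (spoke y (third x y)) _ _)).
    by rewrite gt_eqF.
  + have ac3 : acute (third (3^-1 *: x) (childy x y)) (3^-1 *: x).
      by have := acute_rot (acute_rot (acute_child ac)); rewrite third_rot.
    exact: limit_boundary_start ac3 (center_tile_lobe p ac).
  + exact: hugs_center_tile.
- exact: tangent_mid.
- exact: dot_spoke.
Qed.

(** At [p] the arc of the first cell starts along [x], while that of the second ends along
    [- J x]. *)
Lemma cells_right_angle p x y : acute x y ->
  meet_at_right_angle (cell p x y) (cell (rotp p x y) y (third x y)) p /\ meet_at_right_angle (cell (rotp p x y) y (third x y)) (cell p x y) p.
Proof.
move=> ac; have ac2 := acute_rot ac; have nz := acute_cross ac; have nz2 := acute_cross ac2.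
have e q u v : acute u v -> cell q u v `&` hex q u v = cell q u v.
  by move=> h; apply/setIidl; apply: cell_hex.
have E : rotp p x y + y - J (third y (third x y)) = p.
  by apply: plane_eq; rewrite /rotp /third ?coordE ?fstJ ?sndJ ?coordE ?fstJ ?sndJ ?coordE; ring.
have t1 : tangent_direction (boundary (cell p x y)) p x.
  apply: hugs_tangent; first by case: (nonzero_cross nz).
    exact: limit_boundary_start ac (e _ _ _ ac).
  exact: under_hugs_start.
have t2 : tangent_direction (boundary (cell (rotp p x y) y (third x y))) p (- J x).
  have third3 := third_rot x y.
  apply: hugs_tangent; first by case: (nonzero_cross nz2); rewrite third3.
    by rewrite -{2}E; apply: limit_boundary_end ac2 (e _ _ _ ac2).
  rewrite -[X in hugs _ _ (- J X)](third_rot x y).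
  by rewrite -[X in hugs _ X _]E; apply: under_hugs_end.
have d0 : dot x (- J x) = 0 by rewrite /dot !coordE fstJ sndJ; ring.
have d1 : dot (- J x) x = 0 by rewrite /dot !coordE fstJ sndJ; ring.
by split; [exists x, (- J x)|exists (- J x), x].
Qed.

End LocalBoundary.

(** * The tree of triples and the inherited invariant *)

Section States.
Variable R : realType.
Implicit Types (C D : circle R) (T : set (plane R)).

(* A triple of the packing with its spinors, and the hexagon of the plane
   assigned to its gap. *)
Record state := State {
  s1 : circle R; s2 : circle R; s3 : circle R; sx : plane R; sy : plane R;
  gp : plane R; gx : plane R; gy : plane R }.
Implicit Type s : state.

(** Apollonian curves are determined up to scale, so the hexagon needs the spinors only up to a
    factor [c], which is divided by 3 at each level. *)
Definition valid s := node (s1 s) (s2 s) (s3 s) (sx s) (sy s) /\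
  exists c : R, [/\ 0 < c, gx s = c *: sx s & gy s = c *: sy s].

Definition rotS s := State (s2 s) (s3 s) (s1 s) (sy s) (third (sx s) (sy s))
  (rotp (gp s) (gx s) (gy s)) (gy s) (third (gx s) (gy s)).

Definition Succ s := succ (s1 s) (sx s) (sy s).

Definition childS s := State (s1 s) (s2 s) (Succ s) (sx s) (nexty (sx s) (sy s))
  (gp s) (3^-1 *: gx s) (childy (gx s) (gy s)).

Definition Hex s := hex (gp s) (gx s) (gy s).
Definition IHex s := ihex (gp s) (gx s) (gy s).
Definition Cell s := cell (gp s) (gx s) (gy s).
Definition Tile s := center_tile (gp s) (gx s) (gy s).
Definition Contact s := contact (gp s) (gx s) (gy s).
Definition Verts s : set (plane R) :=
  [set Contact s; Contact (rotS s); Contact (rotS (rotS s))].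

Lemma rotS3 s : rotS (rotS (rotS s)) = s.
Proof. by case: s => a b c x y p u v; rewrite /rotS /= !third_rot ?third_rot' rotp3. Qed.

Lemma Hex_rot s : Hex (rotS s) = Hex s. Proof. exact: hex_rot. Qed.
Lemma IHex_rot s : IHex (rotS s) = IHex s. Proof. exact: ihex_rot. Qed.
Lemma Tile_rot s : Tile (rotS s) = Tile s. Proof. exact: center_tile_rot. Qed.
Lemma Verts_rot s : Verts (rotS s) = Verts s.
Proof. by rewrite /Verts rotS3 setUC setUA. Qed.

Lemma valid_rot s : valid s -> valid (rotS s).
Proof.
move=> [n [c [c0 ex ey]]]; split; first exact: node_rot n.
by exists c; split=> //=; rewrite /third ex ey scalerBr scalerN.
Qed.

Lemma Succ_rot s : valid s -> Succ (rotS s) = Succ s.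
Proof. by move=> [n _]; exact: succ_rot n. Qed.

Lemma valid_child s : valid s -> valid (childS s).
Proof.
move=> [n [c [c0 ex ey]]]; split; first exact: succ_node n.
exists (c / 3); split=> /=; first by rewrite divr_gt0.
  by rewrite ex scalerA mulrC.
by apply: plane_eq; rewrite ex ey /childy /nexty !coordE ?fstJ ?sndJ !coordE; field.
Qed.

Lemma acute_scale (c : R) (x y : plane R) : 0 < c -> acute x y -> acute (c *: x) (c *: y).
Proof.
move=> c0 [h1 h2 h3 h4]; have cc := mulr_gt0 c0 c0.
split.
- by rewrite [X in 0 < X](_ : _ = c * c * - dot x (- x - y)) ?mulr_gt0 // /dot !coordE; ring.
- by rewrite [X in 0 < X](_ : _ = c * c * - dot x y) ?mulr_gt0 // /dot !coordE; ring.
- by rewrite [X in 0 < X](_ : _ = c * c * - dot y (- x - y)) ?mulr_gt0 // /dot !coordE; ring.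
- by rewrite [X in 0 < X](_ : _ = c * c * - cross x y) ?mulr_gt0 // /cross !coordE; ring.
Qed.

Lemma valid_acute s : valid s -> acute (gx s) (gy s).
Proof. by move=> [[_ _ _ ac _ _ _] [c [c0 -> ->]]]; exact: acute_scale. Qed.

(** Only the first circle is named; rotating the state reaches the other two. [far] records the
    separation of regions together with that of circles. *)
Definition memb s C T := C = s1 s /\ T `&` Hex s = Cell s.
Definition far s C T := T `&` Hex s = set0 /\ dominated 1 (invdist C) (s1 s) (s2 s) (s3 s) (Succ s).
(* How a circle outside the gap of [s], and its region, can lie with respect to
   [s]; this is inherited by the nodes below [s]. *)
Definition outside s C T :=
  [\/ memb s C T, memb (rotS s) C T, memb (rotS (rotS s)) C T | far s C T].

Lemma far_rot s C T : valid s -> far s C T -> far (rotS s) C T.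
Proof.
move=> v [e d]; split; first by rewrite Hex_rot.
by rewrite (Succ_rot v); apply: dominated_rot.
Qed.

Lemma outside_rot s C T : valid s -> outside s C T -> outside (rotS s) C T.
Proof.
move=> v [h|h|h|h]; [|exact: Or41|exact: Or42|].
  by apply: Or43; rewrite rotS3.
by apply: Or44; exact: far_rot.
Qed.

(** The first two circles stay in the triple, by [cell_first] and [cell_second]; the third drops out
    and becomes far, by [cell_opposite] and [third_dominated]. *)
Lemma outside_child s C T : valid s -> outside s C T -> outside (childS s) C T.
Proof.
move=> v; have ac := valid_acute v; have sub : Hex (childS s) `<=` Hex s by exact: hex_child_sub.
have cut A : T `&` Hex s = A -> T `&` Hex (childS s) = A `&` Hex (childS s).
  by move=> <-; rewrite -setIA [Hex s `&` _]setIC (setIidl sub).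
have ac2 := acute_rot ac; have ac3 := acute_rot ac2; rewrite third_rot in ac3.
case=> [[e h]|[e h]|[e h]|[h d]].
- by apply: Or41; split=> //; rewrite (cut _ h); exact: cell_first.
- apply: Or42; split; first by [].
  rewrite Hex_rot (cut _ (etrans (esym (congr1 _ (Hex_rot s))) h)).
  have := cell_second (rotp (gp s) (gx s) (gy s)) ac2.
  by cbv zeta; rewrite third_rot rotp3.
- apply: Or44; split.
    rewrite !Hex_rot in h; rewrite (cut _ h) /Cell /= third_rot.
    have := cell_opposite (gp (rotS (rotS s))) ac3.
    by rewrite third_rot' /= rotp3.
  by rewrite e; case: v => n _; exact: third_dominated n.
- apply: Or44; split; first by rewrite (cut _ h) set0I.
  by case: v => n _; exact: dominated_child ler01 (lin_invdist C) n d.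
Qed.

Lemma outside_base s : valid s -> outside (childS s) (Succ s) (Tile s).
Proof.
move=> v; apply: Or43; split=> //; have := center_tile_lobe (gp s) (valid_acute v).
by rewrite /Hex /Cell /= third_rot.
Qed.

Definition step (j : 'I_3) s := childS (iter j rotS s).
Definition node_at s (w : seq 'I_3) := foldl (fun s j => step j s) s w.

Lemma valid_iter s (j : nat) : valid s -> valid (iter j rotS s).
Proof. by move=> v; elim: j => //= j; apply: valid_rot. Qed.

Lemma valid_step s j : valid s -> valid (step j s).
Proof. by move=> v; apply/valid_child/valid_iter. Qed.

Lemma valid_at s w : valid s -> valid (node_at s w).
Proof. by elim: w s => //= j w IH s v; apply/IH/valid_step. Qed.

Lemma outside_step s j C T : valid s -> outside s C T -> outside (step j s) C T.
Proof.
move=> v h; apply: outside_child; first exact: valid_iter.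
by elim: (j : nat) => //= k; apply: outside_rot; exact: valid_iter.
Qed.

Lemma outside_at s w C T : valid s -> outside s C T -> outside (node_at s w) C T.
Proof. by elim: w s => //= j w IH s v h; apply: IH; [exact: valid_step|exact: outside_step]. Qed.

Lemma Succ_iter s (j : nat) : valid s -> Succ (iter j rotS s) = Succ s.
Proof. by move=> v; elim: j => //= j <-; rewrite Succ_rot //; exact: valid_iter. Qed.

Lemma Tile_iter s (j : nat) : Tile (iter j rotS s) = Tile s.
Proof. by elim: j => //= j <-; rewrite Tile_rot. Qed.

Lemma Hex_iter s (j : nat) : Hex (iter j rotS s) = Hex s.
Proof. by elim: j => //= j <-; rewrite Hex_rot. Qed.

Lemma IHex_iter s (j : nat) : IHex (iter j rotS s) = IHex s.
Proof. by elim: j => //= j <-; rewrite IHex_rot. Qed.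

Lemma outside_Succ s j : valid s -> outside (step j s) (Succ s) (Tile s).
Proof.
by move=> v; have := outside_base (valid_iter j v); rewrite Succ_iter // Tile_iter.
Qed.

Lemma outside_memb s : valid s -> outside s (s1 s) (Cell s).
Proof.
by move=> v; apply: Or41; split=> //; apply: setIidl; apply: cell_hex; exact: valid_acute.
Qed.

Definition member s C := [\/ C = s1 s, C = s2 s | C = s3 s].

Lemma outside_invdist s C T : valid s -> outside s C T ->
  member s C /\ invdist C (Succ s) = 1 \/ far s C T /\ 1 < invdist C (Succ s).
Proof.
move=> [n _]; have [_ [e1 e2 e3]] := node_invdist n.
case=> [[-> _]|[-> _]|[-> _]|f].
- by left; split=> //; exact: Or31.
- by left; split=> //; exact: Or32.
- by left; split=> //; exact: Or33.
- by right; split=> //; case: f => _ [h1 h2 h3 h4]; lra.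
Qed.

Lemma IHex_step s j : valid s -> IHex (step j s) `<=` IHex s.
Proof.
move=> v; rewrite -(IHex_iter s j).
by apply: ihex_child_sub; apply/valid_acute/valid_iter.
Qed.

Lemma IHex_at s w : valid s -> IHex (node_at s w) `<=` IHex s.
Proof.
elim: w s => [|j w IH] s v //=; apply: subset_trans (IH _ (valid_step j v)) _.
exact: IHex_step.
Qed.

Lemma Tile_IHex s : valid s -> Tile s `<=` IHex s.
Proof. by move=> v; apply: center_tile_ihex; exact: valid_acute. Qed.

Lemma Tile_at s w : valid s -> Tile (node_at s w) `<=` IHex s.
Proof. by move=> v; apply: subset_trans (Tile_IHex (valid_at w v)) (IHex_at v). Qed.

Lemma dominated_rotS c L s : valid s -> dominated c L (s1 s) (s2 s) (s3 s) (Succ s) ->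
  dominated c L (s1 (rotS s)) (s2 (rotS s)) (s3 (rotS s)) (Succ (rotS s)).
Proof. by move=> v /dominated_rot; rewrite Succ_rot. Qed.

Lemma dominated_childS c L s : 0 <= c -> lin L -> valid s ->
  dominated c L (s1 s) (s2 s) (s3 s) (Succ s) ->
  dominated c L (s1 (childS s)) (s2 (childS s)) (s3 (childS s)) (Succ (childS s)).
Proof. by move=> c0 lL [n _]; exact: dominated_child. Qed.

Lemma dominated_at c L s w : valid s -> 0 <= c -> lin L ->
  dominated c L (s1 s) (s2 s) (s3 s) (Succ s) ->
  forall s' : state, s' = node_at s w -> dominated c L (s1 s') (s2 s') (s3 s') (Succ s').
Proof.
move=> v c0 lL d s' ->; elim: w s v d => //= j w IH s v d; apply: IH; first exact: valid_step.
apply: dominated_childS => //; first exact: valid_iter.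
by elim: (j : nat) => //= k; apply: dominated_rotS; exact: valid_iter.
Qed.

Lemma dominated_Succ c L s : 0 <= c -> dominated c L (s1 s) (s2 s) (s3 s) (Succ s) -> c < L (Succ s).
Proof. by move=> c0 [h1 h2 h3 h4]; lra. Qed.

Lemma invdist_ge1 s C T w : valid s -> outside s C T -> 1 <= invdist C (Succ (node_at s w)).
Proof.
move=> v h; case: (outside_invdist (valid_at w v) (outside_at w v h)) => -[_]; first by move=> ->.
exact: ltW.
Qed.

(** The tiles lie in hexagons with disjoint interiors. For the circles, fix [D] below [t']:
    positivity of [dual] at [D] says exactly that the inversive distance to [D], as a function on
    the triple of [t], starts out dominated; the recurrence then runs below [t]. *)
Lemma siblings_next s w w' (t := childS s) (t' := childS (rotS s)) : valid s ->
  1 < invdist (Succ (node_at t w)) (Succ (node_at t' w')) /\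
  Tile (node_at t w) `&` Tile (node_at t' w') = set0.
Proof.
move=> v; have vr := valid_rot v; have vt : valid t by exact: valid_child.
have vt' : valid t' by exact: valid_child.
split; last first.
  apply/seteqP; split=> // q [/(Tile_at vt) h /(Tile_at vt') /ihex_hex h'].
  exact: (child_hex_disjoint (gp s) (gx s) (gy s) q).1 h h'.
set D := Succ (node_at t' w').
have o1 : 1 <= invdist (s1 s) D.
  apply: (@invdist_ge1 t' _ (Cell s)) => //; apply: outside_child => //.
  by apply: outside_rot => //; exact: outside_memb.
have o2 : 1 <= invdist (s2 s) D.
  by apply: (@invdist_ge1 t' _ (Cell (rotS s))) => //; apply: outside_child => //; exact: outside_memb.
have o3 : 1 <= invdist (Succ s) D.
  apply: (@invdist_ge1 t' _ (Tile s)) => //; rewrite -(Succ_rot v) -(Tile_rot s).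
  exact: outside_base.
have [n _] := v; have dd := dual_dominated n; cbv zeta in dd.
have := @dominated_at 0 _ t' w' vt' (lexx 0) (lin_dual _ _ _ _).
have -> : s3 t' = Succ s by exact: Succ_rot.
have -> : Succ t' = succ (s2 s) (sy s) (nexty (sy s) (third (sx s) (sy s))) by [].
move=> /(_ _ _ _ _ dd _ erefl) /(dominated_Succ (lexx 0)); rewrite -/D /dual => h.
rewrite invdist_sym; apply: (dominated_Succ (c := 1)) => //.
apply: (@dominated_at 1 _ t w vt) => //; first exact: lin_invdist.
rewrite /= -/(Succ t); have e : Succ t = succ (s1 s) (sx s) (nexty (sx s) (sy s)) by [].
rewrite -e -/(Succ s) ![invdist _ D]invdist_sym in h.
rewrite ![invdist _ D]invdist_sym in o1 o2 o3.
by split=> //; lra.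
Qed.

End States.

(** * Pairwise compatibility of all circles and regions *)

Section Items.
Variable R : realType.
Implicit Types (C D : circle R) (T V : set (plane R)) (s : state R) (w : seq 'I_3).

Record item := Item { circ : circle R; region : set (plane R); corners : set (plane R) }.
Implicit Type X Y : item.

Definition apart X Y := 1 < invdist (circ X) (circ Y) /\ region X `&` region Y = set0.

Definition touches X Y := exists p, [/\ corners X p, region X `&` region Y = [set p] &
  meet_at_right_angle (region X) (region Y) p].

(** Both orders of the radii are listed, so for equal radii the meeting point must be a vertex of
    both regions. *)
Definition linked X Y := [/\ invdist (circ X) (circ Y) = 1,
  radius (circ Y) <= radius (circ X) -> touches Y X &
  radius (circ X) <= radius (circ Y) -> touches X Y].

Definition compatible X Y := apart X Y \/ linked X Y.

Lemma apart_sym X Y : apart X Y -> apart Y X.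
Proof. by move=> [h e]; split; [rewrite invdist_sym|rewrite setIC]. Qed.

Lemma compatible_sym X Y : compatible X Y -> compatible Y X.
Proof.
move=> [/apart_sym h|[e h1 h2]]; [by left|right].
by split; rewrite 1?invdist_sym.
Qed.

Definition node_item s := Item (Succ s) (Tile s) (Verts s).
Definition root_item s := Item (s1 s) (Cell s) [set gp s; gp s + gx s - J (third (gx s) (gy s))].

Lemma radius_Succ s : valid s -> radius (Succ s) < radius (s1 s).
Proof.
move=> [n _]; have [_ k] := succ_spin n; have k2 := curv_gt0 (s2 s); have k3 := curv_gt0 (s3 s).
rewrite -[radius (Succ s)]invrK -[radius (s1 s)]invrK ltf_pV2 ?posrE ?curv_gt0 //.
rewrite -/(curv (Succ s)) -/(curv (s1 s)) [curv (Succ s)]k /succ_curv; move: k2 k3; case: n => _ _ _ [_ _ _ hK] -> -> ->.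
lra.
Qed.

(** A successor is strictly smaller than its neighbours in the triple, so only its own vertex is
    required. Its tile lies in the hexagon, where [region X] is the cell. *)
Lemma memb_linked s X : valid s -> closed (region X) -> memb s (circ X) (region X) ->
  linked X (node_item s).
Proof.
case: X => C T V; rewrite /memb /= => v cT [-> e]; have ac := valid_acute v.
have [[_ _ _] [q _ _]] := node_invdist v.1; split=> //= [_|]; last first.
  by move=> h; have := lt_le_trans (radius_Succ v) h; rewrite ltxx.
exists (Contact s); split; first by left; left.
  rewrite -(center_tile_cell _ ac) -[cell _ _ _]e [T `&` _]setIC setIA; congr (_ `&` _).
  by apply/esym/setIidl; apply: subset_trans (Tile_IHex v) _; exact: ihex_hex.
exact: contact_right_angle.
Qed.

Lemma node_item_rot s : valid s -> node_item (rotS s) = node_item s.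
Proof. by move=> v; rewrite /node_item Succ_rot // Tile_rot Verts_rot. Qed.

Lemma outside_compatible s X : valid s -> closed (region X) ->
  outside s (circ X) (region X) -> compatible X (node_item s).
Proof.
move=> v cT; have v2 := valid_rot v; have v3 := valid_rot v2.
case=> [h|h|h|h].
- by right; exact: memb_linked.
- by right; rewrite -(node_item_rot v); exact: memb_linked.
- by right; rewrite -(node_item_rot v) -(node_item_rot v2); exact: memb_linked.
left; case: h => e [h1 h2 h3 h4]; split; first by move: h4 => /=; lra.
apply/seteqP; split=> // q [Xq /(Tile_IHex v)/ihex_hex hq].
by rewrite -e.
Qed.

Lemma closed_Tile s : valid s -> closed (Tile s).
Proof. by move=> v; apply: center_tile_closed; exact: valid_acute. Qed.

Lemma closed_Cell s : valid s -> closed (Cell s).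
Proof. by move=> v; apply: under_closed; apply: acute_cross; exact: valid_acute. Qed.

Lemma siblings s (j k : 'I_3) w w' : valid s -> j != k ->
  apart (node_item (node_at (step j s) w)) (node_item (node_at (step k s) w')).
Proof.
move=> v; have v2 := valid_rot v; have v3 := valid_rot v2.
case: j => [[|[|[|//]]] ?]; case: k => [[|[|[|//]]] ?] // _.
- exact: siblings_next v.
- by have := siblings_next w' w v3; rewrite rotS3 => /(@apart_sym (node_item _) (node_item _)).
- by have := siblings_next w' w v => /(@apart_sym (node_item _) (node_item _)).
- exact: siblings_next v2.
- by have := siblings_next w w' v3; rewrite rotS3.
- by have := siblings_next w' w v2 => /(@apart_sym (node_item _) (node_item _)).
Qed.

(** If [w'] is a prefix of [w], its circle was placed earlier and stays outside; otherwise the words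
    branch and [siblings] applies. The sizes exclude that [w] is a proper prefix of [w']. *)
Lemma outside_or_apart s w w' : valid s -> w != w' -> (size w' <= size w)%N ->
  outside (node_at s w) (Succ (node_at s w')) (Tile (node_at s w')) \/
  apart (node_item (node_at s w')) (node_item (node_at s w)).
Proof.
elim: w' w s => [|k w' IH] [|j w] s v //=.
  move=> _ _; left; apply: outside_at; [exact: valid_step|exact: outside_Succ].
rewrite eqseq_cons ltnS; have [->|jk] := eqVneq j k.
  by move=> /=; apply: IH; exact: valid_step.
by move=> _ _; right; apply: siblings => //; rewrite eq_sym.
Qed.

Lemma nodes_compatible s w w' : valid s -> w != w' ->
  compatible (node_item (node_at s w)) (node_item (node_at s w')).
Proof.
move=> v; wlog le : w w' / (size w' <= size w)%N.
  move=> H n; have [/H|/ltnW/H] := leqP (size w') (size w); first exact.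
  by rewrite eq_sym => /(_ n)/compatible_sym.
move=> n; apply: compatible_sym; have vw := valid_at w v; have vw' := valid_at w' v.
have [h|h] := outside_or_apart v n le; last by left.
by apply: outside_compatible => //; exact: closed_Tile.
Qed.

Lemma roots_compatible s : valid s -> compatible (root_item s) (root_item (rotS s)).
Proof.
move=> v; have ac := valid_acute v; right.
have [[q _ _] _] := node_invdist v.1; have [r1 r2] := cells_right_angle (gp s) ac.
have m := cells_meet (gp s) ac; split=> //= _; exists (gp s); split=> //=.
- right=> /=; apply: plane_eq; rewrite /rotp /third ?coordE ?fstJ ?sndJ ?coordE ?fstJ ?sndJ ?coordE; ring.
- by rewrite setIC.
- by left.
Qed.

End Items.

(** * The regions are Apollonian triangles *)

Section Triangles.
Variable R : realType.
Implicit Types (C D : circle R) (T V : set (plane R)) (s : state R) (w : seq 'I_3).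

Lemma state_arc s (b := - J (third (gx s) (gy s))) : valid s ->
  apollonian_arc (s1 s) (s2 s) (s3 s) (gp s) (gp s + gx s + b) (arc (gp s) (gx s) b).
Proof.
move=> [n [c [c0 ex ey]]]; have [h1 h2 h3 h4] := node_spinors n.
have -> : b = c *: - J (third (sx s) (sy s)).
  by rewrite /b ex ey; apply: plane_eq; rewrite /third ?coordE ?fstJ ?sndJ ?coordE ?fstJ ?sndJ ?coordE; ring.
by rewrite ex; exact: arc_apollonian.
Qed.

(** In a child state rotated twice the successor comes first, so a side of its triangle is the arc
    of that state. *)
Lemma side_arc s (t := rotS (rotS (childS s))) :
  side (hub (gp s) (gx s) (gy s)) (spoke (gx s) (gy s)) (spoke (gy s) (third (gx s) (gy s))) =
    arc (gp t) (gx t) (- J (third (gx t) (gy t))) /\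
  gp t + gx t - J (third (gx t) (gy t)) = Contact (rotS s).
Proof.
have e1 : Contact (rotS s) = hub (gp s) (gx s) (gy s) - spoke (gy s) (third (gx s) (gy s)).
  by rewrite /Contact contactE hub_rot.
have e2 : gp t = hub (gp s) (gx s) (gy s) - spoke (gx s) (gy s).
  by rewrite -contactE.
rewrite e1 e2 /side /t /= third_rot.
set O := hub _ _ _; rewrite /spoke /childy /third.
split; [congr arc|]; by apply: plane_eq; rewrite ?coordE ?fstJ ?sndJ ?coordE ?fstJ ?sndJ ?coordE; field.
Qed.

Lemma node_arc s : valid s ->
  apollonian_arc (Succ s) (s1 s) (s2 s) (Contact s) (Contact (rotS s))
    (side (hub (gp s) (gx s) (gy s)) (spoke (gx s) (gy s)) (spoke (gy s) (third (gx s) (gy s)))).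
Proof.
move=> v; have [-> <-] := side_arc s.
exact: (state_arc (valid_rot (valid_rot (valid_child v)))).
Qed.

Lemma node_triangle s : valid s ->
  apollonian_triangle (Succ s) (s1 s) (s2 s) (s3 s) (Tile s) (Verts s).
Proof.
move=> v; have v2 := valid_rot v; have v3 := valid_rot v2; split.
  by case: v => n _; exact: succ_is_successor.
have k1 := node_arc v; have k2 := node_arc v2; have k3 := node_arc v3.
rewrite Succ_rot // in k2; rewrite !Succ_rot // rotS3 in k3.
do 6!eexists; split; [exact: k1|exact: k2|exact: k3| |by []].
rewrite /= !hub_rot !third_rot ?third_rot' deltoid_region //; first exact: spoke_sum.
by apply: spoke_cross; exact: valid_acute.
Qed.

Lemma root_triangle s : valid s ->
  degenerate_triangle (s1 s) (s2 s) (s3 s) (Cell s)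
    [set gp s; gp s + gx s - J (third (gx s) (gy s))].
Proof.
move=> v; have ac := valid_acute v; have nz := acute_cross ac; have [n1 n2] := nonzero_cross nz.
do 5!eexists; split; [exact: (state_arc v)| | | |by []].
- by apply: hugs_tangent n1 _ _; [exact: arc_limit_start|exact: arc_hugs_start].
- apply: hugs_tangent n2 _ _; last exact: arc_hugs_end.
  rewrite -arc_rev; apply: arc_limit_start.
  by rewrite (_ : cross _ _ = - cross (gx s) (- J (third (gx s) (gy s)))) ?oppr_eq0 //
    /cross ?coordE; ring.
- by rewrite degenerate_region.
Qed.

End Triangles.

(** * The circles generated by successors are those of the tree *)

Section InnerPacking.
Variable R : realType.
Implicit Types (C D E S : circle R) (s : state R) (w : seq 'I_3).

Lemma is_successor_rot C D E S : is_successor C D E S -> is_successor D E C S.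
Proof.
by move=> [[t1 t2 t3] [u1 u2 u3] h]; split=> //; rewrite /gap -setUA setUC in h.
Qed.

Lemma ext_tangent_neq C : ~ ext_tangent C C.
Proof. by move=> /invdist_tangent; rewrite invdist_self; lra. Qed.

Lemma member_rot s C : member s C -> member (rotS s) C.
Proof. by case=> ->; [exact: Or33|exact: Or31|exact: Or32]. Qed.

Lemma successor_members s C D E S : valid s -> member s C -> member s D -> member s E ->
  is_successor C D E S -> S = Succ s.
Proof.
have first s' C' D' E' S' : valid s' -> C' = s1 s' -> member s' D' -> member s' E' ->
    is_successor C' D' E' S' -> S' = Succ s'.
  move=> [n _] -> hD hE suc; case: (suc) => -[t1 t2 t3] _ _.
  case: hD suc t1 t2 => -> suc t1 t2; first by case: (ext_tangent_neq t1).
    case: hE suc t2 t3 => -> suc t2 t3; [by case: (ext_tangent_neq t3)|by case: (ext_tangent_neq t2)|].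
    exact: successor_unique n suc.
  case: hE suc t2 t3 => -> suc t2 t3; [by case: (ext_tangent_neq t3)| |by case: (ext_tangent_neq t2)].
  by apply: successor_unique n _; exact: is_successor_swap.
move=> v hC hD hE suc; case: hC => e.
- exact: first v e hD hE suc.
- rewrite -Succ_rot //; apply: first (valid_rot v) e _ _ suc; exact: member_rot.
- have v2 := valid_rot v; rewrite -Succ_rot // -(Succ_rot v2).
  by apply: first (valid_rot v2) e _ _ suc; do 2!apply: member_rot.
Qed.

Lemma member_step s D E : member s D -> member s E -> ext_tangent D E ->
  exists j, member (step j s) D /\ member (step j s) E.
Proof.
pose j1 : 'I_3 := @Ordinal 3 1 isT; pose j2 : 'I_3 := @Ordinal 3 2 isT.
case=> -> [] -> t.
- by case: (ext_tangent_neq t).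
- by exists ord0; split; [exact: Or31|exact: Or32].
- by exists j2; split; [exact: Or32|exact: Or31].
- by exists ord0; split; [exact: Or32|exact: Or31].
- by case: (ext_tangent_neq t).
- by exists j1; split; [exact: Or31|exact: Or32].
- by exists j2; split; [exact: Or31|exact: Or32].
- by exists j1; split; [exact: Or32|exact: Or31].
- by case: (ext_tangent_neq t).
Qed.

Definition index := ('I_3 + seq 'I_3)%type.

Definition item_at s (i : index) : item R :=
  match i with inl j => root_item (iter j (@rotS R) s) | inr w => node_item (node_at s w) end.

(** The offset puts the three root circles before the successor of the root triple, whose word is
    empty. *)
Definition depth (i : index) := match i with inl _ => 0%N | inr w => (size w).+1 end.

Lemma outside_root s (j : 'I_3) : valid s ->
  let X := item_at s (inl j) in outside s (circ X) (region X).
Proof.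
move=> v; case: j => [[|[|[|//]]] ?] /=; first exact: outside_memb.
  have := outside_memb (valid_rot v).
  by move=> /(outside_rot (valid_rot v)) /(outside_rot (valid_rot (valid_rot v))); rewrite rotS3.
by move=> /=; have := outside_memb (valid_rot (valid_rot v)) => /(outside_rot (valid_rot (valid_rot v))); rewrite rotS3.
Qed.

Lemma items_compatible s i k : valid s -> i != k -> compatible (item_at s i) (item_at s k).
Proof.
move=> v; have v2 := valid_rot v; have v3 := valid_rot v2.
have c1 := roots_compatible v; have c2 := roots_compatible v2.
have c3 := roots_compatible v3; rewrite rotS3 in c3.
case: i => [i|w]; case: k => [k|w'] n.
- case: i n => [[|[|[|//]]] ?]; case: k => [[|[|[|//]]] ?] //= _; do ?[by []];
    by apply: compatible_sym.
- apply: outside_compatible; [exact: valid_at|exact/closed_Cell/valid_iter|].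
  by apply: outside_at => //; exact: outside_root.
- apply: compatible_sym; apply: outside_compatible; [exact: valid_at|exact/closed_Cell/valid_iter|].
  by apply: outside_at => //; exact: outside_root.
- exact: nodes_compatible.
Qed.

(** A circle has inversive distance -1 to itself, while different positions are compatible and thus
    at distance at least 1. *)
Lemma item_at_inj s i k : valid s -> circ (item_at s i) = circ (item_at s k) -> i = k.
Proof.
move=> v e; apply/eqP; apply: contraPT (invdist_self (circ (item_at s i))) => n.
by rewrite {2}e; case: (items_compatible v n) => -[]; lra.
Qed.

Lemma root_member s (j : 'I_3) : member s (circ (item_at s (inl j))).
Proof. by case: j => [[|[|[|//]]] ?]; [exact: Or31|exact: Or32|exact: Or33]. Qed.

Lemma tangent_member s i w : valid s -> i != inr w -> (depth i <= (size w).+1)%N ->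
  ext_tangent (circ (item_at s i)) (Succ (node_at s w)) -> member (node_at s w) (circ (item_at s i)).
Proof.
move=> v n d t; have vw := valid_at w v.
suff : outside (node_at s w) (circ (item_at s i)) (region (item_at s i)) \/
    apart (item_at s i) (node_item (node_at s w)).
  move/invdist_tangent: t => t [/(outside_invdist vw)[[]//|[_]]|[]] /=; rewrite t ltxx //.
case: i n d {t} => [j|w'] n d; first by left; apply: outside_at => //; exact: outside_root.
by apply: outside_or_apart => //; apply: contraNneq n => ->.
Qed.

(** Take a deepest of the three circles. If it is a successor, the other two are tangent to it and
    no deeper, hence in its triple by [tangent_member]; the three form the triple of a child.
    Otherwise all are roots. *)
Lemma items_closed s C D E S : valid s ->
  let G := [set C | exists i, C = circ (item_at s i)] in
  G C -> G D -> G E -> is_successor C D E S -> G S.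
Proof.
move=> v G.
have top i k l S' : (depth k <= depth i)%N -> (depth l <= depth i)%N ->
    is_successor (circ (item_at s i)) (circ (item_at s k)) (circ (item_at s l)) S' -> G S'.
  move=> lk ll suc; case: i lk ll suc => [i|w] lk ll suc.
    case: k lk suc => // k _; case: l ll => // l _ suc; exists (inr [::]).
    by apply: (successor_members v) suc; exact: root_member.
  case: (suc) => -[t1 t2 t3] _ _; have vw := valid_at w v.
  have nk : k != inr w by apply/eqP => e; rewrite e in t1; exact: ext_tangent_neq t1.
  have nl : l != inr w by apply/eqP => e; rewrite e in t3; exact: ext_tangent_neq t3.
  have mk := tangent_member v nk lk (ext_tangentC t1).
  have ml := tangent_member v nl ll t3.
  have [j [mk' ml']] := member_step mk ml t2.
  exists (inr (rcons w j)); rewrite /= /node_at foldl_rcons -/(node_at s w).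
  apply: (successor_members (valid_step j vw)) suc => //.
  by apply: Or33; rewrite /= Succ_iter.
move=> [i ->] [k ->] [l ->] suc.
have [ki|/ltnW ik] := leqP (depth k) (depth i); have [li|/ltnW il] := leqP (depth l) (depth i).
- exact: top ki li suc.
- by apply: (top l i k) => //; [exact: leq_trans ki il|do 2!apply: is_successor_rot].
- by apply: (top k l i) => //; [exact: leq_trans li ik|apply: is_successor_rot].
have [lk|/ltnW kl] := leqP (depth l) (depth k).
  by apply: (top k l i) => //; apply: is_successor_rot.
by apply: (top l i k) => //; do 2!apply: is_successor_rot.
Qed.

Lemma inner_packing_items s : valid s ->
  inner_packing (s1 s) (s2 s) (s3 s) = [set C | exists i, C = circ (item_at s i)].
Proof.
move=> v; apply/seteqP; split=> C.
  apply; split; first by move=> D1 D2 D3 S h1 h2 h3 suc; exact: (items_closed v h1 h2 h3 suc).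
  pose j1 : 'I_3 := @Ordinal 3 1 isT; pose j2 : 'I_3 := @Ordinal 3 2 isT.
  by move=> D [[->|->]|->]; [exists (inl ord0)|exists (inl j1)|exists (inl j2)].
move=> [i ->] G [Gs GC].
have g1 : G (s1 s) by apply: GC; left; left.
have g2 : G (s2 s) by apply: GC; left; right.
have g3 : G (s3 s) by apply: GC; right.
case: i => [[[|[|[|//]]] ?]|w] //=.
suff : [/\ G (s1 (node_at s w)), G (s2 (node_at s w)) & G (s3 (node_at s w))].
  by move=> [h1 h2 h3]; apply: Gs h1 h2 h3 _; case: (valid_at w v) => n _; exact: succ_is_successor.
elim: w s v g1 g2 g3 {GC} => //= j w IH s v g1 g2 g3.
have gS : G (Succ s) by apply: Gs g1 g2 g3 _; case: v => n _; exact: succ_is_successor.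
apply: IH; first exact: valid_step.
- by case: j => [[|[|[|//]]] ?].
- by case: j => [[|[|[|//]]] ?].
- by rewrite /= Succ_iter.
Qed.

End InnerPacking.

(** * Density of the regions in the root hexagon *)

Section Density.
Variable R : realType.
Implicit Types (p q r : plane R) (U : set (plane R)) (s : state R) (w : seq 'I_3).

Definition cells_in U s := [/\ Cell s `<=` U, Cell (rotS s) `<=` U & Cell (rotS (rotS s)) `<=` U].

Lemma cells_in_rot U s : cells_in U s -> cells_in U (rotS s).
Proof. by move=> [h1 h2 h3]; split=> //; rewrite rotS3. Qed.

(** The cells of a child are pieces of two cells of its parent and of the tile. *)
Lemma cells_in_child U s : valid s -> cells_in U s -> Tile s `<=` U -> cells_in U (childS s).
Proof.
move=> v [h1 h2 _] t; have ac := valid_acute v; split.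
- rewrite /Cell /= -(cell_first _ ac); apply: subset_trans h1.
  exact: subIsetl.
- apply: subset_trans h2; have := cell_second (rotp (gp s) (gx s) (gy s)) (acute_rot ac).
  by cbv zeta; rewrite third_rot rotp3 => e; rewrite [Cell _](esym e); exact: subIsetl.
- have e := center_tile_lobe (gp s) ac; rewrite /Cell /= third_rot [cell _ _ _](esym e).
  by apply: subset_trans t; exact: subIsetl.
Qed.

Lemma cells_in_step U s j : valid s -> cells_in U s -> Tile s `<=` U -> cells_in U (step j s).
Proof.
move=> v c t; apply: cells_in_child; [exact: valid_iter| |by rewrite Tile_iter].
by elim: (j : nat) => //= k; exact: cells_in_rot.
Qed.

Definition diam2 s : R := size2 (gx s) (gy s).

Lemma diam2_rot s : diam2 (rotS s) = diam2 s.
Proof. by rewrite /diam2 /size2 /= third_rot; lra. Qed.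

Lemma diam2_step s j : valid s -> diam2 (step j s) <= 4 / 9 * diam2 s.
Proof.
move=> v; have -> : diam2 s = diam2 (iter j (@rotS R) s).
  by elim: (j : nat) => //= k ->; rewrite diam2_rot.
by apply: size2_child; apply/valid_acute/valid_iter.
Qed.

Lemma Cell_start s : valid s -> Cell s (gp s).
Proof. by move=> v; apply/arc_under/arc_start; apply: acute_cross; exact: valid_acute. Qed.

Lemma Hex_step s q : valid s -> Hex s q ->
  [\/ Cell s q, Cell (rotS s) q | Cell (rotS (rotS s)) q] \/ exists j, Hex (step j s) q.
Proof.
pose j1 : 'I_3 := @Ordinal 3 1 isT; pose j2 : 'I_3 := @Ordinal 3 2 isT.
move=> v /(hex_cover (valid_acute v))[[h|[h|h]]|[h|[h|h]]].
- by left; exact: Or31.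
- by left; exact: Or32.
- by left; apply: Or33; rewrite /Cell /= third_rot.
- by right; exists ord0.
- by right; exists j1.
- by right; exists j2; rewrite /Hex /= third_rot.
Qed.

(** Follow [q] through n subdivisions: it either falls into a cell or ends in a hexagon with squared
    size reduced by (4/9)^n, a corner of which lies in [U]. *)
Lemma region_near U s n q : valid s -> cells_in U s ->
  (forall w, Tile (node_at s w) `<=` U) -> Hex s q ->
  exists2 r, U r & dot (q - r) (q - r) <= (4 / 9) ^+ n * (6 * diam2 s).
Proof.
elim: n s => [|n IH] s v c t hq.
  exists (gp s); first by case: c => + _ _; apply; exact: Cell_start.
  have ac := valid_acute v; rewrite mul1r; apply: (hex_diameter ac hq).
  by apply: (cell_hex ac); exact: Cell_start.
have [h|[j hj]] := Hex_step v hq.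
  exists q; first by case: c => c1 c2 c3; case: h; [exact: c1|exact: c2|exact: c3].
  rewrite subrr /dot fst0 snd0 mulr0 addr0; apply: mulr_ge0.
    by apply: exprn_ge0; apply: divr_ge0.
  by apply: mulr_ge0 => //; apply: addr_ge0; [apply: addr_ge0|]; exact: dot_ge0.
have [r Ur hr] := IH _ (valid_step j v) (cells_in_step j v c (t [::]))
  (fun w => t (j :: w)) hj.
exists r => //; apply: le_trans hr _.
rewrite exprSr -mulrA ler_wpM2l ?exprn_ge0 ?divr_ge0 //.
by have := diam2_step j v; lra.
Qed.

Lemma power_small (e : R) (M : R) : 0 < e -> exists n : nat, (4 / 9) ^+ n * M < e.
Proof.
move=> e0; have [M0|M0] := lerP M 0.
  by exists 0%N; rewrite mul1r; lra.
have c : (4 / 9 : R) ^+ n @[n --> \oo] --> (0 : R).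
  by apply: cvg_expr; rewrite ger0_norm; lra.
have e2 : 0 < e / M by rewrite divr_gt0.
have /cvgrPdist_lt/(_ _ e2)[n _ h] := c.
exists n; have := h n (leqnn n).
have c0 : 0 <= (4 / 9 : R) ^+ n by apply: exprn_ge0; lra.
by rewrite /= sub0r normrN (ger0_norm c0) ltr_pdivlMr.
Qed.

Lemma region_dense U s : valid s -> cells_in U s ->
  (forall w, Tile (node_at s w) `<=` U) -> Hex s `<=` closure U.
Proof.
move=> v c t q hq; apply/closure_planeP => e e0.
have [|n hn] := @power_small (e ^+ 2) (6 * diam2 s); first by rewrite exprn_gt0.
have [r Ur hr] := region_near n v c t hq; exists r; split=> //;
  rewrite -(@ltr_pXn2r _ 2) ?nnegrE ?normr_ge0 ?(ltW e0) // real_normK ?num_real //;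
  apply: le_lt_trans hn; apply: le_trans hr; rewrite /dot ?coordE;
  have := sqr_ge0 (r.1 - q.1); have := sqr_ge0 (r.2 - q.2); rewrite !expr2; lra.
Qed.

Lemma convex_Hex s : convex_set (Hex s).
Proof.
apply/convex_setW => q r; rewrite !inE => hq hr t t0 t1.
have tt : (0 : R) <= t%:num <= 1 by rewrite !ltW.
by rewrite inE; have := hex_segment tt hq hr.
Qed.

End Density.

(** * Assembly of the triangulation *)

Section Triangulation.
Variable R : realType.
Implicit Types (C D : circle R) (p q : plane R) (s : state R) (w : seq 'I_3) (S T V K : set (plane R)).

Lemma member_item s w C : valid s -> member (node_at s w) C -> exists i, C = circ (item_at s i).
Proof.
pose j1 : 'I_3 := @Ordinal 3 1 isT; pose j2 : 'I_3 := @Ordinal 3 2 isT.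
move=> v; elim/last_ind: w C => [|w j IH] C.
  by case=> ->; [exists (inl ord0)|exists (inl j1)|exists (inl j2)].
rewrite /node_at foldl_rcons -/(node_at s w).
have : Succ (iter j (@rotS R) (node_at s w)) = circ (item_at s (inr w)).
  by rewrite Succ_iter //; exact: valid_at.
case: j => [[|[|[|//]]] ?] e [] h;
  solve [by apply: IH; rewrite h; exact: Or31 | by apply: IH; rewrite h; exact: Or32
    | by apply: IH; rewrite h; exact: Or33 | by exists (inr w); rewrite -e].
Qed.

Lemma circle_set_point C : circle_set C !=set0.
Proof.
have r := radius_gt0 C; exists (center C + (radius C, 0)); rewrite /circle_set /= addrC addKr.
rewrite /enorm /= expr0n addr0 sqrtr_sqr ger0_norm //; exact: ltW.
Qed.

Lemma tangent_circles_meet C D : ext_tangent C D -> circle_set C `&` circle_set D !=set0.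
Proof.
move=> t; have rC := radius_gt0 C; have rD := radius_gt0 D.
have k0 : 0 < radius C + radius D by lra.
have h : enorm (center D - center C) = radius C + radius D by rewrite -enormN opprB t.
exists (center C + (radius C / (radius C + radius D)) *: (center D - center C)).
split; rewrite /circle_set /=.
  by rewrite addrC addKr enormZ ?divr_ge0 ?ltW // h divfK // gt_eqF.
rewrite (_ : _ - center D = (radius D / (radius C + radius D)) *: (center C - center D)).
  by rewrite enormZ ?divr_ge0 ?ltW // t divfK // gt_eqF.
by apply: plane_eq; rewrite !coordE; field; rewrite gt_eqF.
Qed.

Lemma node_triangulation s : valid s -> exists S,
  apollonian_triangulation (s1 s) (s2 s) (s3 s) S /\ convex_set (closure S).
Proof.
move=> v; have vi j := valid_iter j v.
pose j1 : 'I_3 := @Ordinal 3 1 isT; pose j2 : 'I_3 := @Ordinal 3 2 isT.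
(* Regions must be indexed by circles rather than by positions in the tree; [item_at_inj] makes this
   union the region at the only position of the circle. *)
pose T C := [set q | exists i, circ (item_at s i) = C /\ region (item_at s i) q].
pose V C := [set q | exists i, circ (item_at s i) = C /\ corners (item_at s i) q].
have TE i : T (circ (item_at s i)) = region (item_at s i).
  by apply/seteqP; split=> q; [move=> [k [/(item_at_inj v) ->]]|exists i].
have VE i : V (circ (item_at s i)) = corners (item_at s i).
  by apply/seteqP; split=> q; [move=> [k [/(item_at_inj v) ->]]|exists i].
pose A := inner_packing (s1 s) (s2 s) (s3 s).
have AE : A = [set C | exists i, C = circ (item_at s i)] by exact: inner_packing_items.
exists (\bigcup_(C in A) T C); split; last first.
  have sub i : region (item_at s i) `<=` \bigcup_(C in A) T C.
    by move=> q h; exists (circ (item_at s i)); rewrite ?TE // AE; exists i.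
  (* All regions lie in the closed root hexagon, and [region_dense] gives the converse inclusion. *)
  suff -> : closure (\bigcup_(C in A) T C) = Hex s by exact: convex_Hex.
  apply/seteqP; split.
    rewrite [X in _ `<=` X](closure_id (Hex s)).1; last exact: hex_closed.
    apply: closureS => q [C _ [[j|w] [_]]] /=.
      by rewrite -(Hex_iter s j); apply: cell_hex; exact: valid_acute.
    by move=> /(Tile_at v)/ihex_hex.
  apply: region_dense => // [|w]; last exact: (sub (inr w)).
  by split; [exact: (sub (inl ord0))|exact: (sub (inl j1))|exact: (sub (inl j2))].
exists T, V; split=> //.
- have d (j : 'I_3) : let t := iter j (@rotS R) s in
      degenerate_triangle (s1 t) (s2 t) (s3 t) (T (s1 t)) (V (s1 t)).
    by move=> t; rewrite [T _](TE (inl j)) [V _](VE (inl j)); exact: (root_triangle (vi j)).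
  by split; [exact: (d ord0)|exact: (d j1)|exact: (d j2)].
- rewrite -/A AE => C [[j|w] ->] nr.
    by case: nr; case: (j) => [[|[|[|//]]] ?]; [left; left|left; right|right].
  have m C' : member (node_at s w) C' -> exists i, C' = circ (item_at s i) by exact: member_item.
  exists (s1 (node_at s w)), (s2 (node_at s w)), (s3 (node_at s w)).
  split; [by apply: m; exact: Or31|by apply: m; exact: Or32|by apply: m; exact: Or33|].
  by rewrite TE VE; apply/node_triangle/valid_at.
- rewrite -/A AE => C C' [i ->] [k ->] e; rewrite !TE.
  have [ik|ik] := eqVneq i k.
    by have [q h] := circle_set_point (circ (item_at s i)); move: e;
      rewrite ik setIid -ik => e; rewrite e in h.
  case: (items_compatible v ik) => [[]//|[/invdist_tangent/tangent_circles_meet[q h] _ _]].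
  by rewrite e in h.
- rewrite -/A AE => C C' [i ->] [k ->] t le; rewrite !TE VE.
  have [ik|ik] := eqVneq i k; first by rewrite ik in t; case: (ext_tangent_neq t).
  case: (items_compatible v ik) => [[h _]|[_ h _]]; last exact: h.
  by move/invdist_tangent: t => t; rewrite t ltxx in h.
Qed.

Lemma segmC (a b : R) : segm a b = segm b a.
Proof. by rewrite /segm minC maxC. Qed.

Lemma apollonian_arc_swap C0 C1 C2 p q K :
  apollonian_arc C0 C1 C2 p q K -> apollonian_arc C0 C2 C1 q p K.
Proof.
move=> [a1 [a2 [g [[[h1 h2 h3] c n h] gp gq ->]]]].
exists a2, a1, g; rewrite /apollonian_curve /angle_range !(segmC a2) /gap /successor_chain.
by rewrite -setUA [closed_disk C2 `|` _]setUC setUA [[set C2; C1]]setUC.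
Qed.

Lemma degenerate_triangle_swap C1 C2 C3 T V :
  degenerate_triangle C1 C2 C3 T V -> degenerate_triangle C1 C3 C2 T V.
Proof.
move=> [p [q [K [u [w [k tp tq -> ->]]]]]]; exists q, p, K, w, u; split=> //.
- exact: apollonian_arc_swap.
- by rewrite -!setUA [line_through p u `|` _]setUC.
- by rewrite setUC.
Qed.

(** Handles triples with clockwise centers, for which [node_exists] supplies a node with two circles
    exchanged. *)
Lemma triangulation_swap C1 C2 C3 S :
  apollonian_triangulation C1 C3 C2 S -> apollonian_triangulation C1 C2 C3 S.
Proof.
have e : [set C1; C3; C2] = [set C1; C2; C3] by rewrite -setUA [[set C3] `|` _]setUC setUA.
move=> [T [V]]; rewrite /inner_packing e => -[[d1 d2 d3] h1 h2 h3 h4].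
exists T, V; split=> //; split; exact: degenerate_triangle_swap.
Qed.

Lemma tangent_triple_triangulation C1 C2 C3 : ext_tangent_triple C1 C2 C3 ->
  exists S, apollonian_triangulation C1 C2 C3 S /\ convex_set (closure S).
Proof.
have tri D1 D2 D3 x y : node D1 D2 D3 x y ->
    exists S, apollonian_triangulation D1 D2 D3 S /\ convex_set (closure S).
  (* The root hexagon is placed at the origin and spanned by the spinors themselves, at scale 1. *)
  move=> n; apply: (@node_triangulation (State D1 D2 D3 x y 0 x y)).
  by split=> //; exists 1; rewrite /= !scale1r.
move=> /node_exists[[x [y /tri//]]|[x [y /tri[S [h c]]]]].
by exists S; split=> //; exact: triangulation_swap.
Qed.

End Triangulation.

Theorem theorem7p1 (R : realType) (A : set (set (option (plane R))))
    (C1 C2 C3 : circle R) :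
  apollonian_packing A ->
  A (sphere_circle C1) -> A (sphere_circle C2) -> A (sphere_circle C3) ->
  ext_tangent_triple C1 C2 C3 ->
  exists S : set (plane R),
    apollonian_triangulation C1 C2 C3 S /\ convex_set (closure S).
Proof. by move=> _ _ _ _; exact: tangent_triple_triangulation. Qed.
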